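(* Let $K$ be the Koenigs linearizer of $A$ at $\tfrac12$: the unique increasing solution of the Schröder equation $K(2u)=A(K(u))$ with $K(0)=\tfrac12$, $K'(0)=1$. Then $K$ extends to a real-analytic increasing bijection $\mathbb{R}\to(0,1)$ and is the distribution function of a symmetric law $\mathcal{K}$ with analytic density. For every $f\in\mathcal{D}_{+}$ with median $m$, $$2^{n}f(m)\,(X_{n}-m)\xrightarrow{\ d\ }\mathcal{K}\qquad(n\to\infty),$$ and if $\mathbb{E}|X|^{\varepsilon}<\infty$ for some $\varepsilon>0$ (where $X\sim f$), all moments of $2^{n}f(m)(X_{n}-m)$ converge to those of $\mathcal{K}$; in particular $$\operatorname{Var}(X_{n})\sim\sigma_{\mathcal{K}}^{2}\,f(m)^{-2}\,4^{-n},\qquad \sigma_{\mathcal{K}}^{2}\approx 0.166,$$ where $\sigma_{\mathcal K}^2$ is the variance of $\mathcal K$. Moreover, $g=1-K$ satisfies the exact tail recursion $g(2u)=A(g(u))$, whence $$-\log\big(1-K(u)\big)=u^{\log_{2}3}\,\Theta(\log_{2}u)\,\big(1+O(u^{-\log_{2}3})\big)\qquad(u\to\infty)$$ for a positive continuous $1$-periodic function $\Theta$. Thus the tails of $\mathcal{K}$ are compressed-exponential with exponent $\log_{2}3$ (lighter than exponential and heavier than Gaussian), the exponent being the ratio of the logarithms of the endpoint degree $3$ and the interior multiplier $2$ of $A$; the excess kurtosis of $\mathcal{K}$ is positive ($\approx0.164$).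
   Context: $\mathcal{D}_{+}$ is the set of probability densities on $\mathbb{R}$ that are continuous and strictly positive on an open interval and vanish outside it; $F(x)=\int_{-\infty}^{x}f$, and $m$ is the unique median, $F(m)=\tfrac12$. The canonical operator is $\rho[f]=2\sin^{2}(\pi F)\,f$, and $A(z)=\int_{0}^{z}2\sin^{2}(\pi s)\,ds=z-\frac{\sin(2\pi z)}{2\pi}$ on $[0,1]$. $X_{n}$ is a random variable with density $f_{n}=\rho^{n}[f]$ ($n$-fold iterate), equivalently with distribution function $A^{\circ n}\circ F$. *)

(* Defs.v *)
From HB Require Import structures.
From mathcomp Require Import all_boot all_order all_algebra.
From mathcomp Require Import all_classical all_reals all_analysis.

Set Implicit Arguments.
Unset Strict Implicit.
Unset Printing Implicit Defensive.

Import Order.TTheory GRing.Theory Num.Theory.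
Import numFieldNormedType.Exports.

Local Open Scope classical_set_scope.
Local Open Scope ring_scope.

Section Densities.
Context {R : realType}.

(* The open interval ]a, b[ may be unbounded. *)
Definition Dplus (f : R -> R) : Prop :=
  exists a b : \bar R,
    [/\ forall x, (a < x%:E < b)%E -> 0 < f x /\ {for x, continuous f},
        forall x, ~~ (a < x%:E < b)%E -> f x = 0
      & (\int[lebesgue_measure]_x (f x)%:E = 1)%E].

Definition density_cdf (f : R -> R) (x : R) : R :=
  Rintegral lebesgue_measure `]-oo, x] f.

Definition is_median (f : R -> R) (m : R) : Prop := density_cdf f m = 2^-1.

Definition rho (f : R -> R) : R -> R :=
  fun x => 2 * sin (pi * density_cdf f x) ^+ 2 * f x.

Definition has_density (mu : set R -> \bar R) (f : R -> R) : Prop :=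
  [/\ measurable_fun setT f, forall x, 0 <= f x
    & forall B : set R, measurable B ->
        (mu B = \int[lebesgue_measure]_(x in B) (f x)%:E)%E].

End Densities.

Section Linearizer.
Context {R : realType}.

(* Meaningful on [0, 1] only, where A z = z - sin (2 pi z) / (2 pi). *)
Definition A (z : R) : R :=
  Rintegral lebesgue_measure `[0, z] (fun s => 2 * sin (pi * s) ^+ 2).

(* K linearizes A at 1/2 on the domain D, a neighbourhood of 0; the first
   clause makes A (K u) meaningful. *)
Definition koenigs_linearizer_on (D : set R) (K : R -> R) : Prop :=
  [/\ forall u, D u -> 0 <= K u <= 1,
      forall u v, D u -> D v -> u < v -> K u < K v,
      forall u, D u -> D (2 * u) -> K (2 * u) = A (K u),
      K 0 = 2^-1
    & is_derive (0 : R) (1 : R) K 1].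

Definition real_analytic (f : R -> R) : Prop :=
  forall x, exists a : nat -> R, exists2 r : R, 0 < r &
    forall h, `|h| < r -> pseries a h @ \oo --> f (x + h).

(* d is the order of contact of h with its fixed points 0 and 1. *)
Definition endpoint_degree (h : R -> R) (d : nat) : Prop :=
  (exists2 c : R, 0 < c & h z / z ^+ d @[z --> 0^'+] --> c) /\
  (exists2 c : R, 0 < c & (1 - h (1 - z)) / z ^+ d @[z --> 0^'+] --> c).

Definition log2 (x : R) : R := ln x / ln 2.

End Linearizer.

Section Laws.
Context {R : realType}.
Implicit Type mu : probability (measurableTypeR R) R.

Definition law_cdf mu (x : R) : \bar R := mu [set y | y <= x].

Definition symmetric_law mu : Prop :=
  forall B : set (measurableTypeR R), measurable B ->
    mu ((fun x => - x) @^-1` B) = mu B.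

(* The probability spaces carrying the Y n may differ. *)
Definition cvg_in_distribution (d : nat -> measure_display)
    (T : forall n, measurableType (d n)) (P : forall n, probability (T n) R)
    (Y : forall n, T n -> R) mu : Prop :=
  forall x : R, {for x, continuous (law_cdf mu)} ->
    P n [set w | Y n w <= x] @[n --> \oo] --> law_cdf mu x.

(* For small n the moment of order k may fail to exist, hence the
   eventual integrability. *)
Definition cvg_moments (d : nat -> measure_display)
    (T : forall n, measurableType (d n)) (P : forall n, probability (T n) R)
    (Y : forall n, T n -> R) mu : Prop :=
  forall k : nat,
    [/\ mu.-integrable setT (fun x => (x ^+ k)%:E),
        \forall n \near \oo,
          (P n).-integrable setT (fun w => (Y n w ^+ k)%:E)
      & ('E_(P n)[fun w => (Y n w ^+ k)%R])%E @[n --> \oo] -->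
        ('E_mu[fun x => (x ^+ k)%R])%E].

Definition law_mean mu : R := fine ('E_mu[fun x => x])%E.

Definition law_variance mu : R := fine ('V_mu[fun x => x])%E.

Definition excess_kurtosis mu : R :=
  fine ('E_mu[fun x => ((x - law_mean mu) ^+ 4)%R])%E / law_variance mu ^+ 2
  - 3.

Definition law_tail mu (u : R) : R := fine (mu [set x | u < `|x|]).

Definition compressed_exponential_tails mu (a : R) : Prop :=
  1 < a /\
  exists c1 c2 : R, [/\ 0 < c1, 0 < c2 &
    \forall u \near +oo,
      expR (- (c2 * u `^ a)) <= law_tail mu u <= expR (- (c1 * u `^ a))].

Definition lighter_than_exponential mu : Prop :=
  forall c : R, 0 < c -> law_tail mu u / expR (- (c * u)) @[u --> +oo] --> 0.

Definition heavier_than_gaussian mu : Prop :=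
  forall c : R, 0 < c ->
    expR (- (c * u ^+ 2)) / law_tail mu u @[u --> +oo] --> 0.

End Laws.

(* Main.v *)
Require Import Defs.
From HB Require Import structures.
From mathcomp Require Import all_boot all_order all_algebra.
From mathcomp Require Import all_classical all_reals all_analysis.
From mathcomp Require Import measurable_realfun.
From Stdlib Require Import ZArith.
From mathcomp Require Import ssrnat ring lra zify ssrZ.

Set Implicit Arguments.
Unset Strict Implicit.
Unset Printing Implicit Defensive.

Import Order.TTheory GRing.Theory Num.Theory.
Import numFieldNormedType.Exports.

Local Open Scope classical_set_scope.
Local Open Scope ring_scope.

(** Write A (1/2 + y) = 1/2 + B y with B y = y + sin (2 pi y) / (2 pi), an odd map that
    doubles lengths near its fixed point 0. An iterate of rho has distribution function
    1/2 + B^n (F - 1/2) (cdf_iter_rho), and F - 1/2 is close to f m * (x - m) near the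
    median, so after rescaling by 2 ^ n * f m the distribution function at y is about
    1/2 + B^n (y / 2 ^ n). The limit of B^n (y / 2 ^ n) is the linearizer phi of B, the
    solution of phi (2 u) = B (phi u) with phi' 0 = 1, and K = 1/2 + phi
    (iter_Bmap_cvg).

    The equation determines the Taylor coefficients of phi one by one. Comparison with
    the series of absolute values of B bounds them near 0; as B is entire, the doubling
    equation then doubles the radius of convergence again and again, so phi is entire
    (koenigs_entire). Everything else about phi and its derivative kappa also spreads
    from a neighbourhood of 0 by doubling: |phi| < 1/2, kappa > 0, and uniqueness of K
    as a germ. Differentiating gives kappa (2 u) = cos (pi phi u) ^ 2 * kappa u, hence
    kappa is, up to a factor tending to 1, the product of the squared cosines along an
    orbit of B, and it decreases on the positive half-line.

    Convergence of moments (moment_cvg): the density of the rescaled iterate is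
    f (m + y / s_n) / f m times the same kind of product of squared cosines. Close to m
    this product is at most a constant times kappa (y / 2), since the orbit stays
    further from 0 than an orbit of phi; dominated convergence applies because kappa
    decays faster than any power. Far from m, with q the distance of F x to the nearer
    of 0 and 1, the factor number j is at most q * t_j where t_j decays
    super-exponentially. Finitely many factors q absorb |x - m| ^ k, by Markov's
    inequality for the moment of order eps; the product of the t_j beats the powers of
    2 ^ n that come from the rescaling.

    Tails: with g = 1 - K one has g (2 u) = A (g u), and A z is of exact order z ^ 3 at
    0, so L = - log g satisfies L (2 u) = 3 L u + O(1). Hence 3 ^ - n * L (2 ^ n u)
    converges to a limit Lambda within a bounded distance of L, Lambda (2 u) =
    3 * Lambda u, and Lambda u = u ^ (log2 3) * Theta (log2 u) with Theta of period 1.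

    Variance and kurtosis: in the variable v = 2 pi u the equation reads
    psi (2 v) = psi v + sin (psi v). The truncated moments of psi' are bracketed on each
    cell of a dyadic mesh by inequalities that need the values of psi at the nodes only,
    because psi' decreases. Nodes on [2 ^ j a, 2 ^ (j + 1) a] are images of nodes on
    [a, 2 a], where the Taylor polynomial of psi is precise enough; they are computed in
    integer fixed-point arithmetic with a proved error bound for the sine. What is left,
    below a and above the last node, is bounded by hand. *)

(** * Entire power series *)
Section EntireSeries.
Context {R : realType}.
Implicit Types (a : nat -> R) (x r : R).

(** The bound on the sums, rather than convergence, is what the recursion on the coefficients
    of the linearizer provides. *)
Definition entire_series a : Prop :=
  forall r, 0 <= r -> exists M, forall n, \sum_(i < n) `|a i| * r ^+ i <= M.

Definition series_fun a x : R := limn (pseries a x).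

Lemma entire_cvg_norm a x : entire_series a ->
  cvgn [series `|a i * x ^+ i|]_i.
Proof.
move=> /(_ _ (normr_ge0 x))[M aM].
apply: nondecreasing_is_cvgn.
  by apply: nondecreasing_series => n _ _; exact: normr_ge0.
exists M => _ [n _ <-] /=; rewrite /series /= big_mkord.
by apply: le_trans (aM n); apply: ler_sum => i _; rewrite normrM normrX.
Qed.

Lemma entire_cvg a x : entire_series a -> cvgn (pseries a x).
Proof. by move=> ha; apply: normed_cvg; exact: entire_cvg_norm. Qed.

Lemma entire_cvg_to a x : entire_series a ->
  pseries a x @ \oo --> series_fun a x.
Proof. exact: entire_cvg. Qed.

Lemma entire_diffs a : entire_series a -> entire_series (pseries_diffs a).
Proof.
move=> ha r r0; pose s := 2 * (r + 1).
have s0 : 0 <= s by rewrite /s; lra.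
have [M aM] := ha _ s0; exists M => n.
apply: le_trans (aM n.+1); rewrite big_ord_recl /= expr0 mulr1.
apply: ler_wpDl => //; apply: ler_sum => i _; rewrite /pseries_diffs /bump /= add1n.
rewrite normrM [`|_| * `|a _|]mulrC -mulrA ler_wpM2l//.
rewrite /s exprMn ler_pM ?exprn_ge0//.
  by rewrite ger0_norm// -natrX ler_nat ltnW// ltn_expl.
rewrite exprS -[leLHS]mul1r ler_pM ?exprn_ge0//; first lra.
by rewrite lerXn2r ?nnegrE//; lra.
Qed.

Lemma series_fun_derive a x : entire_series a ->
  is_derive x (1 : R) (series_fun a) (series_fun (pseries_diffs a) x).
Proof.
move=> ha; have hd := entire_diffs ha.
apply: (@pseries_snd_diffs _ a (`|x| + 1)); try exact: entire_cvg.
  exact/entire_cvg/entire_diffs.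
by rewrite (@ger0_norm _ (`|x| + 1)) ?ltrDl// addr_ge0.
Qed.

(** The tail of the series of absolute values does not depend on x, so the convergence is uniform
    on |x| <= r. *)
Lemma pseries_tail a x r n : entire_series a -> `|x| <= r ->
  `|series_fun a x - pseries a x n| <=
  limn [series `|a i| * r ^+ i]_i - [series `|a i| * r ^+ i]_i n.
Proof.
move=> ha xr; have r0 : 0 <= r by exact: le_trans xr.
pose S := [series `|a i| * r ^+ i]_i.
have Scvg : cvgn S.
  have := @entire_cvg_norm a r ha.
  by under eq_fun do rewrite normrM normrX (ger0_norm r0).
have lhs : (fun m => `|pseries a x m - pseries a x n|) @ \oo -->
    `|series_fun a x - pseries a x n|.
  by apply: cvg_norm; apply: cvgB; [exact: entire_cvg_to|exact: cvg_cst].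
have rhs : (fun m => S m - S n) @ \oo --> limn S - S n.
  by apply: cvgB => //; exact: cvg_cst.
rewrite -(cvg_lim _ lhs)// -(cvg_lim _ rhs)//.
apply: ler_lim; [by apply/cvg_ex; eexists; exact: lhs
  |by apply/cvg_ex; eexists; exact: rhs|].
near=> m; have nm : (n <= m)%N by near: m; exact: nbhs_infty_ge.
rewrite /S /pseries !sub_series_geq// (le_trans (ler_norm_sum _ _ _))//.
apply: ler_sum => i _; rewrite normrM normrX ler_wpM2l//.
by rewrite lerXn2r ?nnegrE.
Unshelve. all: by end_near. Qed.

Lemma series_fun0 a : series_fun a 0 = a 0%N.
Proof.
apply: lim_near_cst => //; near=> n.
have n0 : (0 < n)%N by near: n; exact: nbhs_infty_gt.
rewrite /pseries /= /series /= -(prednK n0) big_nat_recl//= expr0 mulr1.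
by rewrite big1 ?addr0// => i _; rewrite exprS mul0r mulr0.
Unshelve. all: by end_near. Qed.

Lemma series_fun_continuous a : entire_series a -> continuous (series_fun a).
Proof.
move=> ha x; apply/differentiable_continuous/derivable1_diffP.
by have [] := series_fun_derive x ha.
Qed.

Definition partial_poly a n : {poly R} := \poly_(i < n) a i.

Lemma horner_partial_poly a n x : (partial_poly a n).[x] = pseries a x n.
Proof. by rewrite horner_poly /pseries /series /= big_mkord. Qed.

(** Cauchy's majorants, for polynomials; the relation is compatible with the operations from
    which a composition is built. *)
Definition poly_majorant (p q : {poly R}) := forall i, `|p`_i| <= q`_i.

Lemma majorant0 : poly_majorant 0 0.
Proof. by move=> i; rewrite !coef0 normr0. Qed.

Lemma majorantD p p' q q' : poly_majorant p p' -> poly_majorant q q' ->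
  poly_majorant (p + q) (p' + q').
Proof.
by move=> hp hq i; rewrite !coefD (le_trans (ler_normD _ _))// lerD.
Qed.

Lemma majorantM p p' q q' : poly_majorant p p' -> poly_majorant q q' ->
  poly_majorant (p * q) (p' * q').
Proof.
move=> hp hq i; rewrite !coefM (le_trans (ler_norm_sum _ _ _))//.
by apply: ler_sum => j _; rewrite normrM ler_pM.
Qed.

Lemma majorantZ p p' c : poly_majorant p p' -> poly_majorant (c *: p) (`|c| *: p').
Proof. by move=> hp i; rewrite !coefZ normrM ler_wpM2l. Qed.

Lemma majorantX p p' n : poly_majorant p p' -> poly_majorant (p ^+ n) (p' ^+ n).
Proof.
move=> hp; elim: n => [|n IH].
  by rewrite !expr0 => i; rewrite !coef1 ger0_norm.
by rewrite !exprS; exact: majorantM.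
Qed.

Lemma majorant_sum n (p p' : nat -> {poly R}) :
  (forall i, poly_majorant (p i) (p' i)) ->
  poly_majorant (\sum_(i < n) p i) (\sum_(i < n) p' i).
Proof.
move=> h; elim/big_ind2: _ => [|? ? ? ?|i _]; [exact: majorant0|exact: majorantD|].
exact: h.
Qed.

Lemma majorant_sum_norm p q r n : 0 <= r -> poly_majorant p q ->
  \sum_(i < n) `|p`_i| * r ^+ i <= q.[r].
Proof.
move=> r0 h; have q0 i : 0 <= q`_i by exact: le_trans (h i).
apply: (@le_trans _ _ (\sum_(i < maxn n (size q)) q`_i * r ^+ i)).
  apply: (@le_trans _ _ (\sum_(i < maxn n (size q)) `|p`_i| * r ^+ i)).
    rewrite -!(big_mkord xpredT (fun i => `|p`_i| * r ^+ i)).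
    rewrite [leRHS](@big_cat_nat _ _ _ n)//= ?leq_maxl// lerDl.
    by apply: sumr_ge0 => i _; rewrite mulr_ge0 ?exprn_ge0.
  by apply: ler_sum => i _; rewrite ler_wpM2r ?exprn_ge0.
rewrite -[leRHS]/(q.[r]) [q.[r]](@horner_coef_wide _ (maxn n (size q))) ?leq_maxr//.
Qed.

Definition abs_poly (p : {poly R}) : {poly R} := \poly_(i < size p) `|p`_i|.

Lemma coef_abs_poly p i : (abs_poly p)`_i = `|p`_i|.
Proof.
rewrite coef_poly; case: ltnP => // h.
by rewrite nth_default// normr0.
Qed.

Lemma majorant_abs p : poly_majorant p (abs_poly p).
Proof. by move=> i; rewrite coef_abs_poly. Qed.

Lemma horner_abs_poly (p : {poly R}) r n : (size p <= n)%N ->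
  (abs_poly p).[r] = \sum_(i < n) `|p`_i| * r ^+ i.
Proof.
move=> h; rewrite (@horner_coef_wide _ n) ?(leq_trans (size_poly _ _))//.
by apply: eq_bigr => i _; rewrite coef_abs_poly.
Qed.

Lemma majorant_horner p q x r : `|x| <= r -> poly_majorant p q -> `|p.[x]| <= q.[r].
Proof.
move=> xr h; apply: le_trans (majorant_sum_norm (size p) (le_trans (normr_ge0 x) xr) h).
rewrite horner_coef (le_trans (ler_norm_sum _ _ _))//.
apply: ler_sum => i _; rewrite normrM normrX ler_wpM2l// lerXn2r ?nnegrE//.
exact: le_trans xr.
Qed.

(** The Taylor coefficients at x of the partial sums are Cauchy sequences; their limits are the
    Taylor coefficients of the sum. All errors are controlled by tails of the series of
    absolute values at |x| + |h|. *)
Lemma entire_real_analytic a : entire_series a -> real_analytic (series_fun a).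
Proof.
move=> ha x; pose c n k : R := (partial_poly a n)^`N(k).[x].
have cE n h m : (n <= m)%N -> (partial_poly a n).[x + h] = \sum_(k < m) c n k * h ^+ k.
  move=> nm; rewrite nderiv_taylor//; last exact: mulrC.
  rewrite -!(big_mkord xpredT (fun k => (partial_poly a n)^`N(k).[x] * h ^+ k)).
  rewrite [RHS](@big_cat_nat _ _ _ (size (partial_poly a n)))//=; last first.
    by rewrite (leq_trans (size_poly _ _)).
  rewrite [X in _ = _ + X]big_nat_cond [X in _ = _ + X]big1 ?addr0// => i.
  rewrite andbT => /andP[ni _].
  by rewrite nderivn_poly0 ?horner0 ?mul0r.
(* The increments of the k-th Taylor coefficient are summable in n: the polynomial p of the
   terms n to m - 1 is majorized by abs_poly p, whose Taylor expansion at |x| has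
   nonnegative coefficients. *)
have key n m r K : (n <= m)%N -> 0 <= r ->
    \sum_(k < K) `|c m k - c n k| * r ^+ k <=
    \sum_(n <= i < m) `|a i| * (`|x| + r) ^+ i.
  move=> nm r0.
  pose p := partial_poly a m - partial_poly a n.
  have pcoef i : p`_i = if (n <= i < m)%N then a i else 0.
    rewrite coefB !coef_poly; case: (ltnP i m) => im; case: (ltnP i n) => inn /=;
      rewrite ?subrr ?subr0 ?andbF//.
    by move: (leq_trans inn nm); rewrite ltnNge im.
  have -> : \sum_(n <= i < m) `|a i| * (`|x| + r) ^+ i = (abs_poly p).[`|x| + r].
    rewrite (@horner_abs_poly _ _ m); last first.
      by apply/leq_sizeP => j mj; rewrite pcoef (ltnNge j) mj andbF.
    rewrite -(big_mkord xpredT (fun i => `|p`_i| * (`|x| + r) ^+ i)).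
    rewrite [RHS](@big_cat_nat _ _ _ n)//= [X in _ = X + _]big_nat_cond.
    rewrite [X in _ = X + _]big1 ?add0r; last first.
      move=> i; rewrite andbT => /andP[_ h]; rewrite pcoef leqNgt h/=.
      by rewrite normr0 mul0r.
    rewrite [LHS]big_nat_cond [RHS]big_nat_cond; apply: eq_bigr => i.
    by rewrite andbT pcoef => ->.
  have mj k : `|(p^`N(k)).[x]| <= (abs_poly p)^`N(k).[`|x|].
    apply: majorant_horner => // i; rewrite !coef_nderivn coef_abs_poly.
    by rewrite normrMn.
  rewrite nderiv_taylor; last exact: mulrC.
  pose N := maxn K (size (abs_poly p)).
  have ge0 k : 0 <= (abs_poly p)^`N(k).[`|x|] by exact: le_trans (mj k).
  apply: (@le_trans _ _ (\sum_(k < N) (abs_poly p)^`N(k).[`|x|] * r ^+ k)).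
    rewrite -!(big_mkord xpredT (fun i => (abs_poly p)^`N(i).[`|x|] * r ^+ i)).
    rewrite [leRHS](@big_cat_nat _ _ _ K)//= ?leq_maxl// big_mkord.
    apply: ler_wpDr; first by apply: sumr_ge0 => i _; rewrite mulr_ge0 ?exprn_ge0.
    apply: ler_sum => k _; rewrite ler_wpM2r ?exprn_ge0//.
    by rewrite /c -hornerN -hornerD -nderivnB.
  rewrite -!(big_mkord xpredT (fun i => (abs_poly p)^`N(i).[`|x|] * r ^+ i)).
  rewrite [leLHS](@big_cat_nat _ _ _ (size (abs_poly p)))//= ?leq_maxr//.
  rewrite [X in _ + X]big_nat_cond [X in _ + X]big1 ?addr0//.
  move=> i; rewrite andbT => /andP[h _].
  by rewrite nderivn_poly0 ?horner0 ?mul0r.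

have absC r : 0 <= r -> cvgn [series `|a i| * r ^+ i]_i.
  move=> r0; have := @entire_cvg_norm a r ha.
  by under eq_fun do rewrite normrM normrX (ger0_norm r0).
have ccvg k : cvgn (c ^~ k).
  have -> : c ^~ k = fun n => series (telescope (c ^~ k)) n + c 0%N k.
    by apply/funext => n; rewrite telescopeK /= subrK.
  apply: is_cvgD; last exact: is_cvg_cst.
  apply: normed_cvg.
  apply: (@series_le_cvg _ _ (fun i => `|a i| * (`|x| + 1) ^+ i)) => [i|i|i|].
  - exact: normr_ge0.
  - by rewrite mulr_ge0 ?exprn_ge0 ?addr_ge0.
  - have := @key i i.+1 1 k.+1 (leqnSn i) ler01.
    rewrite big_nat1 big_ord_recr /= expr1n mulr1; apply: le_trans.
    rewrite /telescope /=; apply: ler_wpDl => //.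
    by apply: sumr_ge0 => j _; rewrite expr1n mulr1.
  - by apply: absC; rewrite addr_ge0.
exists (fun k => limn (c ^~ k)), 1 => // h _.
pose S n := \sum_(0 <= i < n) `|a i| * (`|x| + `|h|) ^+ i.
have Scvg : S @ \oo --> limn S by apply: absC; rewrite addr_ge0.
have SE n m : (n <= m)%N -> \sum_(n <= i < m) `|a i| * (`|x| + `|h|) ^+ i = S m - S n.
  by move=> nm; rewrite /S [X in _ = X - _](@big_cat_nat _ _ _ n)//= addrAC subrr add0r.
(* Only the coefficients, not the argument, differ between the two sums. *)
have main n : `|(partial_poly a n).[x + h] - pseries (fun k => limn (c ^~ k)) h n|
    <= limn S - S n.
  rewrite (cE n h n (leqnn n)) /pseries /series /= big_mkord -sumrB.
  have lhs : (fun m => \sum_(k < n) `|c m k - c n k| * `|h| ^+ k) @ \oo -->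
     \sum_(k < n) `|limn (c ^~ k) - c n k| * `|h| ^+ k.
    apply: cvg_big => [|k _]; first exact: add_continuous.
    apply: cvgM; last exact: cvg_cst; apply: cvg_norm.
    by apply: cvgB; [exact: ccvg|exact: cvg_cst].
  apply: (@le_trans _ _ (\sum_(k < n) `|limn (c ^~ k) - c n k| * `|h| ^+ k)).
    rewrite (le_trans (ler_norm_sum _ _ _))//; apply: ler_sum => k _.
    by rewrite -mulrBl normrM normrX distrC.
  have rhs : (fun m => S m - S n) @ \oo --> limn S - S n.
    by apply: cvgB => //; exact: cvg_cst.
  rewrite -(cvg_lim _ lhs)// -(cvg_lim _ rhs)//.
  apply: ler_lim; [by apply/cvg_ex; eexists; exact: lhs
    |by apply/cvg_ex; eexists; exact: rhs|].
  near=> m; have nm : (n <= m)%N by near: m; exact: nbhs_infty_ge.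
  by rewrite -SE//; exact: key.
have d0 : (fun n => (partial_poly a n).[x + h] -
    pseries (fun k => limn (c ^~ k)) h n) @ \oo --> (0 : R).
  apply: norm_cvg0; apply: (@squeeze_cvgr _ _ _ _ (cst 0) (fun n => limn S - S n)).
  - by near=> n; rewrite normr_ge0 main.
  - exact: cvg_cst.
  - by rewrite -[X in _ --> X](subrr (limn S)); apply: cvgB => //; exact: cvg_cst.
have -> : pseries (fun k => limn (c ^~ k)) h = fun n => pseries a (x + h) n -
   ((partial_poly a n).[x + h] - pseries (fun k => limn (c ^~ k)) h n).
  by apply/funext => n; rewrite horner_partial_poly opprB addrC subrK.
rewrite -[X in _ --> X]subr0; apply: cvgB => //; exact: entire_cvg_to.
Unshelve. all: by end_near. Qed.

(** Diagonal convergence: a convergent argument may be inserted in the partial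
    sums of an entire series. *)
Lemma entire_cvg_diag a (p : nat -> R) (l : R) : entire_series a ->
  p @ \oo --> l -> (fun n => pseries a (p n) n) @ \oo --> series_fun a l.
Proof.
move=> ha pl; pose r := `|l| + 1; pose S := [series `|a i| * r ^+ i]_i.
have r0 : 0 <= r by rewrite addr_ge0.
have Scvg : S @ \oo --> limn S.
  have := @entire_cvg_norm a r ha.
  by under eq_fun do rewrite normrM normrX (ger0_norm r0).
have h1 : series_fun a (p n) @[n --> \oo] --> series_fun a l.
  by apply: continuous_cvg => //; exact: series_fun_continuous.
have d0 : (fun n => series_fun a (p n) - pseries a (p n) n) @ \oo --> (0 : R).
  apply: norm_cvg0; apply: (@squeeze_cvgr _ _ _ _ (cst 0) (fun n => limn S - S n)).
  - near=> n; rewrite normr_ge0/=; apply: pseries_tail => //.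
    near: n; have /cvgrPdist_le/(_ 1 ltr01) := pl.
    apply: filterS => n; rewrite distrC => h.
    by rewrite -(subrK l (p n)) (le_trans (ler_normD _ _))// addrC lerD2l.
  - exact: cvg_cst.
  - by rewrite -[X in _ --> X](subrr (limn S)); apply: cvgB => //; exact: cvg_cst.
have -> : (fun n => pseries a (p n) n) = fun n => series_fun a (p n) -
   (series_fun a (p n) - pseries a (p n) n).
  by apply/funext => n; rewrite opprB addrC subrK.
by rewrite -[X in _ --> X]subr0; apply: cvgB.
Unshelve. all: by end_near. Qed.

End EntireSeries.

(** * Koenigs linearizer of an entire map *)
Section Koenigs.
Context {R : realType}.
Variable b : nat -> R.
Hypotheses (hb : entire_series b) (b0 : b 0%N = 0) (b1 : b 1%N = 2).

Definition comp_trunc m (p : {poly R}) : {poly R} :=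
  \sum_(j < m.+1) b j *: p ^+ j.

(** Step n + 1 adds the monomial that makes the equation P (2 X) = b (P X) hold up to degree
    n + 2: it changes the coefficient of that degree by 2 ^ (n + 2) on the left and by b 1 = 2
    on the right. *)
Fixpoint koenigs_poly n : {poly R} :=
  if n is n'.+1 then
    koenigs_poly n' + ((comp_trunc n'.+2 (koenigs_poly n'))`_n'.+2 /
      (2 ^+ n'.+2 - 2)) *: 'X^(n'.+2)
  else 'X.

Definition koenigs_coef i := (koenigs_poly i)`_i.

(** A monomial of degree k reaches the coefficients of degree at most k only through the linear
    term, as p has no constant term. *)
Lemma coef_exp_addX (p : {poly R}) c k j i : p.[0] = 0 -> (0 < k)%N -> (i <= k)%N ->
  ((p + c *: 'X^k) ^+ j)`_i = (p ^+ j)`_i + c * ((i == k) && (j == 1%N))%:R.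
Proof.
move=> p0 k0 ik; set q := p + _.
have q0 : q.[0] = 0 by rewrite hornerD hornerZ hornerXn p0 expr0n gtn_eqF// mulr0 addr0.
rewrite -[q ^+ j](subrK (p ^+ j)) coefD addrC subrXX; congr (_ + _).
have -> : q - p = c *: 'X^k by rewrite /q addrAC subrr add0r.
rewrite -scalerAl coefZ coefXnM; congr (c * _).
case: ltngtP ik => //= ->; rewrite ?subnn ?mulr0// => _.
rewrite -horner_coef0 horner_sum; case: j => [|[|j]].
- by rewrite big_ord0.
- by rewrite big_ord1 /= subnn !expr0 mulr1 hornerC.
rewrite big1// => -[l lj] _ /=; rewrite hornerM !horner_exp q0 p0 -exprD subnK//.
by rewrite expr0n.
Qed.

Lemma coef_exp_small (p : {poly R}) j i : p.[0] = 0 -> (i < j)%N -> (p ^+ j)`_i = 0.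
Proof.
move=> /eqP; rewrite -/(root p 0) => /factor_theorem[q ->] ij.
by rewrite subr0 exprMn coefMXn ij.
Qed.

Lemma coef_comp_trunc (p : {poly R}) m k i : p.[0] = 0 -> (i <= m)%N -> (m <= k)%N ->
  (comp_trunc k p)`_i = (comp_trunc m p)`_i.
Proof.
move=> p0 im mk; rewrite /comp_trunc -!(big_mkord xpredT (fun j => b j *: p ^+ j)).
rewrite (@big_cat_nat _ _ _ m.+1)//= coefD [X in _ + X]coef_sum.
rewrite [X in _ + X]big_nat_cond [X in _ + X]big1 ?addr0// => j; rewrite andbT => /andP[mj _].
by rewrite coefZ coef_exp_small ?mulr0// (leq_ltn_trans im).
Qed.

Lemma koenigs_poly0 n : (koenigs_poly n).[0] = 0.
Proof.
by elim: n => [|n IH] /=; rewrite ?hornerX// hornerD IH hornerZ hornerXn expr0n mulr0 addr0.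
Qed.

Lemma coef_koenigs_poly_large n i : (n.+1 < i)%N -> (koenigs_poly n)`_i = 0.
Proof.
elim: n => [|n IH] /= ni; first by rewrite coefX gtn_eqF.
by rewrite coefD IH 1?ltnW// coefZ coefXn gtn_eqF// mulr0 addr0.
Qed.

Lemma coef_koenigs_poly n i : (i <= n.+1)%N -> (koenigs_poly n)`_i = koenigs_coef i.
Proof.
have stable k d : (i <= k.+1)%N -> (koenigs_poly (k + d))`_i = (koenigs_poly k)`_i.
  move=> ik; elim: d => [|d IH]; first by rewrite addn0.
  rewrite addnS /= coefD IH coefZ coefXn ltn_eqF ?mulr0 ?addr0//.
  by rewrite ltnS (leq_trans ik)// ltnS leq_addr.
move=> ni; rewrite /koenigs_coef; case: (leqP i n) => h.
  by rewrite -(subnKC h) stable.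
have e : i = n.+1 by apply/eqP; rewrite eqn_leq ni.
by rewrite -(stable n 1%N ni) addn1 e.
Qed.

Lemma koenigs_poly_partial n : koenigs_poly n = partial_poly koenigs_coef n.+2.
Proof.
apply/polyP => i; rewrite coef_poly; case: ltnP => h.
  by rewrite coef_koenigs_poly.
by rewrite coef_koenigs_poly_large.
Qed.

Lemma coef_comp_koenigs_poly n m i : (i <= n.+1)%N -> (i <= m)%N ->
  (comp_trunc m (koenigs_poly n))`_i = 2 ^+ i * (koenigs_poly n)`_i.
Proof.
elim: n m i => [|n IH] m i /= ni im.
  rewrite /comp_trunc coef_sum.
  have im' : (i < m.+1)%N by [].
  rewrite (bigD1 (Ordinal im'))//= coefZ coefXn eqxx mulr1 big1 ?addr0.
    by case: i ni im im' => [|[|]]//; rewrite coefX ?b0 ?b1 ?mulr0// expr1 mulr1.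
  move=> j /negP ji; rewrite coefZ coefXn; case: eqP; rewrite ?mulr0// => ij.
  by exfalso; apply: ji; apply/eqP/val_inj.
set c := _ / _; have p0 := koenigs_poly0 n.
have -> : (comp_trunc m (koenigs_poly n + c *: 'X^(n.+2)))`_i =
    (comp_trunc m (koenigs_poly n))`_i + 2 * c * (i == n.+2)%:R.
  rewrite /comp_trunc !coef_sum.
  under eq_bigr => j _ do rewrite coefZ coef_exp_addX// mulrDr -coefZ.
  rewrite big_split /=; congr (_ + _).
  have [ii|] := eqVneq i n.+2; last by move=> _; rewrite big1 ?mulr0// => j _; rewrite !mulr0.
  have m1 : (1 < m.+1)%N by rewrite ltnS (leq_trans _ im)// ii.
  rewrite (bigD1 (Ordinal m1))//= mulr1 b1 big1 ?addr0 ?mulr1// => j /negP j1.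
  case: eqP; rewrite ?mulr0// => hj; exfalso; apply: j1; exact/eqP/val_inj.
rewrite coefD coefZ coefXn; have [ii|ii] := eqVneq i n.+2; last first.
  by rewrite !mulr0 !addr0 IH// -ltnS ltn_neqAle ii.
rewrite mulr1 coef_koenigs_poly_large ?ii// add0r mulr1.
rewrite (@coef_comp_trunc _ n.+2)// -?ii// ?ii//.
have h : (2 ^+ n.+2 - 2 : R) != 0.
  by rewrite subr_eq0 -natrX eqr_nat -[X in _ != X]expn1 eqn_exp2l.
by rewrite /c; field.
Qed.

Lemma koenigs_coef0 : koenigs_coef 0 = 0.
Proof. by rewrite /koenigs_coef coefX. Qed.

Lemma koenigs_coef1 : koenigs_coef 1 = 1.
Proof. by rewrite -(@coef_koenigs_poly 0)//= coefX. Qed.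

Lemma majorant_comp_trunc m (p : {poly R}) :
  poly_majorant (comp_trunc m p) (\sum_(j < m.+1) `|b j| *: abs_poly p ^+ j).
Proof.
apply: (@majorant_sum _ _ (fun j => b j *: p ^+ j) (fun j => `|b j| *: abs_poly p ^+ j)).
by move=> i; apply/majorantZ/majorantX/majorant_abs.
Qed.

(** For the powers of order at least 2 of b, comparison at radius r gives
    (2 ^ i - 2) |a_i| r ^ i summing to at most C (2 r) ^ 2, which is below 2 r when r is small. *)
Lemma koenigs_small : exists2 r, 0 < r &
  forall n, \sum_(i < n) `|koenigs_coef i| * r ^+ i <= 2 * r.
Proof.
have [C bC] := hb ler01.
have C0 : 0 <= C by have := bC 0%N; rewrite big_ord0.
(* The bound 2 * r is reproduced by the induction if 2 * C * r <= 1. *)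
pose r := (2 * (C + 1))^-1.
have r0 : 0 < r by rewrite invr_gt0; lra.
have rC : 2 * C * r <= 1.
  rewrite /r -[leRHS](@mulfV _ (2 * (C + 1))) ?ler_pM2r ?invr_gt0//; lra.
have r1 : 2 * r <= 1.
  by rewrite /r invfM mulrA mulfV ?mul1r ?invf_le1; lra.
have key n : (abs_poly (koenigs_poly n)).[r] <= 2 * r.
  elim: n => [|n IH].
    rewrite (@horner_abs_poly _ _ _ 2) ?size_polyX//= !big_ord_recr big_ord0 /=.
    by rewrite !coefX/= normr0 normr1 !mul0r !add0r mul1r expr1; lra.
  set y := (abs_poly _).[r] in IH.
  have y0 : 0 <= y.
    rewrite /y (@horner_abs_poly _ _ _ n.+2) ?koenigs_poly_partial ?size_poly//.
    by apply: sumr_ge0 => i _; rewrite mulr_ge0 ?exprn_ge0// ltW.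
  rewrite (@horner_abs_poly _ _ _ n.+3); last by rewrite koenigs_poly_partial size_poly.
  have -> : \sum_(i < n.+3) `|(koenigs_poly n.+1)`_i| * r ^+ i =
      r + \sum_(i < n.+1) `|koenigs_coef i.+2| * r ^+ i.+2.
    rewrite (eq_bigr (fun i : 'I__ => `|koenigs_coef i| * r ^+ i)); last first.
      by move=> i _; rewrite coef_koenigs_poly// -ltnS.
    rewrite 2!big_ord_recl /= koenigs_coef0 normr0 mul0r add0r /bump /= koenigs_coef1.
    by rewrite normr1 mul1r expr1.
  suff : \sum_(i < n.+1) `|koenigs_coef i.+2| * r ^+ i.+2 <= r.
    by rewrite (mulrDl 1 1) !mul1r lerD2l.
  (* The part of b of order at least 2, evaluated at the current polynomial. *)
  pose d := \sum_(i < n.+1) b i.+2 *: (koenigs_poly n) ^+ i.+2.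
  have dmaj : poly_majorant d (\sum_(i < n.+1) `|b i.+2| *: (abs_poly (koenigs_poly n)) ^+ i.+2).
    apply: (@majorant_sum _ _ (fun i => b i.+2 *: koenigs_poly n ^+ i.+2)
      (fun i => `|b i.+2| *: abs_poly (koenigs_poly n) ^+ i.+2)) => i.
    by apply/majorantZ/majorantX/majorant_abs.
  have dE i : (i <= n.+2)%N -> (2 <= i)%N -> d`_i = (2 ^+ i - 2) * koenigs_coef i.
    move=> ni i2.
    have -> : d = comp_trunc n.+2 (koenigs_poly n) - 2 *: koenigs_poly n.
      rewrite /comp_trunc 2!big_ord_recl /= expr0 b0 scale0r add0r /bump /= b1 expr1.
      by rewrite addrAC subrr add0r.
    rewrite coefB coefZ; move: ni; rewrite leq_eqVlt => /predU1P[->|ni].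
      rewrite (@coef_koenigs_poly_large _ n.+2)// mulr0 subr0.
      rewrite -(@coef_koenigs_poly n.+1)//= coefD coef_koenigs_poly_large// add0r.
      rewrite coefZ coefXn eqxx mulr1 mulrC divfK//.
      by rewrite subr_eq0 -natrX eqr_nat -[X in _ != X]expn1 eqn_exp2l.
    by rewrite coef_comp_koenigs_poly ?coef_koenigs_poly ?mulrBl// ltnW.
  have s1 : \sum_(i < n.+1) `|koenigs_coef i.+2| * r ^+ i.+2 <=
     2^-1 * \sum_(i < n.+3) `|d`_i| * r ^+ i.
    rewrite [in leRHS]big_ord_recl [in leRHS]big_ord_recl /= mulrDr; apply: ler_wpDl; first by rewrite !mulr_ge0.
    rewrite mulrDr; apply: ler_wpDl; first by rewrite !mulr_ge0// exprn_ge0// ltW.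
    rewrite mulr_sumr; apply: ler_sum => i _.
    have ii : (i.+2 <= n.+2)%N := ltn_ord i.
    rewrite /bump /= !add1n (dE i.+2 ii isT) [in leRHS]mulrA.
    apply: ler_wpM2r; first by rewrite exprn_ge0// ltW.
    rewrite normrM mulrA ler_peMl// ler_pdivlMl// mulr1.
    rewrite ger0_norm ?exprS.
      have : 1 <= (2 ^+ i : R) by rewrite exprn_ege1// ler1n.
      lra.
    have : 1 <= (2 ^+ i : R) by rewrite exprn_ege1// ler1n.
    lra.
  apply: (le_trans s1).
  have s2 := majorant_sum_norm n.+3 (ltW r0) dmaj.
  apply: (@le_trans _ _ (2^-1 * (C * (2 * r) ^+ 2))); last first.
    have -> : 2^-1 * (C * (2 * r) ^+ 2) = (2 * C * r) * r by field.
    by rewrite ler_piMl// ltW.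
  rewrite ler_pM2l; last lra.
  apply: (le_trans s2); rewrite horner_sum.
  apply: (@le_trans _ _ (\sum_(i < n.+1) `|b i.+2| * (2 * r) ^+ 2)).
    apply: ler_sum => i _; rewrite hornerZ horner_exp -/y ler_wpM2l//.
    rewrite exprS exprS exprS expr1 mulrA -[leRHS]mulr1 ler_pM//.
    - by rewrite mulr_ge0.
    - exact: exprn_ge0.
    - by rewrite ler_pM.
    - by rewrite exprn_ile1// (le_trans IH).
  rewrite -mulr_suml ler_wpM2r ?sqr_ge0//.
  apply: le_trans (bC n.+3); rewrite [in leRHS]big_ord_recl [in leRHS]big_ord_recl /=.
  apply: ler_wpDl; first by rewrite mulr_ge0.
  apply: ler_wpDl; first by rewrite mulr_ge0.
  by apply: ler_sum => i _; rewrite expr1n mulr1 /bump /= !add1n.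
exists r => // n; apply: le_trans (key n).
rewrite (@horner_abs_poly _ _ _ n.+2) ?koenigs_poly_partial ?size_poly//.
rewrite -koenigs_poly_partial.
rewrite [leRHS]big_ord_recr [X in _ <= X + _]big_ord_recr /= -addrA.
apply: ler_wpDr; first by rewrite addr_ge0// mulr_ge0// exprn_ge0// ltW.
apply: ler_sum => i _; rewrite coef_koenigs_poly//.
by rewrite (leq_trans (ltnW (ltn_ord i))).
Qed.

(** A bound at radius r turns into one at radius 2 r through the majorant of b. *)
Lemma koenigs_double r n : 0 <= r ->
  \sum_(i < n.+2) `|koenigs_coef i| * (2 * r) ^+ i <=
  \sum_(j < n.+2) `|b j| * (\sum_(i < n.+2) `|koenigs_coef i| * r ^+ i) ^+ j.
Proof.
move=> r0; have := majorant_sum_norm n.+2 r0 (@majorant_comp_trunc n.+1 (koenigs_poly n)).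
rewrite horner_sum; under [X in _ <= X -> _]eq_bigr => j _.
  rewrite hornerZ horner_exp (@horner_abs_poly _ _ _ n.+2); last first.
    by rewrite koenigs_poly_partial size_poly.
  under eq_bigr => i _ do rewrite coef_koenigs_poly -1?ltnS//.
  over.
apply: le_trans; apply: ler_sum => i _.
rewrite coef_comp_koenigs_poly -1?ltnS// coef_koenigs_poly -1?ltnS// normrM exprMn.
by rewrite (@ger0_norm _ (2 ^+ i)) ?exprn_ge0// mulrCA mulrA mulrAC -mulrA mulrCA.
Qed.

Lemma koenigs_entire : entire_series koenigs_coef.
Proof.
have [r0 r0gt0 h0] := koenigs_small.
have ge0 r n : 0 <= r -> 0 <= \sum_(i < n) `|koenigs_coef i| * r ^+ i.
  by move=> r0'; apply: sumr_ge0 => i _; rewrite mulr_ge0 ?exprn_ge0.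
have mono r n m : 0 <= r -> (n <= m)%N -> \sum_(i < n) `|koenigs_coef i| * r ^+ i <=
     \sum_(i < m) `|koenigs_coef i| * r ^+ i.
  move=> r0' nm; rewrite -!(big_mkord xpredT (fun i => `|koenigs_coef i| * r ^+ i)).
  rewrite [leRHS](@big_cat_nat _ _ _ n)//= lerDl.
  by apply: sumr_ge0 => i _; rewrite mulr_ge0 ?exprn_ge0.
have key k : exists M, forall n, \sum_(i < n) `|koenigs_coef i| * (2 ^+ k * r0) ^+ i <= M.
  elim: k => [|k [M hM]]; first by exists (2 * r0) => n; rewrite expr0 mul1r.
  have k0 : 0 <= 2 ^+ k * r0 by rewrite mulr_ge0 ?exprn_ge0// ltW.
  have M0 : 0 <= M by apply: le_trans (hM 0%N); rewrite big_ord0.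
  have [C hC] := hb M0; exists C => n.
  apply: le_trans (hC n.+2); rewrite exprS -mulrA.
  have := mono (2 * (2 ^+ k * r0)) n n.+2; rewrite mulr_ge0// => /(_ isT).
  rewrite ltnW ?ltnS ?leqnSn// => /(_ isT) /le_trans; apply.
  apply: (le_trans (koenigs_double n k0)); apply: ler_sum => j _.
  by rewrite ler_wpM2l// lerXn2r ?nnegrE ?ge0.
move=> r r_ge0.
have [k rk] : exists k, r <= 2 ^+ k * r0.
  exists (Num.bound (r / r0)).
  rewrite -ler_pdivrMr//; apply: (@le_trans _ _ (Num.bound (r / r0))%:R).
    by apply/ltW/archi_boundP; rewrite divr_ge0// ltW.
  by rewrite -natrX ler_nat ltnW// ltn_expl.
have [M hM] := key k; exists M => n; apply: le_trans (hM n).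
by apply: ler_sum => i _; rewrite ler_wpM2l// lerXn2r ?nnegrE ?(le_trans r_ge0 rk).
Qed.

Lemma horner_comp_trunc m (p : {poly R}) x : (comp_trunc m p).[x] = pseries b p.[x] m.+1.
Proof.
rewrite /comp_trunc horner_sum /pseries /series /= big_mkord.
by apply: eq_bigr => j _; rewrite hornerZ horner_exp.
Qed.

(** The partial sums satisfy the equation up to degree n + 1. What is left of the right-hand
    side has degree at least n + 2 and is bounded at radius 2 |u|, so it costs a factor
    2 ^ - (n + 2) at u. *)
Lemma koenigs_functional u :
  series_fun koenigs_coef (2 * u) = series_fun b (series_fun koenigs_coef u).
Proof.
have ha := koenigs_entire.
have h2u : 0 <= 2 * `|u| by rewrite mulr_ge0.
have [M hM] := ha _ h2u.
have M0 : 0 <= M by apply: le_trans (hM 0%N); rewrite big_ord0.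
have [C hC] := hb M0.
have bound n : `|pseries koenigs_coef (2 * u) n.+2 -
     pseries b (pseries koenigs_coef u n.+2) n.+2| <= C * (2^-1) ^+ n.+2.
  rewrite -[X in pseries b X](horner_partial_poly koenigs_coef n.+2).
  rewrite -koenigs_poly_partial -horner_comp_trunc.
  set c := comp_trunc _ _; pose s := maxn n.+2 (size c).
  rewrite (@horner_coef_wide _ s) ?leq_maxr// /pseries /series /=.
  rewrite -(big_mkord xpredT (fun i => c`_i * u ^+ i)).
  rewrite (@big_cat_nat _ _ _ n.+2 0 s)//= ?leq_maxl// opprD addrA.
  have -> : \sum_(0 <= i < n.+2) koenigs_coef i * (2 * u) ^+ i =
     \sum_(0 <= i < n.+2) c`_i * u ^+ i.
    rewrite big_nat_cond [RHS]big_nat_cond; apply: eq_bigr => i; rewrite andbT => /andP[_ ni].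
    by rewrite /c coef_comp_koenigs_poly// coef_koenigs_poly// exprMn mulrCA mulrA.
  rewrite subrr add0r normrN (le_trans (ler_norm_sum _ _ _))//.
  have : \sum_(n.+2 <= i < s) `|c`_i * u ^+ i| <=
      (2^-1) ^+ n.+2 * \sum_(0 <= i < s) `|c`_i| * (2 * `|u|) ^+ i.
    rewrite [in leRHS](@big_cat_nat _ _ _ n.+2)//= ?leq_maxl// mulrDr.
    apply: ler_wpDl.
      rewrite mulr_ge0 ?exprn_ge0//; apply: sumr_ge0 => i _.
      by rewrite mulr_ge0// exprn_ge0.
    rewrite mulr_sumr big_nat_cond [leRHS]big_nat_cond.
    apply: ler_sum => i; rewrite andbT => /andP[ni _].
    rewrite normrM normrX mulrCA ler_wpM2l// exprMn mulrA ler_peMl ?exprn_ge0//.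
    rewrite exprVn ler_pdivlMl ?exprn_gt0// mulr1.
    by rewrite ler_weXn2l// ler1n.
  move=> /le_trans; apply; rewrite mulrC ler_wpM2r ?exprn_ge0//.
  rewrite big_mkord; apply: le_trans (hC n.+2).
  have := majorant_sum_norm s h2u (@majorant_comp_trunc n.+1 (koenigs_poly n)).
  move=> /le_trans; apply; rewrite horner_sum; apply: ler_sum => j _.
  rewrite hornerZ horner_exp ler_wpM2l//.
  rewrite (@horner_abs_poly _ _ _ n.+2) ?koenigs_poly_partial ?size_poly//.
  rewrite lerXn2r ?nnegrE//.
    by apply: sumr_ge0 => i _; rewrite mulr_ge0 ?exprn_ge0.
  apply: le_trans (hM n.+2); apply: ler_sum => i _.
  by rewrite -koenigs_poly_partial coef_koenigs_poly// -ltnS.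
have l1 : pseries koenigs_coef (2 * u) @ \oo --> series_fun koenigs_coef (2 * u).
  exact: entire_cvg_to.
have l2 : (fun n => pseries b (pseries koenigs_coef u n) n) @ \oo -->
    series_fun b (series_fun koenigs_coef u).
  by apply: entire_cvg_diag => //; exact: entire_cvg_to.
have l3 : (fun n => pseries koenigs_coef (2 * u) n -
    pseries b (pseries koenigs_coef u n) n) @ \oo --> (0 : R).
  apply: norm_cvg0; apply: (@squeeze_cvgr _ _ _ _ (cst 0) (fun n => C * (2^-1) ^+ n)).
  - near=> n; rewrite normr_ge0/=.
    have n2 : (1 < n)%N by near: n; exact: nbhs_infty_gt.
    by rewrite -(subnK n2) addn2.
  - exact: cvg_cst.
  - rewrite -[X in _ --> X](mulr0 C); apply: cvgM; [exact: cvg_cst|apply: cvg_expr].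
    by rewrite ger0_norm ?invf_lt1 ?ltr1n.
have l4 := cvg_unique (@norm_hausdorff _ _) l3 (cvgB l1 l2).
by apply/eqP; rewrite -subr_eq0 -[X in X == _]l4.
Unshelve. all: by end_near. Qed.

End Koenigs.

(** * Elementary calculus *)
Section Calculus.
Context {R : realType}.
Implicit Types (f g : R -> R) (a b x y : R).

Lemma is_derive_continuous f df x : is_derive x (1 : R) f df -> {for x, continuous f}.
Proof. by move=> [dfx _]; apply/differentiable_continuous/derivable1_diffP. Qed.

Lemma mean_value f (df : R -> R) a b : a <= b ->
  (forall x, a <= x <= b -> is_derive x (1 : R) f (df x)) ->
  exists2 c, a <= c <= b & f b - f a = df c * (b - a).
Proof.
move=> ab h; have [|||c] := @MVT_segment _ f df a b.
- by [].
- by move=> x /[!in_itv]/= /andP[ax xb]; apply: h; rewrite !ltW.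
- apply: derivable_within_continuous => x /[!in_itv]/= xab.
  by have [] := h x xab.
- by rewrite in_itv /= => cab e; exists c.
Qed.

Lemma ler_deriv f g (df dg : R -> R) a b : a <= b ->
  (forall x, a <= x <= b -> is_derive x (1 : R) f (df x)) ->
  (forall x, a <= x <= b -> is_derive x (1 : R) g (dg x)) ->
  (forall x, a <= x <= b -> df x <= dg x) -> f a <= g a -> f b <= g b.
Proof.
move=> ab hf hg le fga.
have [|c cab e] := @mean_value (fun x => g x - f x) (fun x => dg x - df x) a b ab.
  by move=> x xab; apply: is_deriveB; [exact: hg|exact: hf].
have : 0 <= (dg c - df c) * (b - a) by rewrite mulr_ge0// subr_ge0 ?le.
rewrite -e; lra.
Qed.

Lemma natr_expr_bound (r : R) : exists k : nat, r <= 2 ^+ k.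
Proof.
exists (Num.bound `|r|); apply: (le_trans (ler_norm r)).
apply: (@le_trans _ _ (Num.bound `|r|)%:R); first exact/ltW/archi_boundP.
by rewrite -natrX ler_nat ltnW// ltn_expl.
Qed.

Lemma mul_halves n x : 2 ^+ n * (x / 2 ^+ n) = x.
Proof. by rewrite mulrCA mulfV ?mulr1// expf_neq0. Qed.

Lemma cvg_halves x : (fun n => x / 2 ^+ n) @ \oo --> (0 : R).
Proof.
rewrite -[X in _ --> X](mulr0 x); apply: cvgM; first exact: cvg_cst.
under eq_cvg do rewrite -exprVn.
by apply: cvg_expr; rewrite ger0_norm ?invf_lt1 ?ltr1n.
Qed.

(** Caratheodory's form of the derivative, along a null sequence. *)
Lemma derive_seq f (d p : R) (c e : nat -> R) (u : R) :
  is_derive p (1 : R) f d -> e @ \oo --> (0 : R) ->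
  (fun n => c n * e n) @ \oo --> u ->
  (fun n => c n * (f (p + e n) - f p)) @ \oo --> d * u.
Proof.
move=> /is_derive1_caratheodory[s [sE sc <-]] e0 ceu.
have -> : (fun n => c n * (f (p + e n) - f p)) = fun n => s (p + e n) * (c n * e n).
  by apply/funext => n; rewrite sE addrAC subrr add0r mulrCA.
apply: cvgM => //; apply: continuous_cvg => //.
by rewrite -[X in _ --> X]addr0; apply: cvgD => //; exact: cvg_cst.
Qed.

End Calculus.

(** * The interior linearizer *)
Section InteriorMap.
Context {R : realType}.
Implicit Types (u v x y z : R).

(** The map A recentred at its fixed point 1/2. *)
Definition Bmap y : R := y + sin (2 * pi * y) / (2 * pi).

Definition Bmap_coef n : R :=
  (n == 1%N)%:R + (odd n)%:R * (-1) ^+ n.-1./2 / n`!%:R * (2 * pi) ^+ n / (2 * pi).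

Lemma twopi_gt0 : 0 < 2 * pi :> R.
Proof. by rewrite mulr_gt0// pi_gt0. Qed.

Lemma twopi_neq0 : 2 * pi != 0 :> R.
Proof. by rewrite gt_eqF// twopi_gt0. Qed.

Lemma Bmap_coef0 : Bmap_coef 0 = 0.
Proof. by rewrite /Bmap_coef /= !mul0r addr0. Qed.

Lemma Bmap_coef1 : Bmap_coef 1 = 2.
Proof.
rewrite /Bmap_coef eqxx /= (_ : 1`! = 1%N)// invr1 expr0 !mul1r expr1.
by rewrite mulfV ?twopi_neq0.
Qed.

Lemma Bmap_entire : entire_series Bmap_coef.
Proof.
move=> r r0; exists (r + expR (2 * pi * r) / (2 * pi)) => n.
have le i : `|Bmap_coef i| * r ^+ i <=
   (i == 1%N)%:R * r + exp_coeff (2 * pi * r) i / (2 * pi).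
  rewrite /Bmap_coef (le_trans (ler_wpM2r _ (ler_normD _ _))) ?exprn_ge0//.
  rewrite mulrDl lerD//.
    by case: eqP => [->|_]; rewrite ?normr0 ?mul0r// normr1 expr1.
  rewrite !normrM normrX !normfV normrN normr1 expr1n mulr1 normr_nat.
  rewrite (ger0_norm (ltW twopi_gt0)) (normr_nat R i`!) normrX (ger0_norm (ltW twopi_gt0)).
  rewrite /exp_coeff /= exprMn mulrAC ler_wpM2r ?invr_ge0 ?(ltW twopi_gt0)//.
  case: (odd i); last first.
    by rewrite mul0r !mul0r mulr_ge0 ?invr_ge0 ?exprn_ge0 ?mulr_ge0 ?pi_ge0.
  by rewrite mul1r !exprMn [leRHS]mulrC !mulrA.
apply: (@le_trans _ _ (\sum_(i < n) ((i == 1%N :> nat)%:R * r + exp_coeff (2 * pi * r) i / (2 * pi)))).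
  by apply: ler_sum => i _; exact: le.
rewrite big_split /= lerD//.
  rewrite -mulr_suml ler_piMl//.
  case: n => [|[|n]]; rewrite ?big_ord0// ?big_ord1//= .
  rewrite 2!big_ord_recl /= big1 ?addr0 ?add0r// => i _.
rewrite -mulr_suml ler_wpM2r ?invr_ge0 ?(ltW twopi_gt0)//.
have -> : expR (2 * pi * r) = limn (series (exp_coeff (2 * pi * r))) by [].
rewrite -(big_mkord xpredT (exp_coeff (2 * pi * r))).
apply: (@nondecreasing_cvgn_le _ (series (exp_coeff (2 * pi * r)))).
  by apply: nondecreasing_series => i _ _; apply: exp_coeff_ge0; rewrite mulr_ge0// ltW// twopi_gt0.
exact: is_cvg_series_exp_coeff.
Qed.

Lemma series_fun_Bmap y : series_fun Bmap_coef y = Bmap y.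
Proof.
apply/cvg_lim => //; rewrite /Bmap sinE.
pose c (n : nat) : R := (odd n)%:R * (-1) ^+ n.-1./2 / n`!%:R.
have cs : pseries c (2 * pi * y) @ \oo --> limn (pseries c (2 * pi * y)).
  have := @is_cvg_series_sin_coeff R (2 * pi * y).
  by rewrite sin_coeffE.
have -> : pseries Bmap_coef y = fun n => \sum_(0 <= i < n) (i == 1%N)%:R * y ^+ i +
    pseries c (2 * pi * y) n / (2 * pi).
  apply/funext => n; rewrite /pseries /series /= mulr_suml -big_split /=.
  by apply: eq_bigr => i _; rewrite /Bmap_coef mulrDl [(2 * pi * y) ^+ i]exprMn /c; congr (_ + _); rewrite -!mulrA; do 3 congr (_ * _); rewrite mulrCA mulrC !mulrA.
apply: cvgD; last by apply: cvgM => //; exact: cvg_cst.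
apply: cvg_near_cst; near=> n.
have n1 : (1 < n)%N by near: n; exact: nbhs_infty_gt.
rewrite big_mkord (bigD1 (Ordinal n1))//= mul1r expr1 big1 ?addr0// => i /negP i1.
case: eqP; rewrite ?mul0r// => hi; exfalso; apply: i1; exact/eqP/val_inj.
Unshelve. all: by end_near. Qed.

End InteriorMap.

(** The linearizer minus 1/2. The constant is sealed because unfolding it exposes the recursion
    of its coefficients to unification. *)
HB.lock Definition phi {R : realType} : R -> R :=
  series_fun (koenigs_coef (@Bmap_coef R)).
HB.lock Definition kappa {R : realType} : R -> R :=
  series_fun (pseries_diffs (koenigs_coef (@Bmap_coef R))).

Section Linearizer.
Context {R : realType}.
Implicit Types (u v x y z : R).

Lemma phiE : phi = series_fun (koenigs_coef (@Bmap_coef R)).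
Proof. by rewrite unlock. Qed.

Lemma kappaE : kappa = series_fun (pseries_diffs (koenigs_coef (@Bmap_coef R))).
Proof. by rewrite unlock. Qed.

Lemma phi_entire : entire_series (koenigs_coef (@Bmap_coef R)).
Proof. exact: koenigs_entire Bmap_entire Bmap_coef0 Bmap_coef1. Qed.

Lemma phi_double u : phi (2 * u) = Bmap (phi u).
Proof.
rewrite -series_fun_Bmap phiE.
exact: (koenigs_functional Bmap_entire Bmap_coef0 Bmap_coef1).
Qed.

Lemma phi0 : phi 0 = 0 :> R.
Proof. by rewrite phiE series_fun0 koenigs_coef0. Qed.

Lemma kappa0 : kappa 0 = 1 :> R.
Proof. by rewrite kappaE series_fun0 /pseries_diffs koenigs_coef1 mulr1. Qed.

Lemma is_derive_phi u : is_derive u (1 : R) phi (kappa u).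
Proof. by rewrite phiE kappaE; exact: series_fun_derive phi_entire. Qed.

Lemma continuous_phi : continuous (phi : R -> R).
Proof. rewrite phiE; exact: series_fun_continuous phi_entire. Qed.

Lemma continuous_kappa : continuous (kappa : R -> R).
Proof. by rewrite kappaE; exact/series_fun_continuous/entire_diffs/phi_entire. Qed.

Lemma is_derive_Bmap y : is_derive y (1 : R) Bmap (2 * cos (pi * y) ^+ 2).
Proof.
have h : is_derive y (1 : R) (fun y => y + (2 * pi)^-1 * sin (2 * pi * y))
  (1 + (2 * pi)^-1 * (cos (2 * pi * y) * (2 * pi))).
  apply: is_deriveD; apply: is_deriveZ.
  apply: (@is_derive1_comp _ sin (fun y => 2 * pi * y)).
  by apply: is_derive_eq; rewrite /GRing.scale/= mulr1.
have -> : Bmap = fun y => y + (2 * pi)^-1 * sin (2 * pi * y).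
  by apply/funext => z; rewrite /Bmap [_ / _]mulrC.
apply: is_derive_eq; rewrite mulrCA mulVf ?twopi_neq0// mulr1.
have -> : 2 * pi * y = (pi * y) *+ 2 by rewrite mulr2n; ring.
by rewrite cos_mulr2n mulr2n; ring.
Qed.

Lemma continuous_Bmap : continuous (Bmap : R -> R).
Proof. by move=> y; exact: is_derive_continuous (is_derive_Bmap y). Qed.

Lemma kappa_double u : kappa (2 * u) = cos (pi * phi u) ^+ 2 * kappa u.
Proof.
have h1 : is_derive u (1 : R) (fun u => phi (2 * u)) (kappa (2 * u) * 2).
  apply: (@is_derive1_comp _ phi (fun u => 2 * u)); first exact: is_derive_phi.
  by apply: is_derive_eq; rewrite /GRing.scale/= mulr1.
have h2 : is_derive u (1 : R) (fun u => Bmap (phi u)) (2 * cos (pi * phi u) ^+ 2 * kappa u).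
  apply: (@is_derive1_comp _ Bmap phi); [exact: is_derive_Bmap|exact: is_derive_phi].
have e : (fun u => phi (2 * u)) = (fun u => Bmap (phi u)).
  by apply/funext => v; exact: phi_double.
rewrite e in h1; have := @derive_val _ _ _ _ _ _ _ h1; rewrite (@derive_val _ _ _ _ _ _ _ h2).
by move=> h; apply: (@mulIf _ 2) => //; rewrite -h; ring.
Qed.

Lemma Bmap0 : Bmap 0 = 0 :> R.
Proof. by rewrite /Bmap mulr0 sin0 mul0r addr0. Qed.

Lemma BmapN y : Bmap (- y) = - Bmap y.
Proof. by rewrite /Bmap mulrN sinN mulNr -opprD. Qed.

Lemma Bmap_half : Bmap 2^-1 = 2^-1 :> R.
Proof. by rewrite /Bmap mulrAC mulfV// mul1r sinpi mul0r addr0. Qed.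

Lemma Bmap_nondecreasing x y : x <= y -> Bmap x <= Bmap y.
Proof.
move=> xy; have [c _ e] := mean_value xy (fun z _ => is_derive_Bmap z).
by rewrite -subr_ge0 e mulr_ge0 ?subr_ge0// mulr_ge0// sqr_ge0.
Qed.

Lemma Bmap_lipschitz x y : `|Bmap x - Bmap y| <= 2 * `|x - y|.
Proof.
wlog xy : x y / y <= x.
  by move=> h; have [|/ltW] := leP y x; [exact: h|rewrite distrC (distrC x); exact: h].
have [c _ ->] := mean_value xy (fun z _ => is_derive_Bmap z).
rewrite normrM ler_wpM2r// normrM ger0_norm// ler_piMr// normrX.
by rewrite exprn_ile1// cos_max.
Qed.

Lemma cos_pi_gt0 y : `|y| < 2^-1 -> 0 < cos (pi * y).
Proof.
rewrite ltr_norml => /andP[y1 y2]; apply: cos_gt0_pihalf.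
have p0 := @pi_gt0 R; apply/andP; split.
  by rewrite -mulrN ltr_pM2l.
by rewrite ltr_pM2l.
Qed.

Lemma Bmap_increasing x y : - 2^-1 <= x -> x < y -> y <= 2^-1 -> Bmap x < Bmap y.
Proof.
apply: (@gtr0_derive1_incr _ Bmap (- 2^-1) 2^-1).
- by move=> z _; have [] := is_derive_Bmap z.
- move=> z /[!in_itv]/= zz; rewrite derive1E (@derive_val _ _ _ _ _ _ _ (is_derive_Bmap z)).
  by rewrite mulr_gt0// exprn_gt0// cos_pi_gt0// ltr_norml.
- exact/continuous_subspaceT/continuous_Bmap.
Qed.

Lemma Bmap_lt_half y : `|y| < 2^-1 -> `|Bmap y| < 2^-1.
Proof.
rewrite !ltr_norml => /andP[y1 y2]; rewrite -Bmap_half -BmapN.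
by rewrite !Bmap_increasing ?lexx ?(ltW y1) ?(ltW y2).
Qed.

(** Every point is reached from a neighbourhood of 0 by finitely many doublings. *)
Lemma doubling_induction (P : R -> Prop) : (\forall x \near (0 : R), P x) ->
  (forall u, P u -> P (2 * u)) -> forall u, P u.
Proof.
move=> P0 Pd u; have := @cvg_halves R u => /(_ _ P0)[n _ /(_ n (leqnn n))/= hn].
rewrite -(mul_halves n u).
elim: n (u / _) hn => [|n IH] v hv; first by rewrite expr0 mul1r.
by rewrite exprS -mulrA; apply/Pd/IH.
Qed.

Lemma phi_lt_half u : `|phi u| < 2^-1.
Proof.
move: u; apply: doubling_induction => [|u]; last first.
  by rewrite phi_double; exact: Bmap_lt_half.
have /cvgrPdist_lt/(_ 2^-1) := @continuous_phi 0; rewrite invr_gt0 => /(_ (ltr0n _ 2)).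
by apply: filterS => x; rewrite phi0 sub0r normrN.
Qed.

Lemma kappa_gt0 u : 0 < kappa u.
Proof.
move: u; apply: doubling_induction => [|u k0]; last first.
  by rewrite kappa_double mulr_gt0// exprn_gt0// cos_pi_gt0// phi_lt_half.
have /cvgrPdist_lt/(_ 1 ltr01) := @continuous_kappa 0.
by apply: filterS => x; rewrite kappa0 ltr_norml => /andP[_]; rewrite ltrBlDr ltrDl.
Qed.

Lemma phi_increasing u v : u < v -> phi u < phi v.
Proof.
move=> uv; have [c _ e] := mean_value (ltW uv) (fun z _ => is_derive_phi z).
by rewrite -subr_gt0 e mulr_gt0 ?kappa_gt0 ?subr_gt0.
Qed.

Lemma phi_nondecreasing u v : u <= v -> phi u <= phi v.
Proof. by rewrite le_eqVlt => /predU1P[->//|/phi_increasing/ltW]. Qed.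

Lemma phi_ge0 u : 0 <= u -> 0 <= phi u.
Proof. by rewrite -{2}phi0; exact: phi_nondecreasing. Qed.

Lemma phi_iter n u : phi (2 ^+ n * u) = iter n Bmap (phi u).
Proof. by elim: n => [|n IH]; rewrite ?expr0 ?mul1r// exprS -mulrA phi_double IH. Qed.

Lemma iter_Bmap_lipschitz n x y : `|iter n Bmap x - iter n Bmap y| <= 2 ^+ n * `|x - y|.
Proof.
elim: n => [|n IH]; first by rewrite expr0 mul1r.
by rewrite !iterS (le_trans (Bmap_lipschitz _ _))// exprS -mulrA ler_pM2l.
Qed.

Lemma scaled_phi_cvg u : (fun n => 2 ^+ n * phi (u / 2 ^+ n)) @ \oo --> u.
Proof.
have := @derive_seq _ phi 1 0 (fun n => 2 ^+ n) (fun n => u / 2 ^+ n) u.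
rewrite mul1r phi0 (_ : (fun n => 2 ^+ n * (phi (0 + u / 2 ^+ n) - 0)) =
  fun n => 2 ^+ n * phi (u / 2 ^+ n)); last by apply/funext => n; rewrite add0r subr0.
apply; [by have := is_derive_phi 0; rewrite kappa0|exact: (@cvg_halves R u)|].
rewrite (_ : (fun n => _) = cst u); first exact: cvg_cst.
by apply/funext => n; exact: mul_halves.
Qed.

(** The linearizer is the limit of the rescaled iterates: the factor 2 ^ n by
    which they may expand an error is compensated by the rescaling. *)
Lemma iter_Bmap_cvg (x : nat -> R) u : (fun n => 2 ^+ n * x n) @ \oo --> u ->
  (fun n => iter n Bmap (x n)) @ \oo --> phi u.
Proof.
move=> xu; have d0 : (fun n => iter n Bmap (x n) - phi u) @ \oo --> (0 : R).
  apply: norm_cvg0; apply: (@squeeze_cvgr _ _ _ _ (cst 0)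
    (fun n => `|2 ^+ n * x n - 2 ^+ n * phi (u / 2 ^+ n)|)).
  - near=> n; rewrite normr_ge0/=.
    have -> : phi u = iter n Bmap (phi (u / 2 ^+ n)).
      by rewrite -phi_iter mul_halves.
    rewrite (le_trans (iter_Bmap_lipschitz _ _ _))// -mulrBr normrM.
    by rewrite (@ger0_norm _ (2 ^+ n)) ?exprn_ge0.
  - exact: cvg_cst.
  - rewrite -[X in _ --> X](@normr0 _ R) -(subrr u); apply: cvg_norm.
    by apply: cvgB => //; exact: scaled_phi_cvg.
have -> : (fun n => iter n Bmap (x n)) = fun n => (iter n Bmap (x n) - phi u) + phi u.
  by apply/funext => n; rewrite subrK.
by rewrite -[X in _ --> X]add0r; apply: cvgD => //; exact: cvg_cst.
Unshelve. all: by end_near. Qed.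

Lemma iter_BmapN n y : iter n Bmap (- y) = - iter n Bmap y.
Proof. by elim: n => [//|n IH]; rewrite !iterS IH BmapN. Qed.

Lemma phiN u : phi (- u) = - phi u.
Proof.
have h := @iter_Bmap_cvg (fun n => - phi (u / 2 ^+ n)) (- u).
have h1 : (fun n => 2 ^+ n * - phi (u / 2 ^+ n)) @ \oo --> - u.
  by under eq_cvg do rewrite mulrN; apply: cvgN; exact: scaled_phi_cvg.
have h2 : (fun n => iter n Bmap (- phi (u / 2 ^+ n))) @ \oo --> - phi u.
  under eq_cvg do rewrite iter_BmapN.
  by apply: cvgN; apply: iter_Bmap_cvg; exact: scaled_phi_cvg.
exact: cvg_unique (h h1) h2.
Qed.

Lemma kappaN u : kappa (- u) = kappa u.
Proof.
have h : is_derive u (1 : R) (fun u => - phi (- u)) (- (kappa (- u) * - 1)).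
  have hN : is_derive u (1 : R) (fun u => - u) (- 1) by apply: is_deriveN.
  apply: is_deriveN; apply: (@is_derive1_comp _ phi (fun u => - u)) hN.
  exact: is_derive_phi.
have e : (fun u => - phi (- u)) = phi by apply/funext => v; rewrite phiN opprK.
rewrite e in h; have := @derive_val _ _ _ _ _ _ _ h.
by rewrite (@derive_val _ _ _ _ _ _ _ (is_derive_phi u)) mulrN1 opprK.
Qed.

(** The factors by which the iterates of B contract the slope: the derivative of the n-th iterate
    is 2 ^ n times this product. *)
Definition cos_product n x : R := \prod_(j < n) cos (pi * iter j Bmap x) ^+ 2.

Lemma kappa_iter n u : kappa (2 ^+ n * u) = cos_product n (phi u) * kappa u.
Proof.
rewrite /cos_product; elim: n => [|n IH]; first by rewrite expr0 big_ord0 !mul1r.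
by rewrite exprS -mulrA kappa_double IH big_ord_recr /= -phi_iter mulrCA mulrA.
Qed.

Lemma iter_Bmap_nondecreasing n x y : x <= y -> iter n Bmap x <= iter n Bmap y.
Proof. by move=> xy; elim: n => [//|n IH]; rewrite !iterS Bmap_nondecreasing. Qed.

Lemma iter_Bmap0 n : iter n Bmap 0 = 0 :> R.
Proof. by elim: n => [//|n IH]; rewrite iterS IH Bmap0. Qed.

Lemma iter_Bmap_half n : iter n Bmap 2^-1 = 2^-1 :> R.
Proof. by elim: n => [//|n IH]; rewrite iterS IH Bmap_half. Qed.

Lemma cos_sqr_le1 x : cos x ^+ 2 <= 1.
Proof. by rewrite -real_normK ?num_real// exprn_ile1// cos_max. Qed.

Lemma cos_product_le n x y : 0 <= x -> x <= y -> y <= 2^-1 ->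
  cos_product n y <= cos_product n x.
Proof.
move=> x0 xy y1; apply: ler_prod => j _; rewrite sqr_ge0/=.
have p0 := @pi_gt0 R.
have h0 : 0 <= iter j Bmap x by rewrite -(iter_Bmap0 j) iter_Bmap_nondecreasing.
have h1 : iter j Bmap x <= iter j Bmap y by exact: iter_Bmap_nondecreasing.
have h2 : iter j Bmap y <= 2^-1 by rewrite -(iter_Bmap_half j) iter_Bmap_nondecreasing.
have c0 : 0 <= cos (pi * iter j Bmap y).
  apply: cos_ge0_pihalf; apply/andP; split; last by rewrite ler_pM2l.
  apply: (@le_trans _ _ 0); first by rewrite oppr_le0 divr_ge0// ltW.
    by rewrite mulr_ge0 ?(ltW p0)// (le_trans h0).
have c1 : cos (pi * iter j Bmap y) <= cos (pi * iter j Bmap x).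
  have [->//|ne] := eqVneq (iter j Bmap x) (iter j Bmap y).
  apply/ltW; rewrite ltr_cos ?in_itv/=.
  - by rewrite ltr_pM2l// lt_neqAle ne.
  - by rewrite mulr_ge0 ?(ltW p0)//= -[leRHS]mulr1 ler_pM2l// (le_trans h1)// (le_trans h2)// invf_le1// ler1n.
  - by rewrite mulr_ge0 ?(ltW p0) ?(le_trans h0)//= -[leRHS]mulr1 ler_pM2l// (le_trans h2)// invf_le1// ler1n.
by rewrite lerXn2r ?nnegrE// (le_trans c0).
Qed.

Lemma cos_product_ge0 n x : 0 <= cos_product n x.
Proof. by apply: prodr_ge0 => j _; exact: sqr_ge0. Qed.

Lemma cos_product_le1 n x : cos_product n x <= 1.
Proof.
rewrite /cos_product -[leRHS](@big1_eq _ 1 *%R _ (index_enum 'I_n) xpredT).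
by apply: ler_prod => j _; rewrite sqr_ge0 cos_sqr_le1.
Qed.

Lemma kappa_halves_cvg u : (fun n => kappa (u / 2 ^+ n)) @ \oo --> (1 : R).
Proof.
have h : (fun n => kappa (u / 2 ^+ n)) @ \oo --> kappa 0.
  apply: continuous_cvg; first exact: continuous_kappa.
  exact: (@cvg_halves R u).
by rewrite kappa0 in h.
Qed.

(** kappa is the limit of the products of squared cosines started at phi (u / 2 ^ n), and each
    factor decreases with its starting point. *)
Lemma kappa_nonincreasing u v : 0 <= u -> u <= v -> kappa v <= kappa u.
Proof.
move=> u0 uv.
have h n : kappa v * kappa (u / 2 ^+ n) <= kappa u * kappa (v / 2 ^+ n).
  have e w : kappa w = cos_product n (phi (w / 2 ^+ n)) * kappa (w / 2 ^+ n).
    by rewrite -kappa_iter mul_halves.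
  rewrite (e v) [in leRHS](e u) -!mulrA [kappa (v / _) * _]mulrC.
  rewrite ler_wpM2r ?mulr_ge0 ?(ltW (kappa_gt0 _))//.
  have p2 : 0 < (2 ^+ n : R) by rewrite exprn_gt0.
  apply: cos_product_le; first by rewrite phi_ge0// divr_ge0// ltW.
    by rewrite phi_nondecreasing// ler_pM2r ?invr_gt0.
  by have := phi_lt_half (v / 2 ^+ n); rewrite ltr_norml => /andP[_ /ltW].
have l1 : (fun n => kappa v * kappa (u / 2 ^+ n)) @ \oo --> kappa v.
  by rewrite -[X in _ --> X]mulr1; apply: cvgM; [exact: cvg_cst|exact: kappa_halves_cvg].
have l2 : (fun n => kappa u * kappa (v / 2 ^+ n)) @ \oo --> kappa u.
  by rewrite -[X in _ --> X]mulr1; apply: cvgM; [exact: cvg_cst|exact: kappa_halves_cvg].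
rewrite -(cvg_lim _ l1)// -(cvg_lim _ l2)//; apply: ler_lim.
- by apply/cvg_ex; eexists; exact: l1.
- by apply/cvg_ex; eexists; exact: l2.
- by near=> n; exact: h.
Unshelve. all: by end_near. Qed.

Lemma kappa_norm u : kappa `|u| = kappa u.
Proof. by have [//|_] := ger0P u; rewrite kappaN. Qed.

Lemma kappa_le1 u : kappa u <= 1.
Proof. by rewrite -kappa_norm -kappa0 kappa_nonincreasing. Qed.

Lemma phi_le u : 0 <= u -> phi u <= u.
Proof.
move=> u0; apply: (@ler_deriv _ phi id kappa (cst 1) 0 u u0).
- by move=> z _; exact: is_derive_phi.
- by move=> z _; exact: kappa_le1.
- by rewrite phi0.
Qed.

(** The upper tail of the limit law. *)
Definition gtail u : R := 2^-1 - phi u.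

Lemma gtail_gt0 u : 0 < gtail u.
Proof. by rewrite subr_gt0; have := phi_lt_half u; rewrite ltr_norml => /andP[]. Qed.

Lemma gtail_lt1 u : gtail u < 1.
Proof.
rewrite /gtail; have := phi_lt_half u; rewrite ltr_norml => /andP[h _].
have : (2^-1 + 2^-1 = 1 :> R) by field.
lra.
Qed.

Lemma gtail_nonincreasing u v : u <= v -> gtail v <= gtail u.
Proof. by move=> uv; rewrite lerD2l lerN2 phi_nondecreasing. Qed.

(** Closed form of A, which unlike the integral makes sense on the whole line. *)
Definition Aform z : R := z - sin (2 * pi * z) / (2 * pi).

Lemma AformE z : Aform z = 2^-1 - Bmap (2^-1 - z).
Proof.
rewrite /Aform /Bmap; suff -> : sin (2 * pi * (2^-1 - z)) = sin (2 * pi * z) by ring.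
rewrite mulrBr (_ : 2 * pi * 2^-1 = pi); last by rewrite mulrAC mulfV// mul1r.
by rewrite sinB sinpi cospi mul0r mulN1r sub0r opprK.
Qed.

Lemma Aform_Bmap y : Aform (2^-1 + y) = 2^-1 + Bmap y.
Proof. by rewrite AformE (_ : 2^-1 - (2^-1 + y) = - y) ?BmapN ?opprK//; ring. Qed.

Lemma gtail_double u : gtail (2 * u) = Aform (gtail u).
Proof. by rewrite AformE /gtail phi_double opprB addrCA subrr addr0. Qed.

(** The limit is a fixed point of B in ]0, 1/2], and 1/2 is the only one. *)
Lemma phi_cvg_half : phi u @[u --> +oo] --> (2^-1 : R).
Proof.
have ub : has_ubound (range (phi : R -> R)).
  by exists 2^-1 => _ [u _ <-]; have := phi_lt_half u; rewrite ltr_norml => /andP[_ /ltW].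
have phiy := nondecreasing_cvgr phi_nondecreasing ub.
set l := sup _ in phiy.
have pow2y : (fun n => 2 ^+ n : R) @ \oo --> +oo.
  apply/cvgryPge => A; have [k Ak] := natr_expr_bound A.
  near=> n; apply: (le_trans Ak); rewrite ler_weXn2l ?ler1n//.
  by near: n; exact: nbhs_infty_ge.
have s : (fun n => phi (2 ^+ n)) @ \oo --> l by apply: cvg_comp phiy.
have s' : (fun n => phi (2 ^+ n.+1)) @ \oo --> l.
  by rewrite -(cvg_shiftS (fun n => phi (2 ^+ n))) in s.
have s2 : (fun n => phi (2 ^+ n.+1)) @ \oo --> Bmap l.
  under eq_cvg do rewrite exprS phi_double.
  by apply: continuous_cvg => //; exact: continuous_Bmap.
have Bl : Bmap l = l by exact: cvg_unique s2 s'.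
have l_le : l <= 2^-1.
  apply: ge_sup => [|_ [u _ <-]]; first by exists (phi 0), 0.
  by have := phi_lt_half u; rewrite ltr_norml => /andP[_ /ltW].
have l_gt0 : 0 < l.
  apply: (@lt_le_trans _ _ (phi 1)); first by rewrite -phi0 phi_increasing.
  by apply: ub_le_sup => //; exists 1.
have [lt|e] := ltP l 2^-1; last by rewrite (_ : 2^-1 = l)//; apply/le_anti; rewrite e l_le.
suff : 0 < sin (2 * pi * l).
  move: Bl => /eqP; rewrite /Bmap -subr_eq0 addrAC subrr add0r mulf_eq0.
  by rewrite invr_eq0 (negPf twopi_neq0) orbF => /eqP ->; rewrite ltxx.
have p0 := @pi_gt0 R; apply: sin_gt0_pi; rewrite !mulr_gt0//=.
rewrite -ltr_pdivlMl ?twopi_gt0//; apply: (lt_le_trans lt).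
by rewrite invfM -mulrA mulVf ?mulr1// gt_eqF.
Unshelve. all: by end_near. Qed.

End Linearizer.

(** * Probability measures with a density *)
Section Density.
Context {R : realType}.
Notation lbg := (@lebesgue_measure R).

Section Construction.
Variable g : R -> R.
Hypotheses (mg : measurable_fun setT g) (g0 : forall x, 0 <= g x)
  (g1 : (\int[lbg]_x (g x)%:E = 1)%E).

Definition density_prob of measurable_fun setT g & (forall x, 0 <= g x) &
  (\int[lbg]_x (g x)%:E = 1)%E : set (measurableTypeR R) -> \bar R :=
  fun V => (\int[lbg]_(x in V) (g x)%:E)%E.

Local Notation dp := (density_prob mg g0 g1).

Let dp0 : dp set0 = 0%E.
Proof. by rewrite /density_prob integral_set0. Qed.

Let dp_ge0 V : (0 <= dp V)%E.
Proof. by apply: integral_ge0 => x _; rewrite lee_fin. Qed.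

Let dp_sigma_additive : semi_sigma_additive dp.
Proof.
move=> /= F mF tF mUF; rewrite /density_prob; apply: cvg_toP.
  apply: ereal_nondecreasing_is_cvgn => m n mn.
  apply: lee_sum_nneg_natr => // k _ _.
  by apply: integral_ge0 => /= x Fkx; rewrite lee_fin.
rewrite ge0_integral_bigcup//=.
- by apply: measurable_funTS; apply: measurableT_comp.
- by move=> x _; rewrite lee_fin.
Qed.

HB.instance Definition _ := isMeasure.Build _ _ _ dp dp0 dp_ge0 dp_sigma_additive.

Let dp_setT : dp setT = 1%E.
Proof. exact: g1. Qed.

HB.instance Definition _ := @Measure_isProbability.Build _ _ R dp dp_setT.

Definition density_probability : probability (measurableTypeR R) R := dp.

End Construction.

Section Integral.
Variables (mu : {measure set (measurableTypeR R) -> \bar R}) (g : R -> R).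
Hypothesis mug : has_density mu g.

Let mg : measurable_fun setT g. Proof. by have [] := mug. Qed.
Let g0 x : 0 <= g x. Proof. by have [_ /(_ x)] := mug. Qed.
Let muE B : measurable B -> (mu B = \int[lbg]_(x in B) (g x)%:E)%E.
Proof. by have [_ _] := mug; exact. Qed.

Let integral_indic_density E : measurable E ->
  (\int[mu]_x (\1_E x)%:E = \int[lbg]_x ((\1_E x)%:E * (g x)%:E))%E.
Proof.
move=> mE; rewrite integral_indic//= setIT muE// [LHS]integral_mkcond/=.
apply: eq_integral => x _; rewrite patchE indicE; case: (x \in E).
  by rewrite mul1e.
by rewrite mul0e.
Qed.

Import HBNNSimple.

Let integral_nnsfun_density (f : {nnsfun measurableTypeR R >-> R}) :
  (\int[mu]_x (f x)%:E = \int[lbg]_x ((f x)%:E * (g x)%:E))%E.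
Proof.
under [LHS]eq_integral do rewrite fimfunE -fsumEFin//.
rewrite [LHS]ge0_integral_fsum//; last 2 first.
  - by move=> r; exact/measurable_EFinP/measurableT_comp.
  - by move=> n x _; rewrite EFinM nnfun_muleindic_ge0.
under [RHS]eq_integral.
  move=> x xD; rewrite fimfunE -fsumEFin// muleC ge0_mule_fsumr; last first.
    by move=> r; rewrite EFinM nnfun_muleindic_ge0.
  over.
rewrite [RHS]ge0_integral_fsum//; last 2 first.
  - move=> r; apply: emeasurable_funM; first exact/measurable_EFinP.
    by apply/measurable_EFinP; do 2 apply/measurableT_comp => //.
  - move=> n x _; rewrite EFinM mule_ge0//; last by rewrite nnfun_muleindic_ge0.
    by rewrite lee_fin.
apply: eq_fsbigr => r; rewrite inE => -[x _ fx].
have r0 : (0 <= r%:E)%E by rewrite lee_fin -fx.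
rewrite integralZl_indic_nnsfun//= integral_indic_density// -ge0_integralZl//.
- by apply: eq_integral => y _; rewrite EFinM [RHS]muleC muleA.
- by apply: emeasurable_funM; exact/measurable_EFinP.
- by move=> y _; rewrite mule_ge0// lee_fin.
Qed.

(** Simple functions first, then monotone convergence. *)
Lemma ge0_integral_density (f : R -> \bar R) :
  measurable_fun setT f -> (forall x, 0 <= f x)%E ->
  (\int[mu]_x f x = \int[lbg]_x (f x * (g x)%:E))%E.
Proof.
move=> mf f0.
pose f_ := nnsfun_approx (@measurableT _ (measurableTypeR R)) mf.
transitivity (lim (\int[mu]_x (f_ n x)%:E @[n --> \oo])%E).
  rewrite -monotone_convergence//=.
  - apply: eq_integral => ? /[!inE] xD; apply/esym/cvg_lim => //=.
    exact: cvg_nnsfun_approx.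
  - by move=> n; exact/measurable_EFinP/measurable_funTS.
  - by move=> n ? _; rewrite lee_fin.
  - by move=> ? _ ? ? mn; rewrite lee_fin; exact/lefP/nd_nnsfun_approx.
transitivity (lim (\int[lbg]_x ((f_ n x)%:E * (g x)%:E)%E @[n --> \oo])%E).
  by apply: congr_lim; apply/funext => n /=; exact: integral_nnsfun_density.
rewrite -monotone_convergence//=.
- apply: eq_integral => x _; apply/cvg_lim => //.
  apply: cvgeZr => //; exact: cvg_nnsfun_approx.
- by move=> n; apply: emeasurable_funM; exact/measurable_EFinP.
- by move=> n ? _; rewrite mule_ge0// lee_fin.
- move=> x _ ? ? ?; apply: lee_wpmul2r; first by rewrite lee_fin.
  by rewrite lee_fin; exact/lefP/nd_nnsfun_approx.
Qed.

Lemma integrable_density (h : R -> R) : measurable_fun setT h ->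
  lbg.-integrable setT (fun x => (h x * g x)%:E) ->
  mu.-integrable setT (fun x => (h x)%:E).
Proof.
move=> mh /integrableP[_ hg]; apply/integrableP; split; first exact/measurable_EFinP.
rewrite ge0_integral_density//; last by apply: measurableT_comp => //; exact/measurable_EFinP.
apply: le_lt_trans hg.
by under [leRHS]eq_integral => x _ do rewrite /= normrM (ger0_norm (g0 x)).
Qed.

Lemma integral_density (h : R -> R) : measurable_fun setT h ->
  lbg.-integrable setT (fun x => (h x * g x)%:E) ->
  (\int[mu]_x (h x)%:E = \int[lbg]_x (h x * g x)%:E)%E.
Proof.
move=> mh ih; rewrite integralE [RHS]integralE.
have mE : measurable_fun setT (fun x => (h x)%:E) by exact/measurable_EFinP.
rewrite !ge0_integral_density//; last 2 first.
- exact: measurable_funeneg.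
- exact: measurable_funepos.
congr (_ - _)%E; apply: eq_integral => x _.
- rewrite !funeposE /= -!EFin_max -EFinM maxr_pMl ?mul0r//.
- rewrite !funenegE /= -!EFin_max -EFinM maxr_pMl ?mul0r// mulNr//.
Qed.

End Integral.

(** The intervals ]a, b] form an intersection-stable generator of the Borel sets. *)
Lemma eq_probability_cdf (P Q : probability (measurableTypeR R) R) :
  (forall x, P `]-oo, x]%classic = Q `]-oo, x]%classic) ->
  forall B, measurable B -> P B = Q B.
Proof.
move=> PQ B mB.
have oc (a b : R) : `]a, b]%classic = `]-oo, b] `\` `]-oo, a].
  by rewrite -[RHS]setCK setCD setCitvl setUC -[LHS]setCK setCitv.
have Poc (M : probability (measurableTypeR R) R) (a b : R) :
    M `]a, b]%classic = (if (a <= b)%R then M `]-oo, b]%classic - M `]-oo, a]%classic else 0)%E.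
  have [ab|ba] := leP a b; last by rewrite set_itv_ge ?measure0// bnd_simp -leNgt ltW.
  rewrite oc measureD ?setIidr//; first exact: subset_itvl.
  by rewrite -ge0_fin_numE// fin_num_measure.
apply: (@measure_unique _ R (measurableTypeR R) (@ocitv R)
   (fun k => `](- k%:R), k%:R]%classic)) mB => //.
- exact: ocitvI.
- by move=> k; exact: is_ocitv.
- apply/seteqP; split=> // x _; exists (Num.bound `|x|) => //=.
  have := archi_boundP (normr_ge0 x); rewrite in_itv/= ltr_norml => /andP[-> /ltW ->//].
- by move=> _ [[a b] _ <-] /=; rewrite !Poc !PQ.
- by move=> k; rewrite (le_lt_trans (probability_le1 _ _)) ?ltry.
Qed.

End Density.

(** * The limit law *)
Section LimitLaw.
Context {R : realType}.
Notation lbg := (@lebesgue_measure R).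
Implicit Types u v x y z : R.

Lemma phi_cvg_right u : phi x @[x --> u^'+] --> phi u.
Proof. by apply: cvg_at_right_filter; exact: continuous_phi. Qed.

Lemma derive1_phi u : derive1 (phi : R -> R) u = kappa u.
Proof. by rewrite derive1E; apply: derive_val; exact: is_derive_phi. Qed.

Lemma derivable_phi u : derivable (phi : R -> R) u 1.
Proof. by have [] := is_derive_phi u. Qed.

Lemma integral_kappa_tail u :
  (\int[lbg]_(x in `[u, +oo[) (kappa x)%:E = (gtail u)%:E)%E.
Proof.
rewrite (@ge0_continuous_FTC2y _ kappa phi u 2^-1) ?EFinB//.
- by move=> x _; exact/ltW/kappa_gt0.
- by apply/continuous_subspaceT/continuous_kappa.
- exact: phi_cvg_half.
- by move=> x _; exact: derivable_phi.
- exact: phi_cvg_right.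
- by move=> x _; exact: derive1_phi.
Qed.

Lemma measurable_kappa : measurable_fun setT (kappa : R -> R).
Proof. by apply: continuous_measurable_fun; exact: continuous_kappa. Qed.

Lemma kappa_ge0 u : 0 <= kappa u. Proof. exact/ltW/kappa_gt0. Qed.

Lemma integral_kappa : (\int[lbg]_x (kappa x)%:E = 1)%E.
Proof.
rewrite ge0_symfun_integralT; last 3 first.
- exact: kappa_ge0.
- exact: continuous_kappa.
- by move=> x /=; rewrite kappaN.
rewrite -set_itvcy integral_kappa_tail /gtail phi0 subr0 -EFinM mulfV//.
Qed.

Definition koenigs_law : probability (measurableTypeR R) R :=
  density_probability measurable_kappa kappa_ge0 integral_kappa.

Lemma koenigs_law_density : has_density koenigs_law kappa.
Proof. by split => //; [exact: measurable_kappa|exact: kappa_ge0]. Qed.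

Lemma koenigs_law_tail_oy u : koenigs_law `]u, +oo[%classic = (gtail u)%:E.
Proof.
rewrite -integral_kappa_tail -integral_itv_obnd_cbnd//.
by apply/measurable_EFinP; apply: measurable_funTS; exact: measurable_kappa.
Qed.

Lemma koenigs_law_cdf u : koenigs_law `]-oo, u]%classic = (2^-1 + phi u)%:E.
Proof.
rewrite -[X in koenigs_law X]setCK setCitvl probability_setC//.
by rewrite koenigs_law_tail_oy -EFinB /gtail; congr (_%:E); field.
Qed.

Definition reflection (x : measurableTypeR R) : measurableTypeR R := - x.

Lemma measurable_reflection :
  @measurable_fun _ _ (measurableTypeR R) (measurableTypeR R) setT reflection.
Proof. exact: oppr_measurable. Qed.

HB.instance Definition _ := isMeasurableFun.Build _ _ (measurableTypeR R)
  (measurableTypeR R) reflection measurable_reflection.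

(** The reflected law has the same distribution function because phi is odd. *)
Lemma koenigs_law_symmetric : symmetric_law koenigs_law.
Proof.
move=> B mB.
pose Q : probability (measurableTypeR R) R :=
  distribution koenigs_law (reflection : {RV koenigs_law >-> measurableTypeR R}).
rewrite -[LHS]/(Q B); apply: eq_probability_cdf => // x.
rewrite /Q /distribution /pushforward /=.
have -> : reflection @^-1` `]-oo, x]%classic = `[(- x), +oo[%classic.
  by apply/seteqP; split=> y /=; rewrite !in_itv/= ?andbT lerNl.
rewrite koenigs_law_cdf /koenigs_law/= /density_prob integral_kappa_tail.
by rewrite /gtail phiN opprK.
Qed.

Lemma koenigs_law_tail u : 0 <= u -> law_tail koenigs_law u = 2 * gtail u.
Proof.
move=> u0; rewrite /law_tail.
have mN : measurable ((fun x : R => - x) @^-1` `]u, +oo[%classic : set (measurableTypeR R)).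
  rewrite (_ : _ @^-1` _ = `]-oo, (- u)[%classic)//.
  by apply/seteqP; split=> y /=; rewrite !in_itv/= ?andbT ltrNr.
have -> : [set x | u < `|x|] =
    `]u, +oo[%classic `|` (fun x : R => - x) @^-1` `]u, +oo[%classic.
  by apply/seteqP; split=> y /=; rewrite !in_itv/= !andbT lter_normr; [move/orP|move=> h; apply/orP].
rewrite measureU//; last first.
  apply/seteqP; split=> // y [] /=; rewrite !in_itv/= !andbT => h1 h2.
  by have := ltr_pDl; lra.
rewrite [X in fine (_ + X)%E](_ : _ = (gtail u)%:E).
  rewrite [X in fine (X + _)%E](_ : _ = (gtail u)%:E) /=; first by ring.
  exact: koenigs_law_tail_oy.
rewrite -koenigs_law_tail_oy; exact: koenigs_law_symmetric.
Qed.

Lemma Aform_derive x : is_derive x (1 : R) Aform (2 * sin (pi * x) ^+ 2).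
Proof.
have h : is_derive x (1 : R) (fun y => y - (2 * pi)^-1 * sin (2 * pi * y))
  (1 - (2 * pi)^-1 * (cos (2 * pi * x) * (2 * pi))).
  apply: is_deriveB; apply: is_deriveZ.
  apply: (@is_derive1_comp _ sin (fun y => 2 * pi * y)).
  by apply: is_derive_eq; rewrite /GRing.scale/= mulr1.
have -> : Aform = fun y : R => y - (2 * pi)^-1 * sin (2 * pi * y).
  by apply/funext => y; rewrite /Aform [_ / _]mulrC.
apply: is_derive_eq; rewrite mulrCA mulVf ?twopi_neq0// mulr1.
have -> : 2 * pi * x = (pi * x) *+ 2 by rewrite mulr2n; ring.
by rewrite cos_mulr2n cos2sin2 mulr2n; ring.
Qed.

Lemma A_Aform z : 0 <= z -> A z = Aform z.
Proof.
rewrite le_eqVlt => /predU1P[<-|z0].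
  by rewrite /A set_itv1 Rintegral_set1 /Aform mulr0 sin0 mul0r subr0.
have dA := Aform_derive.
have cA : continuous (Aform : R -> R) by move=> x; exact: is_derive_continuous (dA x).
rewrite /A /Rintegral (@continuous_FTC2 _ _ Aform)//.
- by rewrite /= /Aform mulr0 sin0 mul0r !subr0.
- apply/continuous_subspaceT => x.
  have hs : {for x, continuous (fun s => sin (pi * s) : R)}.
    apply: continuous_comp; last exact: continuous_sin.
    by apply: cvgM; [exact: cvg_cst|exact: cvg_id].
  by apply: cvgM; [exact: cvg_cst|exact: (cvgM hs hs)].
- split; first by move=> x _; have [] := dA x.
  + by apply: cvg_at_right_filter; exact: cA.
  + by apply: cvg_at_left_filter; exact: cA.
- by move=> x _; rewrite derive1E; apply: derive_val.
Qed.

Definition Kfun u : R := 2^-1 + phi u.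

Lemma Kfun_gtail u : 1 - Kfun u = gtail u.
Proof. by rewrite /Kfun /gtail; field. Qed.

Lemma Kfun_double u : Kfun (2 * u) = A (Kfun u).
Proof.
rewrite A_Aform; first by rewrite /Kfun phi_double Aform_Bmap.
by have := phi_lt_half u; rewrite ltr_norml => /andP[/ltW h _]; rewrite /Kfun; lra.
Qed.

Lemma Kfun_koenigs : koenigs_linearizer_on setT Kfun.
Proof.
split.
- move=> u _; have := phi_lt_half u; rewrite ltr_norml /Kfun => /andP[h1 h2].
  have : (2^-1 + 2^-1 = 1 :> R) by field.
  by move=> e; apply/andP; split; lra.
- by move=> u v _ _ uv; rewrite /Kfun ltrD2l phi_increasing.
- by move=> u _ _; exact: Kfun_double.
- by rewrite /Kfun phi0 addr0.
- have h : is_derive (0 : R) (1 : R) (fun u => 2^-1 + phi u) (0 + kappa 0).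
    by apply: is_deriveD; exact: is_derive_phi.
  by rewrite add0r kappa0 in h.
Qed.

(** On an arbitrary linearizer L the equation gives L u as the n-th iterate at L (u / 2 ^ n); the
    normalisation L' 0 = 1 makes these iterates converge to the value of K. *)
Lemma Kfun_unique (r : R) (L : R -> R) : 0 < r ->
  koenigs_linearizer_on [set u | `|u| < r] L -> forall u, `|u| < r -> L u = Kfun u.
Proof.
move=> r0 [L01 _ Ld L0 L'] u ur.
have ur' n : `|u / 2 ^+ n| < r.
  rewrite normrM normfV (@ger0_norm _ (2 ^+ n)) ?exprn_ge0//.
  rewrite ltr_pdivrMr ?exprn_gt0// (lt_le_trans ur)// ler_peMr ?(ltW r0)//.
  by rewrite exprn_ege1// ler1n.
have LE n : L u - 2^-1 = iter n Bmap (L (u / 2 ^+ n) - 2^-1).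
  elim: n => [|n IH]; first by rewrite expr0 divr1.
  rewrite IH iterSr; congr (iter _ _ _).
  have e : u / 2 ^+ n = 2 * (u / 2 ^+ n.+1).
    by rewrite exprS; field; rewrite expf_neq0.
  have Pn := ur' n; have PSn := ur' n.+1; rewrite e in Pn *.
  rewrite Ld// A_Aform; last by have /andP[] := L01 _ PSn.
  rewrite -[X in Aform X](subrK 2^-1) [X in Aform X]addrC Aform_Bmap.
  by rewrite addrAC subrr add0r.
have h1 : (fun n => 2 ^+ n * (L (u / 2 ^+ n) - 2^-1)) @ \oo --> u.
  have := @derive_seq _ L 1 0 (fun n => 2 ^+ n) (fun n => u / 2 ^+ n) u L'.
  rewrite mul1r L0 (_ : (fun n => 2 ^+ n * (L (0 + u / 2 ^+ n) - 2^-1)) =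
    fun n => 2 ^+ n * (L (u / 2 ^+ n) - 2^-1)); last by apply/funext => n; rewrite add0r.
  apply; first exact: (@cvg_halves R u).
  rewrite (_ : (fun n => _) = cst u); first exact: cvg_cst.
  by apply/funext => n; exact: mul_halves.
have h2 := iter_Bmap_cvg h1.
have h3 : (fun n => iter n Bmap (L (u / 2 ^+ n) - 2^-1)) @ \oo --> L u - 2^-1.
  by under eq_cvg do rewrite -LE; exact: cvg_cst.
have := cvg_unique _ h2 h3 => /(_ (@norm_hausdorff _ _)).
by rewrite /Kfun => ->; rewrite addrC subrK.
Qed.

Lemma Kfun_bij : set_bij setT `]0, 1[ Kfun.
Proof.
split.
- move=> u _ /=; rewrite in_itv/= /Kfun.
  have := phi_lt_half u; rewrite ltr_norml => /andP[h1 h2].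
  have : (2^-1 + 2^-1 = 1 :> R) by field.
  by move=> e; apply/andP; split; lra.
- move=> u v _ _ /addrI e; apply/eqP; have [luv|lvu|//] := ltgtP u v.
    by have := phi_increasing luv; rewrite e ltxx.
  by have := phi_increasing lvu; rewrite e ltxx.
- move=> y /=; rewrite in_itv/= => /andP[y0 y1].
  pose e := Num.min y (1 - y).
  have e0 : 0 < e by rewrite lt_min y0/=; lra.
  have /cvgrPdist_lt/(_ _ e0) := @phi_cvg_half R.
  move=> [M [Mreal hM]].
  pose w := `|M| + 1.
  have w0 : 0 <= w by rewrite addr_ge0.
  have : `|2^-1 - phi w| < e.
    by apply: hM; rewrite /w (le_lt_trans (ler_norm M))// ltrDl.
  rewrite ltr_norml lt_min => /andP[_ /andP[h1 h2]].
  have [|||c _ ce] := @IVT _ Kfun (- w) w y.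
  - by lra.
  - apply/continuous_subspaceT => x; apply: cvgD; first exact: cvg_cst.
    exact: continuous_phi.
  - rewrite /Kfun phiN ge_min le_max; apply/andP; split.
      by apply/orP; left; lra.
    by apply/orP; right; lra.
  by exists c.
Qed.

(** The constant 1/2 is absorbed into the series. *)
Lemma Kfun_analytic : real_analytic Kfun.
Proof.
pose a n : R := koenigs_coef Bmap_coef n + (n == 0%N)%:R * 2^-1.
have ha : entire_series a.
  move=> r r0; have [M hM] := phi_entire r0; exists (M + 2^-1) => n.
  apply: (@le_trans _ _ (\sum_(i < n) (`|koenigs_coef Bmap_coef i : R| * r ^+ i +
     (i == 0%N :> nat)%:R * 2^-1))).
    apply: ler_sum => i _; rewrite /a (le_trans (ler_wpM2r _ (ler_normD _ _))) ?exprn_ge0//.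
    rewrite mulrDl lerD2l; case: eqP => [->|_]; rewrite ?mul0r ?normr0 ?mul0r// mul1r expr0 mulr1.
    by rewrite ger0_norm.
  rewrite big_split/=; apply: lerD; first exact: hM.
  case: n => [|n]; first by rewrite big_ord0.
  by rewrite big_ord_recl/= big1 ?addr0 ?mul1r// => i _; rewrite mul0r.
have -> : Kfun = series_fun a; last exact: entire_real_analytic.
apply/funext => u; apply/esym/cvg_lim => //; rewrite /Kfun phiE.
have -> : pseries a u = fun n => \sum_(0 <= i < n) (i == 0%N)%:R * 2^-1 * u ^+ i +
   pseries (koenigs_coef Bmap_coef) u n.
  apply/funext => n; rewrite /pseries /series /= -big_split /=.
  by apply: eq_bigr => i _; rewrite /a mulrDl addrC.
apply: cvgD; last exact: (entire_cvg_to phi_entire).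
apply: cvg_near_cst; near=> n.
have n1 : (0 < n)%N by near: n; exact: nbhs_infty_gt.
rewrite big_mkord (bigD1 (Ordinal n1))//= mul1r expr0 mulr1 big1 ?addr0// => i /negP i1.
case: eqP; rewrite ?mul0r// => hi; exfalso; apply: i1; exact/eqP/val_inj.
Unshelve. all: by end_near. Qed.

Lemma kappa_analytic : real_analytic (kappa : R -> R).
Proof. by rewrite kappaE; exact/entire_real_analytic/entire_diffs/phi_entire. Qed.

End LimitLaw.

(** * Taylor bounds for the sine *)
Section SineTaylor.
Context {R : realType}.
Implicit Types (x : R) (n : nat).

Definition sin_taylor n : {poly R} :=
  \sum_(i < n) ((-1) ^+ i / (i.*2.+1)`!%:R) *: 'X^(i.*2.+1).
Definition cos_taylor n : {poly R} :=
  \sum_(i < n) ((-1) ^+ i / (i.*2)`!%:R) *: 'X^(i.*2).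

Lemma deriv_sin_taylor n : (sin_taylor n)^`() = cos_taylor n.
Proof.
rewrite /sin_taylor raddf_sum; apply: eq_bigr => i _ /=.
rewrite derivZ derivXn -(scaler_nat _ 'X^_) scalerA; congr (_ *: _).
by rewrite factS natrM invfM mulrA mulrAC mulfVK// pnatr_eq0.
Qed.

Lemma deriv_cos_taylor n : (cos_taylor n.+1)^`() = - sin_taylor n.
Proof.
rewrite /cos_taylor big_ord_recl /= expr0 derivD derivZ derivXn mulr0n scaler0 add0r.
rewrite raddf_sum -sumrN; apply: eq_bigr => i _ /=.
rewrite /bump /= add1n doubleS derivZ derivXn /= -(scaler_nat _ 'X^_) scalerA -scaleNr; congr (_ *: _).
rewrite factS natrM exprS mulN1r mulNr mulNr; congr (- _).
by rewrite invfM mulrA mulrAC mulfVK// pnatr_eq0.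
Qed.

Lemma sin_taylor0 n : (sin_taylor n).[0] = 0.
Proof.
rewrite horner_sum big1// => i _.
by rewrite hornerZ hornerXn expr0n mulr0.
Qed.

Lemma cos_taylor0 n : (cos_taylor n.+1).[0] = 1.
Proof.
rewrite horner_sum big_ord_recl /= big1 ?addr0 => [|i _].
  by rewrite hornerZ hornerXn !expr0 divr1 mulr1.
by rewrite hornerZ hornerXn expr0n /= mulr0.
Qed.

(** Integrating the bound for the cosine gives the one for the sine, and back;
    the first step is cos <= 1. *)
Lemma sin_cos_taylor n x : 0 <= x ->
  0 <= (-1) ^+ n * ((sin_taylor n.+1).[x] - sin x) /\
  0 <= (-1) ^+ n * ((cos_taylor n.+1).[x] - cos x).
Proof.
have sinstep m : (forall x, 0 <= x -> 0 <= (-1) ^+ m * ((cos_taylor m.+1).[x] - cos x)) ->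
    forall x, 0 <= x -> 0 <= (-1) ^+ m * ((sin_taylor m.+1).[x] - sin x).
  move=> h y y0; pose F (z : R) := (-1) ^+ m * ((sin_taylor m.+1).[z] - sin z).
  have dF (z : R) : is_derive z (1 : R) F ((-1) ^+ m * ((cos_taylor m.+1).[z] - cos z)).
    apply: is_deriveZ; apply: is_deriveB; rewrite -deriv_sin_taylor.
    exact: is_derive_poly.
  apply: (@ler_deriv _ (cst 0) F (cst 0) _ 0 y y0 _ (fun z _ => dF z)).
  - by move=> z /andP[z0 _]; exact: h.
  - by rewrite /F sin_taylor0 sin0 subr0 mulr0.
elim: n x => [|n IH] x x0.
  have c0 (y : R) : 0 <= y -> 0 <= (-1) ^+ 0 * ((cos_taylor 1).[y] - cos y).
    move=> _; rewrite expr0 mul1r /cos_taylor big_ord1 hornerZ hornerXn !expr0 divr1 mulr1.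
    by rewrite subr_ge0 cos_le1.
  by split; [exact: sinstep|exact: c0].
have c1 (y : R) : 0 <= y -> 0 <= (-1) ^+ n.+1 * ((cos_taylor n.+2).[y] - cos y).
  move=> y0; pose F (z : R) := (-1) ^+ n.+1 * ((cos_taylor n.+2).[z] - cos z).
  have dF (z : R) : is_derive z (1 : R) F ((-1) ^+ n * ((sin_taylor n.+1).[z] - sin z)).
    have h : is_derive z (1 : R) F ((-1) ^+ n.+1 * ((- sin_taylor n.+1).[z] - - sin z)).
      apply: is_deriveZ; apply: is_deriveB; rewrite -deriv_cos_taylor.
      exact: is_derive_poly.
    by rewrite hornerN -opprD exprS mulN1r mulrNN in h.
  apply: (@ler_deriv _ (cst 0) F (cst 0) _ 0 y y0 _ (fun z _ => dF z)).
  - by move=> z /andP[z0 _]; have [] := IH z z0.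
  - by rewrite /F cos_taylor0 cos0 subrr mulr0.
by split; [exact: sinstep|exact: c1].
Qed.

Lemma sin_taylor_ge n x : 0 <= x -> sin x <= (sin_taylor n.*2.+1).[x].
Proof.
move=> x0; have [+ _] := sin_cos_taylor n.*2 x0.
by rewrite -signr_odd odd_double expr0 mul1r subr_ge0.
Qed.

Lemma sin_taylor_le n x : 0 <= x -> (sin_taylor n.*2.+2).[x] <= sin x.
Proof.
move=> x0; have [+ _] := sin_cos_taylor n.*2.+1 x0.
by rewrite -signr_odd /= odd_double expr1 mulN1r oppr_ge0 subr_le0.
Qed.

Lemma sin_le_id x : 0 <= x -> sin x <= x.
Proof.
move=> /(sin_taylor_ge 0); rewrite /sin_taylor big_ord1 hornerZ hornerXn.
by rewrite expr0 expr1 divr1 mul1r.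
Qed.

Lemma sin_ge_cubic x : 0 <= x -> x - x ^+ 3 / 6 <= sin x.
Proof.
move=> /(sin_taylor_le 0); rewrite /sin_taylor !big_ord_recl big_ord0 /= addr0.
rewrite hornerD !hornerZ !hornerXn; apply: le_trans; rewrite le_eqVlt; apply/orP; left; apply/eqP.
by rewrite /bump /= (_ : 3`! = 6%N)// (_ : 1`! = 1%N)// expr0 !expr1; field.
Qed.

Lemma sin_le_quintic x : 0 <= x -> sin x <= x - x ^+ 3 / 6 + x ^+ 5 / 120.
Proof.
move=> /(sin_taylor_ge 1); rewrite /sin_taylor !big_ord_recl big_ord0 /= addr0.
rewrite !hornerD !hornerZ !hornerXn => h; apply: (le_trans h).
rewrite le_eqVlt; apply/orP; left; apply/eqP.
rewrite /bump /= (_ : 3`! = 6%N)// (_ : 1`! = 1%N)// (_ : 5`! = 120%N)// expr0 !expr1 !add1n.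
by rewrite expr2; field.
Qed.

End SineTaylor.

(** * Order of contact at the endpoints *)
Section Endpoint.
Context {R : realType}.
Implicit Types (z u x : R).

Lemma Aform_nondecreasing x z : x <= z -> Aform x <= Aform z.
Proof.
move=> xz; have [c _ e] := mean_value xz (fun y _ => Aform_derive y).
by rewrite -subr_ge0 e mulr_ge0 ?subr_ge0// mulr_ge0// sqr_ge0.
Qed.

Definition cubic_rate : R := (2 * pi) ^+ 2 / 6.

Lemma cubic_rate_gt0 : 0 < cubic_rate.
Proof. by rewrite divr_gt0// exprn_gt0// twopi_gt0. Qed.

Lemma Aform_le_cubic z : 0 <= z -> Aform z <= cubic_rate * z ^+ 3.
Proof.
move=> z0; have x0 : 0 <= 2 * pi * z by rewrite mulr_ge0// ltW// twopi_gt0.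
have := sin_ge_cubic x0; rewrite /Aform /cubic_rate => h.
have t0 := @twopi_gt0 R; set t := 2 * pi in t0 h *.
rewrite lerBlDr -(@ler_pM2l _ t)// mulrDr [t * (_ / t)]mulrCA mulfV ?gt_eqF// mulr1.
have -> : t * (t ^+ 2 / 6 * z ^+ 3) = (t * z) ^+ 3 / 6 by field.
lra.
Qed.

Lemma Aform_ge_cubic z : 0 <= z ->
  cubic_rate * z ^+ 3 * (1 - (2 * pi * z) ^+ 2 / 20) <= Aform z.
Proof.
move=> z0; have x0 : 0 <= 2 * pi * z by rewrite mulr_ge0// ltW// twopi_gt0.
have := sin_le_quintic x0; rewrite /Aform /cubic_rate => h.
have t0 := @twopi_gt0 R; set t := 2 * pi in t0 h *.
rewrite lerBrDr -(@ler_pM2l _ t)// mulrDr [t * (_ / t)]mulrCA mulfV ?gt_eqF// mulr1.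
have -> : t * (t ^+ 2 / 6 * z ^+ 3 * (1 - (t * z) ^+ 2 / 20)) =
  (t * z) ^+ 3 / 6 - (t * z) ^+ 5 / 120 by field.
lra.
Qed.

Lemma Aform_cubic_cvg : Aform z / z ^+ 3 @[z --> 0^'+] --> cubic_rate.
Proof.
apply: (@squeeze_cvgr _ _ _ _ (fun z => cubic_rate * (1 - (2 * pi * z) ^+ 2 / 20)) (cst cubic_rate)).
- near=> z; have z0 : 0 < z by near: z; exact: nbhs_right_gt.
  have z3 : 0 < z ^+ 3 by rewrite exprn_gt0.
  rewrite ler_pdivlMr// ler_pdivrMr// Aform_le_cubic ?(ltW z0)// andbT.
  by rewrite mulrAC Aform_ge_cubic// ltW.
- apply: cvg_at_right_filter.
  have : {for 0, continuous (fun z => cubic_rate * (1 - (2 * pi * z) ^+ 2 / 20))}.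
    apply: (@is_derive_continuous _ _ (cubic_rate * (0 - 0))).
    have := @is_derive_poly R (cubic_rate *: (1 - ((2 * pi) ^+ 2 / 20) *: 'X^2)) 0.
    rewrite (_ : horner _ = (fun z => cubic_rate * (1 - (2 * pi * z) ^+ 2 / 20))).
      move=> h; apply: is_derive_eq.
      rewrite derivZ derivB derivZ derivXn derivC !hornerE /=; ring.
    by apply/funext => z; rewrite hornerZ hornerD hornerN hornerZ hornerXn hornerC exprMn; ring.
  by rewrite /prop_for /continuous_at /= mulr0 expr0n /= mul0r subr0 mulr1.
- exact: cvg_cst.
Unshelve. all: by end_near. Qed.

Lemma A_endpoint_degree : endpoint_degree (A : R -> R) 3.
Proof.
split; exists cubic_rate; rewrite ?cubic_rate_gt0//.
  apply: cvg_trans Aform_cubic_cvg; apply: near_eq_cvg; near=> z.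
  by rewrite A_Aform.
apply: cvg_trans Aform_cubic_cvg; apply: near_eq_cvg; near=> z.
rewrite A_Aform; last first.
  by rewrite subr_ge0; near: z; apply: nbhs_right_le.
congr (_ / _); rewrite !AformE.
have -> : 2^-1 - (1 - z) = - (2^-1 - z) by field.
by rewrite BmapN; field.
Unshelve. all: by end_near. Qed.

Lemma A_derive_half : is_derive (2^-1 : R) (1 : R) A 2.
Proof.
have h := @Aform_derive R 2^-1; rewrite sin_pihalf expr1n mulr1 in h.
apply: near_eq_is_derive h; near=> x; rewrite A_Aform//.
by apply: ltW; near: x; apply: lt_nbhsr; rewrite invr_gt0 ltr0n.
Unshelve. all: by end_near. Qed.

(** The quotient is controlled by the contact order near 0 and by monotonicity
    away from 0. *)
Lemma ln_Aform_bounded : exists2 M : R, 0 <= M &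
  forall z, 0 < z < 1 -> `|ln (Aform z) - 3 * ln z| <= M.
Proof.
pose a : R := (2 * pi)^-1.
have a0 : 0 < a by rewrite invr_gt0 twopi_gt0.
have c0 := cubic_rate_gt0.
have half z : 0 <= z -> z <= a -> cubic_rate / 2 * z ^+ 3 <= Aform z.
  move=> z0 za; apply: le_trans (Aform_ge_cubic z0).
  rewrite -mulrA -mulrA ler_pM2l// mulrC ler_wpM2l ?exprn_ge0//.
  have x0 : 0 <= 2 * pi * z by rewrite mulr_ge0// ltW// twopi_gt0.
  have x1 : 2 * pi * z <= 1.
    by rewrite -[leRHS](@mulfV _ (2 * pi)) ?twopi_neq0// ler_pM2l ?twopi_gt0.
  have : (2 * pi * z) ^+ 2 <= 1 by rewrite exprn_ile1.
  lra.
pose m := Num.min (cubic_rate / 2) (cubic_rate / 2 * a ^+ 3).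
have c2 : 0 < cubic_rate / 2 by rewrite divr_gt0.
have a3 : 0 < a ^+ 3 by rewrite exprn_gt0.
have m0 : 0 < m by rewrite lt_min c2/= mulr_gt0.
have lo z : 0 < z -> z < 1 -> m * z ^+ 3 <= Aform z.
  move=> z0 z1; have [za|az] := leP z a.
    apply: le_trans (half z (ltW z0) za); rewrite ler_wpM2r ?exprn_ge0 ?(ltW z0)//.
    by rewrite ge_min lexx.
  apply: (@le_trans _ _ (Aform a)); last exact/Aform_nondecreasing/ltW.
  apply: le_trans (half a (ltW a0) (lexx _)).
  apply: (@le_trans _ _ m); last by rewrite ge_min lexx orbT.
  by rewrite ler_piMr ?(ltW m0)// exprn_ile1 ?ltW.
exists (`|ln m| + `|ln cubic_rate|); first by rewrite addr_ge0.
move=> z /andP[z0 z1].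
have z3 : 0 < z ^+ 3 by rewrite exprn_gt0.
have lnz : ln (z ^+ 3) = 3 * ln z by rewrite lnXn// mulr_natl.
have A0 : 0 < Aform z by apply: lt_le_trans (lo z z0 z1); rewrite mulr_gt0.
have h1 : ln m + 3 * ln z <= ln (Aform z).
  by rewrite -lnz -lnM ?posrE// ler_ln ?posrE ?mulr_gt0// lo.
have h2 : ln (Aform z) <= ln cubic_rate + 3 * ln z.
  have hle := Aform_le_cubic (ltW z0); rewrite -lnz -lnM ?posrE//.
  have ? : 0 < cubic_rate * z ^+ 3 by rewrite mulr_gt0.
  by rewrite ler_ln ?posrE.
have := ler_norm (ln cubic_rate); have := ler_norm (- ln m); rewrite normrN.
have := normr_ge0 (ln cubic_rate); have := normr_ge0 (ln m).
by move=> ? ? ? ?; rewrite ler_norml; apply/andP; split; lra.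
Qed.

End Endpoint.

(** * Tails of the limit law *)
(** In the logarithmic scale the cubic contact of A at 0 becomes multiplication by 3, up to a
    bounded error. *)
HB.lock Definition tail_exponent {R : realType} (u : R) : R := - ln (gtail u).

Section Tails.
Context {R : realType}.
Implicit Types (z u v x : R) (n : nat).

Lemma tail_exponentE u : tail_exponent u = - ln (gtail u).
Proof. by rewrite unlock. Qed.

Lemma tail_exponent_nondecreasing u v : u <= v -> tail_exponent u <= tail_exponent v.
Proof.
by move=> uv; rewrite !tail_exponentE lerN2 ler_ln ?posrE ?gtail_gt0// gtail_nonincreasing.
Qed.

Lemma gtail_exponent u : gtail u = expR (- tail_exponent u).
Proof. by rewrite tail_exponentE opprK lnK// posrE gtail_gt0. Qed.

Lemma continuous_gtail : continuous (gtail : R -> R).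
Proof. by move=> x; apply: cvgB; [exact: cvg_cst|exact: continuous_phi]. Qed.

Lemma continuous_tail_exponent : continuous (tail_exponent : R -> R).
Proof.
rewrite unlock => x; apply: cvgN; apply: continuous_cvg; last exact: continuous_gtail.
exact/continuous_ln/gtail_gt0.
Qed.

Lemma gtail_cvg0 : gtail u @[u --> +oo] --> (0 : R).
Proof.
rewrite -[X in _ --> X](subrr 2^-1); apply: cvgB; first exact: cvg_cst.
exact: phi_cvg_half.
Qed.

Lemma tail_exponent_unbounded (B : R) : exists u, B <= tail_exponent u.
Proof.
have /cvgrPdist_le/(_ (expR (- B)) (expR_gt0 _))[M [Mr hM]] := gtail_cvg0.
exists (M + 1); have := hM (M + 1); rewrite ltrDl => /(_ ltr01).
rewrite sub0r normrN ger0_norm ?(ltW (gtail_gt0 _))// => h.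
by rewrite tail_exponentE lerNr -[leRHS]expRK ler_ln ?posrE ?gtail_gt0 ?expR_gt0.
Qed.

Lemma tail_exponent_double : exists2 M : R, 0 <= M &
  forall u, `|tail_exponent (2 * u) - 3 * tail_exponent u| <= M.
Proof.
have [M M0 hM] := @ln_Aform_bounded R; exists M => // u.
have := hM (gtail u); rewrite gtail_gt0 gtail_lt1 => /(_ isT).
rewrite !tail_exponentE gtail_double -normrN; apply: le_trans.
rewrite le_eqVlt; apply/orP; left; apply/eqP; congr (`|_|); ring.
Qed.

Definition scaled_exponent u n : R := 3^-1 ^+ n * tail_exponent (2 ^+ n * u).

End Tails.

HB.lock Definition limit_exponent {R : realType} (u : R) : R :=
  limn (scaled_exponent u).

Section LimitExponent.
Context {R : realType}.
Implicit Types (z u v x : R) (n : nat).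

(** The scaled exponents, corrected by plus or minus M / 2 times 3 ^ (- n), form
    two adjacent sequences. *)
Lemma limit_exponent_dist : exists2 M : R, 0 <= M &
  forall u n, `|limit_exponent u - scaled_exponent u n| <= 3^-1 ^+ n * M.
Proof.
have [M M0 hM] := @tail_exponent_double R; exists (M / 2); first by rewrite divr_ge0.
move=> u.
pose a n := scaled_exponent u n + 3^-1 ^+ n * (M / 2).
pose b n := scaled_exponent u n - 3^-1 ^+ n * (M / 2).
have step n : `|scaled_exponent u n.+1 - scaled_exponent u n| <= 3^-1 ^+ n.+1 * M.
  rewrite /scaled_exponent [2 ^+ n.+1]exprS -mulrA.
  have -> : 3^-1 ^+ n.+1 * tail_exponent (2 * (2 ^+ n * u)) - 3^-1 ^+ n * tail_exponent (2 ^+ n * u) =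
    3^-1 ^+ n.+1 * (tail_exponent (2 * (2 ^+ n * u)) - 3 * tail_exponent (2 ^+ n * u)).
    by rewrite exprS; field.
  rewrite normrM ger0_norm ?exprn_ge0 ?invr_ge0//.
  by rewrite ler_wpM2l ?exprn_ge0 ?invr_ge0.
have p0 n : 0 <= 3^-1 ^+ n :> R by rewrite exprn_ge0 ?invr_ge0.
have qM n : 3^-1 ^+ n.+1 * M = 2 / 3 * (3^-1 ^+ n * (M / 2)) by rewrite exprS; field.
have qM2 n : 3^-1 ^+ n.+1 * (M / 2) = 3^-1 * (3^-1 ^+ n * (M / 2)) by rewrite exprS; field.
have na : nonincreasing_seq a.
  apply/nonincreasing_seqP => n; have := step n; rewrite ler_norml => /andP[_].
  by rewrite /a qM qM2; lra.
have nb : nondecreasing_seq b.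
  apply/nondecreasing_seqP => n; have := step n; rewrite ler_norml => /andP[+ _].
  by rewrite /b qM qM2; lra.
have ba n : b n <= a n by rewrite /a /b lerD2l ge0_cp// mulr_ge0// divr_ge0.
have ab m n : b m <= a n.
  apply: (@le_trans _ _ (b (maxn m n))); first by apply: nb; exact: leq_maxl.
  by apply: (le_trans (ba _)); apply: na; exact: leq_maxr.
have z0 : (fun n => 3^-1 ^+ n * (M / 2)) @ \oo --> (0 : R).
  rewrite -[X in _ --> X](mul0r (M / 2)); apply: cvgM; last exact: cvg_cst.
  by apply: cvg_expr; rewrite ger0_norm ?invr_ge0// invf_lt1 ?ltr1n.
have ca : cvgn a by apply: nonincreasing_is_cvgn => //; exists (b 0%N) => _ [n _ <-].
have cs : scaled_exponent u @ \oo --> limn a.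
  have -> : scaled_exponent u = fun n => a n - 3^-1 ^+ n * (M / 2).
    by apply/funext => n; rewrite /a addrK.
  by rewrite -[X in _ --> X]subr0; apply: cvgB.
have -> : limit_exponent u = limn a by rewrite unlock; apply/cvg_lim.
have cb : b @ \oo --> limn a.
  by rewrite -[X in _ --> X]subr0; apply: cvgB.
move=> n; rewrite ler_norml; apply/andP; split.
  have : b n <= limn a.
    rewrite -(cvg_lim _ cb)//; apply: nondecreasing_cvgn_le => //.
    by apply/cvg_ex; exists (limn a).
  by rewrite /b; lra.
have : limn a <= a n by exact: nonincreasing_cvgn_ge.
by rewrite /a; lra.
Qed.

Lemma scaled_exponent_cvg u : scaled_exponent u @ \oo --> limit_exponent u.
Proof.
have [M M0 hM] := limit_exponent_dist.
have z0 : (fun n => 3^-1 ^+ n * M) @ \oo --> (0 : R).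
  rewrite -[X in _ --> X](mul0r M); apply: cvgM; last exact: cvg_cst.
  by apply: cvg_expr; rewrite ger0_norm ?invr_ge0// invf_lt1 ?ltr1n.
apply/cvgrPdist_le => e e0.
have /cvgrPdist_le/(_ e e0) := z0; apply: filterS => n; rewrite sub0r normrN => h.
by apply: (le_trans (hM u n)); apply: le_trans h; exact: ler_norm.
Qed.

(** The shift of the sequence by one step is a doubling of u, up to the factor 3. *)
Lemma limit_exponent_double u : limit_exponent (2 * u) = 3 * limit_exponent u.
Proof.
have h1 : (fun n => 3 * scaled_exponent u n.+1) @ \oo --> 3 * limit_exponent u.
  apply: cvgM; first exact: cvg_cst.
  by have := @scaled_exponent_cvg u; rewrite -(cvg_shiftS (scaled_exponent u)).
have h2 : (fun n => 3 * scaled_exponent u n.+1) @ \oo --> limit_exponent (2 * u).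
  rewrite (_ : (fun n => _) = scaled_exponent (2 * u)); first exact: scaled_exponent_cvg.
  apply/funext => n; rewrite /scaled_exponent exprS [2 ^+ n.+1]exprSr !mulrA.
  by rewrite mulfV ?mul1r.
exact: (cvg_unique _ h2 h1).
Qed.

Lemma limit_exponent_nondecreasing u v : 0 <= u -> u <= v -> limit_exponent u <= limit_exponent v.
Proof.
move=> u0 uv; rewrite -(cvg_lim _ (@scaled_exponent_cvg u))// -(cvg_lim _ (@scaled_exponent_cvg v))//.
apply: ler_lim; [by apply/cvg_ex; eexists; exact: scaled_exponent_cvg
  |by apply/cvg_ex; eexists; exact: scaled_exponent_cvg|].
near=> n; rewrite ler_wpM2l ?exprn_ge0 ?invr_ge0// tail_exponent_nondecreasing//.
by rewrite ler_wpM2l// exprn_ge0.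
Unshelve. all: by end_near. Qed.

(** The exponent tends to infinity, so at some 2 ^ n u it exceeds the error bound M. *)
Lemma limit_exponent_gt0 u : 0 < u -> 0 < limit_exponent u.
Proof.
move=> u0; have [M M0 hM] := limit_exponent_dist.
have [w hw] := tail_exponent_unbounded (M + 1).
have [n wn] := natr_expr_bound (w / u).
have := hM u n; rewrite ler_norml => /andP[+ _].
have p0 : 0 < 3^-1 ^+ n :> R by rewrite exprn_gt0 ?invr_gt0.
have : M + 1 <= tail_exponent (2 ^+ n * u).
  by apply: (le_trans hw); rewrite tail_exponent_nondecreasing// -ler_pdivrMr.
rewrite -(@ler_pM2l _ (3^-1 ^+ n))// -/(scaled_exponent u n) mulrDr mulr1; lra.
Qed.

Lemma continuous_limit_exponent : continuous (limit_exponent : R -> R).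
Proof.
move=> u; have [M M0 hM] := limit_exponent_dist.
apply/cvgrPdist_le => e e0.
have z0 : (fun n => 3^-1 ^+ n * M) @ \oo --> (0 : R).
  rewrite -[X in _ --> X](mul0r M); apply: cvgM; last exact: cvg_cst.
  by apply: cvg_expr; rewrite ger0_norm ?invr_ge0// invf_lt1 ?ltr1n.
have e3 : 0 < e / 3 by rewrite divr_gt0.
have /cvgrPdist_le/(_ _ e3)[n _ /(_ n (leqnn n))] := z0.
rewrite /= sub0r normrN => hn; have hn' := le_trans (ler_norm _) hn.
have sc : {for u, continuous (fun v => scaled_exponent v n)}.
  apply: cvgM; first exact: cvg_cst.
  apply: continuous_comp; last exact: continuous_tail_exponent.
  by apply: cvgM; [exact: cvg_cst|exact: cvg_id].
have /cvgrPdist_le/(_ _ e3) := sc; apply: filterS => v h.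
have := hM u n; have := hM v n; rewrite !ler_norml => /andP[? ?] /andP[? ?].
move: h; rewrite !ler_norml => /andP[? ?]; apply/andP; split; lra.
Qed.

(** Dividing by 3 ^ x = (2 ^ x) ^ log2 3 removes the growth; doubling u is translation of x by 1. *)
Definition Theta x : R := limit_exponent (2 `^ x) / 3 `^ x.

Lemma Theta_gt0 x : 0 < Theta x.
Proof. by rewrite divr_gt0 ?limit_exponent_gt0 ?powR_gt0. Qed.

Lemma Theta_periodic x : Theta (x + 1) = Theta x.
Proof.
have e (b : R) : 0 < b -> b `^ (x + 1) = b * b `^ x.
  move=> b0; rewrite powRD; last by rewrite (gt_eqF b0) implybT.
  by rewrite powRr1 ?(ltW b0)// mulrC.
rewrite /Theta !e// limit_exponent_double invfM mulrACA mulfV ?mul1r//.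
Qed.

Lemma continuous_Theta : continuous Theta.
Proof.
have cp (b x : R) : 0 < b -> {for x, continuous (fun x => b `^ x)}.
  move=> b0; rewrite /powR gt_eqF//.
  apply: continuous_comp; last exact: continuous_expR.
  by apply: cvgM; [exact: cvg_id|exact: cvg_cst].
move=> x; apply: cvgM.
  by apply: continuous_comp; [exact: cp|exact: continuous_limit_exponent].
by apply: cvgV; [rewrite gt_eqF// powR_gt0|exact: cp].
Qed.

Lemma ln2_gt0 : 0 < ln 2 :> R. Proof. by rewrite ln_gt0// ltr1n. Qed.

Lemma powR2_log2 u : 0 < u -> 2 `^ log2 u = u.
Proof.
move=> u0; rewrite /powR gt_eqF// /log2 divfK ?gt_eqF ?ln2_gt0//.
by rewrite lnK// posrE.
Qed.

Lemma powR3_log2 u : 0 < u -> 3 `^ log2 u = u `^ log2 3.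
Proof.
move=> u0; rewrite /powR !gt_eqF// /log2; congr expR; ring.
Qed.

Lemma limit_exponent_Theta u : 0 < u ->
  limit_exponent u = u `^ log2 3 * Theta (log2 u).
Proof.
move=> u0; rewrite /Theta powR2_log2// powR3_log2// mulrCA mulfV ?mulr1//.
by rewrite gt_eqF// powR_gt0.
Qed.

Lemma Theta_bounds x : 0 <= x -> limit_exponent 1 / 3 <= Theta x <= limit_exponent 2.
Proof.
move=> x0; have /andP[n1 n2] := truncn_itv x0; set n := Num.trunc x in n1 n2.
have per (k : nat) y : Theta (y + k%:R) = Theta y.
  elim: k => [|k IH]; first by rewrite addr0.
  by rewrite -natr1 addrA Theta_periodic.
rewrite -(subrK n%:R x) per; set y := x - _.
have y0 : 0 <= y by rewrite subr_ge0.
have y1 : y <= 1 by rewrite lerBlDr; move: n2; rewrite -nat1r => /ltW.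
have b1 (b : R) : 1 <= b -> 1 <= b `^ y <= b.
  move=> b1; rewrite -{1}(powRr0 b) ler_powR//= -[leRHS]powRr1 ?(le_trans _ b1)//.
  by rewrite ler_powR.
have /andP[l1 l2] := b1 2 (ler1n _ 2); have /andP[l3 l4] := b1 3 (ler1n _ 3).
have L1 := limit_exponent_gt0 (@ltr01 R).
rewrite /Theta; apply/andP; split.
  rewrite ler_pM ?(ltW L1) ?invr_ge0//; first exact: limit_exponent_nondecreasing.
  by rewrite lef_pV2 ?posrE ?powR_gt0.
rewrite ler_pdivrMr ?powR_gt0//; apply: (@le_trans _ _ (limit_exponent 2)).
  by rewrite limit_exponent_nondecreasing ?powR_ge0.
by rewrite ler_peMr// ltW// limit_exponent_gt0.
Qed.

Lemma near_powR_ge (B b : R) : 0 < b -> \forall u \near +oo, B <= u `^ b.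
Proof.
move=> b0; near=> u.
have u1 : (`|B| + 1) `^ b^-1 <= u by near: u; apply: nbhs_pinfty_ge; exact: num_real.
apply: (@le_trans _ _ (((`|B| + 1) `^ b^-1) `^ b)).
  rewrite -powRrM mulVf ?gt_eqF// powRr1 ?addr_ge0//.
  by rewrite (le_trans (ler_norm B))// lerDl.
by rewrite ge0_ler_powR ?nnegrE ?powR_ge0 ?(ltW b0)// (le_trans _ u1)// powR_ge0.
Unshelve. all: by end_near. Qed.

Lemma log2_3_gt1 : 1 < log2 3 :> R.
Proof. by rewrite /log2 ltr_pdivlMr ?ln2_gt0// mul1r ltr_ln ?posrE// ltr_nat. Qed.

Lemma log2_3_lt2 : log2 3 < 2 :> R.
Proof.
rewrite /log2 ltr_pdivrMr ?ln2_gt0// mulr_natl -lnXn// ltr_ln ?posrE//.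
by rewrite -natrX ltr_nat.
Qed.

Lemma log2_ge0 u : 1 <= u -> 0 <= log2 u.
Proof. by move=> u1; rewrite divr_ge0 ?ln_ge0// ler1n. Qed.

(** The relative error h is tail_exponent / limit_exponent - 1: a bounded numerator over a
    denominator of order u ^ log2 3. *)
Lemma tail_exponent_Theta :
  [/\ continuous Theta, (forall x, 0 < Theta x),
     (forall x, Theta (x + 1) = Theta x)
   & exists (h : R -> R) (C : R),
      (\forall u \near +oo, `|h u| <= C * u `^ (- log2 3)) /\
      forall u, 0 < u -> - ln (1 - Kfun u) =
        u `^ log2 3 * Theta (log2 u) * (1 + h u)].
Proof.
split; [exact: continuous_Theta|exact: Theta_gt0|exact: Theta_periodic|].
have [M M0 hM] := limit_exponent_dist.
have L1 := limit_exponent_gt0 (@ltr01 R).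
exists (fun u => tail_exponent u / limit_exponent u - 1), (M / (limit_exponent 1 / 3)); split.
  near=> u.
  have u1 : 1 <= u by near: u; apply: nbhs_pinfty_ge; exact: num_real.
  have u0 : 0 < u by exact: lt_le_trans u1.
  have Lu := limit_exponent_gt0 u0.
  have -> : tail_exponent u / limit_exponent u - 1 =
      (tail_exponent u - limit_exponent u) / limit_exponent u.
    by rewrite mulrBl mulfV ?gt_eqF.
  rewrite normrM normfV (gtr0_norm Lu) ler_pdivrMr//.
  have := hM u 0%N; rewrite /scaled_exponent !expr0 !mul1r distrC => /le_trans; apply.
  rewrite powRN (limit_exponent_Theta u0).
  have /andP[T1 _] := Theta_bounds (log2_ge0 u1).
  have p0 : 0 < u `^ log2 3 by rewrite powR_gt0.
  rewrite -!mulrA [(u `^ _)^-1 * _]mulrA mulVf ?gt_eqF// mul1r.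
  by rewrite ler_peMr// mulrC ler_pdivlMr ?mul1r// divr_gt0.
move=> u u0; rewrite Kfun_gtail -limit_exponent_Theta// addrC subrK -tail_exponentE.
by rewrite mulrC divfK// gt_eqF// limit_exponent_gt0.
Unshelve. all: by end_near. Qed.

Lemma koenigs_law_compressed : compressed_exponential_tails (koenigs_law : probability (measurableTypeR R) R) (log2 3).
Proof.
split; first exact: log2_3_gt1.
have [M M0 hM] := limit_exponent_dist.
have L1 := limit_exponent_gt0 (@ltr01 R).
have L2 := @limit_exponent_gt0 2 (ltr0n _ 2).
pose c : R := limit_exponent 1 / 3; have c0 : 0 < c by rewrite divr_gt0.
exists (c / 2), (2 * limit_exponent 2); split; rewrite ?divr_gt0 ?mulr_gt0//.
near=> u.
have u1 : 1 <= u by near: u; apply: nbhs_pinfty_ge; exact: num_real.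
have u0 : 0 < u by exact: lt_le_trans u1.
rewrite koenigs_law_tail ?(ltW u0)// gtail_exponent.
have := hM u 0%N; rewrite /scaled_exponent !expr0 !mul1r ler_norml => /andP[h1 h2].
have /andP[T1 T2] := Theta_bounds (log2_ge0 u1).
have pB1 : M / limit_exponent 2 <= u `^ log2 3.
  by near: u; apply: near_powR_ge; rewrite (lt_trans _ log2_3_gt1).
have pB2 : (M + ln 2) / (c / 2) <= u `^ log2 3.
  by near: u; apply: near_powR_ge; rewrite (lt_trans _ log2_3_gt1).
set p := u `^ log2 3 in pB1 pB2 *.
have p0 : 0 < p by rewrite powR_gt0.
rewrite ler_pdivrMr// in pB1; rewrite ler_pdivrMr ?divr_gt0// in pB2.
have LE := limit_exponent_Theta u0; rewrite -/p in LE.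
have LE1 : limit_exponent u <= p * limit_exponent 2 by rewrite LE ler_pM2l.
have LE2 : p * c <= limit_exponent u by rewrite LE ler_pM2l.
apply/andP; split.
  apply: (@le_trans _ _ (expR (- tail_exponent u))); first by rewrite ler_expR; lra.
  by rewrite ler_peMl ?expR_ge0// ler1n.
rewrite -[X in X * _](@lnK _ 2) ?posrE// -expRD ler_expR; lra.
Unshelve. all: by end_near. Qed.

Lemma koenigs_law_lighter : lighter_than_exponential (koenigs_law : probability (measurableTypeR R) R).
Proof.
move=> c c0; have [_ [c1 [c2 [c1_0 c2_0 h]]]] := koenigs_law_compressed.
apply: (@squeeze_cvgr _ _ _ _ (cst 0) (fun u => expR (- u))); last 2 first.
- exact: cvg_cst.
- exact: cvgr_expR.
near=> u.
have u1 : 1 <= u by near: u; apply: nbhs_pinfty_ge; exact: num_real.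
have u0 : 0 < u by exact: lt_le_trans u1.
have /andP[_ hu] : expR (- (c2 * u `^ log2 3)) <= law_tail (@koenigs_law R) u <=
    expR (- (c1 * u `^ log2 3)) by near: u.
rewrite divr_ge0 ?expR_ge0//=.
  rewrite ler_pdivrMr ?expR_gt0// -expRD; apply: (le_trans hu); rewrite ler_expR.
  have pB : (c + 1) / c1 <= u `^ (log2 3 - 1).
    by near: u; apply: near_powR_ge; rewrite subr_gt0 log2_3_gt1.
  rewrite ler_pdivrMr// in pB.
  rewrite -(@mulr_powRB1 _ u) ?(ltW u0) ?(lt_trans _ log2_3_gt1)//.
  have : u * (c + 1) <= u * (u `^ (log2 3 - 1) * c1) by rewrite ler_pM2l.
  lra.
by rewrite koenigs_law_tail ?(ltW u0)// mulr_ge0// ltW// gtail_gt0.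
Unshelve. all: by end_near. Qed.

Lemma koenigs_law_heavier : heavier_than_gaussian (koenigs_law : probability (measurableTypeR R) R).
Proof.
move=> c c0; have [_ [c1 [c2 [c1_0 c2_0 h]]]] := koenigs_law_compressed.
apply: (@squeeze_cvgr _ _ _ _ (cst 0) (fun u => expR (- u))); last 2 first.
- exact: cvg_cst.
- exact: cvgr_expR.
near=> u.
have u1 : 1 <= u by near: u; apply: nbhs_pinfty_ge; exact: num_real.
have u0 : 0 < u by exact: lt_le_trans u1.
have /andP[hu _] : expR (- (c2 * u `^ log2 3)) <= law_tail (@koenigs_law R) u <=
    expR (- (c1 * u `^ log2 3)) by near: u.
have t0 : 0 < law_tail (@koenigs_law R) u by rewrite (lt_le_trans _ hu)// expR_gt0.
rewrite divr_ge0 ?expR_ge0 ?(ltW t0)//= ler_pdivrMr//.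
apply: (@le_trans _ _ (expR (- u) * expR (- (c2 * u `^ log2 3)))); last first.
  by rewrite ler_wpM2l ?expR_ge0.
rewrite -expRD ler_expR.
have pB : (c2 + 1) / c <= u `^ (2 - log2 3).
  by near: u; apply: near_powR_ge; rewrite subr_gt0 log2_3_lt2.
rewrite ler_pdivrMr// in pB.
have e : u ^+ 2 = u `^ log2 3 * u `^ (2 - log2 3).
  rewrite -powRD; last by rewrite (gt_eqF u0) implybT.
  by rewrite addrC subrK powR_mulrn// ltW.
have pu : u <= u `^ log2 3 by rewrite le1r_powR// ltW// log2_3_gt1.
rewrite e; set p := u `^ log2 3 in pu *; set q := u `^ _ in pB *.
have : p * (c2 + 1) <= p * (q * c) by rewrite ler_pM2l// (lt_le_trans u0).
lra.
Unshelve. all: by end_near. Qed.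

End LimitExponent.

(** * Iterated densities *)
Section Iterates.
Context {R : realType}.
Notation lbg := (@lebesgue_measure R).
Implicit Types (x y c e : R) (f : R -> R).

(** The interval is a parameter because all iterates are positive on the same one. *)
Definition positive_density (a b : \bar R) f : Prop :=
  [/\ forall x, (a < x%:E < b)%E -> 0 < f x /\ {for x, continuous f},
      forall x, ~~ (a < x%:E < b)%E -> f x = 0,
      (\int[lbg]_x (f x)%:E = 1)%E
    & measurable_fun setT f].

Lemma sqr_sin_le1 x : sin x ^+ 2 <= 1.
Proof. by rewrite sin2cos2 gerBl sqr_ge0. Qed.

Section OneStep.
Variables (a b : \bar R) (f : R -> R).
Hypothesis fD : positive_density a b f.
Let F := density_cdf f.

Lemma pd_ge0 x : 0 <= f x.
Proof.
have [h1 h2 _ _] := fD; have [/h1[/ltW]//|/negP/negP/h2 ->//] := boolP (a < x%:E < b)%E.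
Qed.

Lemma pd_integrable : lbg.-integrable setT (EFin \o f).
Proof.
have [_ _ h3 h4] := fD; apply/integrableP; split; first exact/measurable_EFinP.
under eq_integral => x _ do rewrite /= ger0_norm ?pd_ge0//.
by rewrite h3 ltry.
Qed.

Lemma pd_integrableS D : measurable D -> lbg.-integrable D (EFin \o f).
Proof. by move=> mD; apply: integrableS pd_integrable. Qed.

Lemma pd_Rintegral_ge0 D : 0 <= \int[lbg]_(x in D) f x.
Proof. by apply: Rintegral_ge0 => x _; exact: pd_ge0. Qed.

Lemma pd_RintegralT : \int[lbg]_x f x = 1.
Proof. by have [_ _ h3 _] := fD; rewrite /Rintegral h3. Qed.

Lemma cdf_diff x y : x <= y -> F y - F x = \int[lbg]_(t in `]x, y]) f t.
Proof.
move=> xy; rewrite /F /density_cdf Rintegral_itvB// ?bnd_simp//.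
exact: pd_integrableS.
Qed.

Lemma cdf_compl x : 1 - F x = \int[lbg]_(t in `]x, +oo[) f t.
Proof.
rewrite -pd_RintegralT -set_itvNyy /F /density_cdf Rintegral_itvB//.
exact: pd_integrableS.
Qed.

Lemma cdf_nd x y : x <= y -> F x <= F y.
Proof. by move=> xy; rewrite -subr_ge0 cdf_diff// pd_Rintegral_ge0. Qed.

Lemma cdf_ge0' x : 0 <= F x.
Proof. exact: pd_Rintegral_ge0. Qed.

Lemma cdf_le1' x : F x <= 1.
Proof. by rewrite -subr_ge0 cdf_compl pd_Rintegral_ge0. Qed.

(** Absolute continuity of the integral. *)
Lemma cdf_modulus e : 0 < e -> exists2 d, 0 < d &
  forall x y, x <= y -> y < x + d -> F y - F x < e.
Proof.
move=> e0; have [d [d0 hd]] := integral_normr_continuous pd_integrable e0.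
exists d => // x y xy yx; rewrite cdf_diff//.
have -> : \int[lbg]_(t in `]x, y]) f t = \int[lbg]_(t in `]x, y]) `|f t|.
  by apply: eq_Rintegral => t _; rewrite ger0_norm ?pd_ge0.
apply: hd => //.
suff : (lebesgue_measure (`]x, y]%classic : set R) < d%:E)%E by [].
rewrite lebesgue_measure_itv/= lte_fin.
by case: ifPn => _; rewrite -?EFinB lte_fin//; lra.
Qed.

Lemma cdf_left x : (x%:E <= a)%E -> F x = 0.
Proof.
move=> xa; rewrite /F /density_cdf (@eq_Rintegral _ _ _ _ _ (cst 0)).
  by rewrite Rintegral_cst ?mul0r.
move=> t; rewrite inE/= in_itv/= => tx; have [_ -> //] := fD.
by rewrite negb_and -!leNgt (le_trans _ xa).
Qed.

Lemma cdf_right x : (b <= x%:E)%E -> F x = 1.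
Proof.
move=> bx; apply/eqP; rewrite eq_sym -subr_eq0 cdf_compl; apply/eqP.
rewrite (@eq_Rintegral _ _ _ _ _ (cst 0)).
  by rewrite Rintegral_cst ?mul0r.
move=> t; rewrite inE/= in_itv/= andbT => xt; have [_ -> //] := fD.
by rewrite negb_and -!leNgt (le_trans bx) ?orbT// lee_fin ltW.
Qed.

Lemma pd_interior : exists x, (a < x%:E < b)%E.
Proof.
apply: contrapT => h; have := pd_RintegralT.
rewrite (@eq_Rintegral _ _ _ _ _ (cst 0)).
  by rewrite Rintegral_cst ?mul0r// => /eqP; rewrite eq_sym oner_eq0.
move=> t _; have [_ -> //] := fD; apply/negP => ht; apply: h; by exists t.
Qed.

Let idR : measurableTypeR R -> R := idfun.

#[local] HB.instance Definition _ :=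
  @isMeasurableFun.Build _ _ _ _ idR (@measurable_id _ _ setT).

Lemma cdf_cvgNy : F x @[x --> -oo] --> (0 : R).
Proof.
have [_ _ h3 h4] := fD.
pose P := density_probability h4 pd_ge0 h3.
have := @cvg_cdfNy0 _ _ _ P (idR : {RV P >-> R}).
move=> /fine_cvg; apply: cvg_trans; apply: near_eq_cvg; near=> x.
by [].
Unshelve. all: by end_near. Qed.

Lemma cdf_cvgy : F x @[x --> +oo] --> (1 : R).
Proof.
have [_ _ h3 h4] := fD.
pose P := density_probability h4 pd_ge0 h3.
have := @cvg_cdfy1 _ _ _ P (idR : {RV P >-> R}).
move=> /fine_cvg; apply: cvg_trans; apply: near_eq_cvg; near=> x.
by [].
Unshelve. all: by end_near. Qed.

Lemma cdf_small e : 0 < e -> exists2 c, (a < c%:E < b)%E & F c < e.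
Proof.
move=> e0; have [x0 /andP[ax0 x0b]] := pd_interior.
have below c : c <= x0 -> (c%:E < b)%E by move=> cx; rewrite (le_lt_trans _ x0b)// lee_fin.
case: a ax0 (@cdf_left) => [r| |] // ax0 Fl.
  have [d d0 hd] := cdf_modulus e0.
  pose c := Num.min (r + d / 2) x0.
  have rx0 : r < x0 by rewrite -lte_fin.
  have rc : r < c by rewrite lt_min rx0 andbT ltrDl divr_gt0.
  exists c; first by rewrite lte_fin rc below// ge_min lexx orbT.
  have := hd r c (ltW rc); rewrite (Fl r)// subr0; apply.
  by rewrite (le_lt_trans (_ : _ <= r + d / 2))// ?ge_min ?lexx//; lra.
have /cvgrPdist_lt/(_ e e0)[M [Mr hM]] := cdf_cvgNy.
pose c := Num.min (M - 1) x0.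
exists c; first by rewrite ltNyr below// ge_min lexx orbT.
have : `|0 - F c| < e by apply: hM; rewrite gt_min; apply/orP; left; lra.
by rewrite sub0r normrN ger0_norm// cdf_ge0'.
Qed.

Lemma cdf_large e : 0 < e -> exists2 c, (a < c%:E < b)%E & 1 - F c < e.
Proof.
move=> e0; have [x0 /andP[ax0 x0b]] := pd_interior.
have above c : x0 <= c -> (a < c%:E)%E by move=> cx; rewrite (lt_le_trans ax0)// lee_fin.
case: b x0b (@cdf_right) => [r| |] // x0b Fr.
  have [d d0 hd] := cdf_modulus e0.
  pose c := Num.max (r - d / 2) x0.
  have rx0 : x0 < r by rewrite -lte_fin.
  have rc : c < r by rewrite gt_max rx0 andbT; lra.
  exists c; first by rewrite lte_fin rc above// le_max lexx orbT.
  have := hd c r (ltW rc); rewrite Fr//; apply.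
  have : r - d / 2 <= c by rewrite le_max lexx.
  lra.
have /cvgrPdist_lt/(_ e e0)[M [Mr hM]] := cdf_cvgy.
pose c := Num.max (M + 1) x0.
exists c; first by rewrite ltry above// le_max lexx orbT.
have : `|1 - F c| < e by apply: hM; rewrite lt_max; apply/orP; left; lra.
by rewrite ger0_norm// subr_ge0 cdf_le1'.
Qed.

Lemma is_derive_cdf x : (a < x%:E < b)%E -> is_derive x (1 : R) F (f x).
Proof.
move=> xab; have [h1 _ _ _] := fD; have [_ fx] := h1 x xab.
have hb : ((-oo%O : itv_bound R) < BRight x)%E by exact: ltNyr.
have [dF Fx] := @continuous_FTC1 _ f -oo%O x (x + 1) (ltr_pwDr ltr01 (lexx x))
  (pd_integrableS (measurable_itv _)) hb fx.
by split; [exact: dF|rewrite -derive1E].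
Qed.

Lemma between_ab x y z : (a < x%:E < b)%E -> (a < y%:E < b)%E -> x <= z <= y ->
  (a < z%:E < b)%E.
Proof.
move=> /andP[ax _] /andP[_ yb] /andP[xz zy].
by rewrite (lt_le_trans ax) ?lee_fin// (le_lt_trans _ yb) ?lee_fin.
Qed.

Lemma cdf_strict x y : (a < x%:E < b)%E -> (a < y%:E < b)%E -> x < y -> F x < F y.
Proof.
move=> hx hy xy.
have [|c cxy e] := @mean_value _ F f x y (ltW xy).
  by move=> z zxy; apply: is_derive_cdf; exact: between_ab zxy.
have [h1 _ _ _] := fD; have [fc _] := h1 c (between_ab hx hy cxy).
by rewrite -subr_gt0 e mulr_gt0 ?subr_gt0.
Qed.

Lemma cdf_gt0 x : (a < x%:E < b)%E -> 0 < F x.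
Proof.
move=> hx; rewrite lt_neqAle cdf_ge0' andbT; apply/eqP => Fx.
have [h1 _ _ _] := fD; have [fx /cvgrPdist_lt/(_ (f x) fx) fc] := h1 x hx.
have : \forall y \near x^'-, (a < y%:E)%E.
  case: a hx => [r| |] //= /andP[rx _]; last by near=> y; rewrite ltNyr.
  by near=> y; rewrite lte_fin; near: y; exact: nbhs_left_gt.
move=> [d d0 hd]; pose y := x - d / 2.
have yx : y < x by rewrite /y ltrBlDr ltrDl divr_gt0.
have ay : (a < y%:E)%E.
  apply: hd => //=; rewrite /y opprB addrC subrK ger0_norm ?divr_ge0 ?ltW//.
  by rewrite ltr_pdivrMr// ltr_pMr// ltr1n.
have hy : (a < y%:E < b)%E.
  by rewrite ay/=; case/andP: hx => _; apply: lt_trans; rewrite lte_fin.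
by have := cdf_strict hy hx yx; rewrite -Fx ltNge cdf_ge0'.
Unshelve. all: by end_near. Qed.

Lemma cdf_lt1 x : (a < x%:E < b)%E -> F x < 1.
Proof.
move=> hx; rewrite lt_neqAle cdf_le1' andbT; apply/eqP => Fx.
have : \forall y \near x^'+, (y%:E < b)%E.
  case: b hx => [r| |] /andP[_ rx]; last by [].
  - by near=> y; rewrite lte_fin; near: y; exact: nbhs_right_lt.
  - by near=> y; rewrite ltry.
move=> [d d0 hd]; pose y := x + d / 2.
have yx : x < y by rewrite /y ltrDl divr_gt0.
have ay : (y%:E < b)%E.
  apply: hd => //=; rewrite /y opprD addrA subrr add0r normrN ger0_norm ?divr_ge0 ?ltW//.
  by rewrite ltr_pdivrMr// ltr_pMr// ltr1n.
have hy : (a < y%:E < b)%E.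
  by rewrite ay/= andbT; case/andP: hx => + _; move=> /lt_trans; apply; rewrite lte_fin.
by have := cdf_strict hx hy yx; rewrite Fx ltNge cdf_le1'.
Unshelve. all: by end_near. Qed.

Lemma rho_ge0 x : 0 <= rho f x.
Proof. by rewrite /rho mulr_ge0 ?pd_ge0// mulr_ge0// sqr_ge0. Qed.

Lemma rho_le x : rho f x <= 2 * f x.
Proof.
rewrite /rho ler_wpM2r ?pd_ge0// -[leRHS]mulr1 ler_wpM2l// sqr_sin_le1.
Qed.

Hypothesis mrho : measurable_fun setT (rho f).

Lemma rho_integrable D : measurable D -> lbg.-integrable D (EFin \o rho f).
Proof.
move=> mD; apply: (@le_integrable _ _ _ lbg D mD _ (EFin \o (fun x => 2 * f x))).
- by apply/measurable_EFinP; apply: measurable_funS mrho.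
- by move=> x _ /=; rewrite lee_fin ger0_norm ?rho_ge0// (le_trans (rho_le x))// ler_norm.
- have := @integrableZl _ _ _ lbg D mD 2 (EFin \o f) (pd_integrableS mD).
  by apply: eq_integrable => // x _.
Qed.

Let G := density_cdf (rho f).

Lemma rho_cdf_diff x y : x <= y -> 0 <= G y - G x <= 2 * (F y - F x).
Proof.
move=> xy; have -> : G y - G x = \int[lbg]_(t in `]x, y]) rho f t.
  rewrite /G /density_cdf Rintegral_itvB// ?bnd_simp//; exact: rho_integrable.
apply/andP; split; first by apply: Rintegral_ge0 => t _; exact: rho_ge0.
rewrite cdf_diff// -RintegralZl//; last exact: pd_integrableS.
apply: le_Rintegral => //; first exact: rho_integrable.
  have := @integrableZl _ _ _ lbg _ (measurable_itv `]x, y]) 2 (EFin \o f) (pd_integrableS (measurable_itv _)).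
  by apply: eq_integrable => // z _.
by move=> t _; exact: rho_le.
Qed.

Lemma rho_cdf_bound x : 0 <= G x <= 2 * F x.
Proof.
apply/andP; split; first by apply: Rintegral_ge0 => t _; exact: rho_ge0.
rewrite /F /density_cdf -RintegralZl//; last exact: pd_integrableS.
apply: le_Rintegral => //; first exact: rho_integrable.
  have := @integrableZl _ _ _ lbg _ (measurable_itv `]-oo, x]) 2 (EFin \o f) (pd_integrableS (measurable_itv _)).
  by apply: eq_integrable => // z _.
by move=> t _; exact: rho_le.
Qed.

Lemma continuous_rho x : (a < x%:E < b)%E -> {for x, continuous (rho f)}.
Proof.
move=> xab; have [h1 _ _ _] := fD; have [_ fx] := h1 x xab.
have hs : {for x, continuous (fun t => sin (pi * F t) : R)}.
  apply: continuous_comp; last exact: continuous_sin.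
  apply: cvgM; first exact: cvg_cst.
  exact: is_derive_continuous (is_derive_cdf xab).
apply: cvgM => //; apply: cvgM; [exact: cvg_cst|exact: (cvgM hs hs)].
Qed.

Lemma rho_cdf_interior x y : (a < x%:E < b)%E -> (a < y%:E < b)%E -> x < y ->
  G y - G x = Aform (F y) - Aform (F x).
Proof.
move=> hx hy xy; have -> : G y - G x = \int[lbg]_(t in `]x, y]) rho f t.
  rewrite /G /density_cdf Rintegral_itvB// ?bnd_simp ?(ltW xy)//; exact: rho_integrable.
rewrite Rintegral_itv_obnd_cbnd; last exact: rho_integrable.
have dAF z : (a < z%:E < b)%E -> is_derive z (1 : R) (Aform \o F) (rho f z).
  move=> hz; have := @is_derive1_comp _ Aform F z _ _ (Aform_derive (F z)) (is_derive_cdf hz).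
  by move=> h; apply: is_derive_eq.
have cAF z : (a < z%:E < b)%E -> {for z, continuous (Aform \o F)}.
  by move=> hz; exact: is_derive_continuous (dAF z hz).
rewrite /Rintegral (@continuous_FTC2 _ _ (Aform \o F))//.
- apply: continuous_in_subspaceT => z; rewrite inE/= in_itv/= => zxy.
  by apply: continuous_rho; exact: between_ab zxy.
- split.
  + move=> z /[!in_itv]/= /andP[xz zy].
    have hz : (a < z%:E < b)%E by apply: (between_ab hx hy); rewrite !ltW.
    by have [] := dAF z hz.
  + by apply: cvg_at_right_filter; exact: cAF.
  + by apply: cvg_at_left_filter; exact: cAF.
- move=> z /[!in_itv]/= /andP[xz zy].
  have hz : (a < z%:E < b)%E by apply: (between_ab hx hy); rewrite !ltW.
  by rewrite derive1E; have := dAF z hz => -[].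
Qed.

Lemma Aform_lipschitz x y : x <= y -> 0 <= Aform y - Aform x <= 2 * (y - x).
Proof.
move=> xy; have [c _ ->] := mean_value xy (fun z _ => Aform_derive z).
rewrite mulr_ge0 ?subr_ge0//=; last by rewrite mulr_ge0// sqr_ge0.
rewrite ler_wpM2r ?subr_ge0// -[leRHS]mulr1 ler_wpM2l// sqr_sin_le1.
Qed.

Lemma Aform0 : Aform 0 = 0 :> R.
Proof. by rewrite /Aform mulr0 sin0 mul0r subr0. Qed.

(** The defect of the claimed formula is constant on ]a, b[ and at most
    4 times the variation of F, which tends to 0 towards both ends. *)
Lemma cdf_rho x : density_cdf (rho f) x = Aform (density_cdf f x).
Proof.
rewrite -/F -/G; pose D y := G y - Aform (F y).
suff : D x = 0 by move/eqP; rewrite subr_eq0 => /eqP.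
have Dvar y z : y <= z -> `|D z - D y| <= 4 * (F z - F y).
  move=> yz; have /andP[g1 g2] := rho_cdf_diff yz.
  have /andP[a1 a2] := Aform_lipschitz (cdf_nd yz).
  by rewrite /D ler_norml; apply/andP; split; lra.
have D0 y : `|D y| <= 4 * F y.
  have /andP[g1 g2] := rho_cdf_bound y.
  have /andP[a1 a2] := Aform_lipschitz (cdf_ge0' y); rewrite Aform0 !subr0 in a1 a2.
  by rewrite /D ler_norml; apply/andP; split; lra.
have Dab y : (a < y%:E < b)%E -> D y = 0.
  move=> hy; apply/eqP; rewrite -normr_le0; apply/ler_addgt0Pl => e e0.
  rewrite addr0.
  have [|c hc Fc] := @cdf_small (Num.min (e / 4) (F y)).
    by rewrite lt_min divr_gt0//= cdf_gt0.
  move: Fc; rewrite lt_min => /andP[Fc1 Fc2].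
  have cy : c < y by rewrite ltNge; apply/negP => /cdf_nd; rewrite leNgt Fc2.
  have -> : D y = D c.
    by have := rho_cdf_interior hc hy cy; rewrite /D; lra.
  by apply: (le_trans (D0 c)); lra.
have [/Dab//|] := boolP (a < x%:E < b)%E.
rewrite negb_and -!leNgt => /orP[xa|bx].
  by apply/eqP; rewrite -normr_le0 (le_trans (D0 x))// cdf_left// mulr0.
apply/eqP; rewrite -normr_le0; apply/ler_addgt0Pl => e e0; rewrite addr0.
have [c hc Fc] := @cdf_large (e / 4) (divr_gt0 e0 (ltr0n _ 4)).
have cx : c <= x.
  by rewrite -lee_fin (le_trans _ bx)// ltW//; case/andP: hc.
have := Dvar c x cx; rewrite (Dab c hc) subr0 => /le_trans; apply.
by rewrite (cdf_right bx); lra.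
Qed.

Lemma rho_positive_density : (\int[lbg]_x (rho f x)%:E = 1)%E ->
  positive_density a b (rho f).
Proof.
move=> h; split => // x hx.
  split; last exact: continuous_rho.
  have [h1 _ _ _] := fD; have [fx _] := h1 x hx.
  rewrite /rho mulr_gt0// mulr_gt0// exprn_gt0// sin_gt0_pi//.
  by rewrite mulr_gt0 ?pi_gt0 ?cdf_gt0//= -[ltRHS]mulr1 ltr_pM2l ?pi_gt0// cdf_lt1.
by have [_ h2 _ _] := fD; rewrite /rho h2// mulr0.
Qed.

End OneStep.

Section AllSteps.
Variables (a b : \bar R) (f : R -> R).
Hypothesis fD : positive_density a b f.
Hypothesis fm : forall n, measurable_fun setT (iter n rho f).
Hypothesis f1 : forall n, (\int[lbg]_x (iter n rho f x)%:E = 1)%E.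

(** All iterates live on the interval of f, so the one-step formula can be iterated. *)
Lemma iter_rho_positive_density n : positive_density a b (iter n rho f).
Proof.
elim: n => [//|n IH]; rewrite iterS; apply: rho_positive_density => //.
  by rewrite -iterS.
by rewrite -iterS.
Qed.

Lemma cdf_iter_rho n x :
  density_cdf (iter n rho f) x = 2^-1 + iter n Bmap (density_cdf f x - 2^-1).
Proof.
elim: n => [|n IH]; first by rewrite addrC subrK.
rewrite !iterS (cdf_rho (iter_rho_positive_density n)) -?iterS// IH.
by rewrite Aform_Bmap.
Qed.

(** Each step multiplies the density by 2 sin (pi F) ^ 2 = 2 cos (pi (F - 1/2)) ^ 2. *)
Lemma iter_rhoE n x :
  iter n rho f x = 2 ^+ n * cos_product n (density_cdf f x - 2^-1) * f x.
Proof.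
elim: n => [|n IH]; first by rewrite expr0 /cos_product big_ord0 !mul1r.
rewrite iterS {1}/rho IH cdf_iter_rho /cos_product big_ord_recr /= [2 ^+ n.+1]exprS.
rewrite [pi * (_ + _)]mulrDr sinD cos_pihalf sin_pihalf mul0r addr0 mul1r; ring.
Qed.

End AllSteps.

End Iterates.

(** * Decay of the limit density *)
Section Decay.
Context {R : realType}.
Notation lbg := (@lebesgue_measure R).
Implicit Types (x y u v c : R) (p k n : nat).

(** Weaker than the compressed-exponential bound, and all that the moments require. *)
Lemma gtail_decay p : exists2 C : R, 0 <= C & forall u, 0 <= u -> u ^+ p * gtail u <= C.
Proof.
have [a1 [c1 [c2 [c1_0 _ [M [Mr hM]]]]]] := @koenigs_law_compressed R.
pose U := `|M| + 1.
have U1 : 1 <= U by rewrite lerDr.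
exists (U ^+ p + p`!%:R / c1 ^+ p) => [|u u0].
  by rewrite addr_ge0 ?divr_ge0 ?exprn_ge0 ?(ltW c1_0)// (le_trans _ U1).
have [uU|Uu] := leP u U.
  apply: (@le_trans _ _ (U ^+ p * 1)).
    apply: ler_pM; [exact: exprn_ge0|by rewrite ltW ?gtail_gt0| |by rewrite ltW ?gtail_lt1].
    by apply: lerXn2r; rewrite ?nnegrE// (le_trans u0).
  by rewrite mulr1 lerDl divr_ge0// exprn_ge0// ltW.
have u1 : 1 <= u by rewrite (le_trans U1)// ltW.
have u_gt0 : 0 < u by rewrite (lt_le_trans _ u1).
have /andP[_] : expR (- (c2 * u `^ log2 3)) <= law_tail (@koenigs_law R) u <= expR (- (c1 * u `^ log2 3)).
  by apply: hM; rewrite (le_lt_trans _ Uu)// (le_trans (ler_norm M))// lerDl.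
rewrite koenigs_law_tail// => h.
have g1 : gtail u <= expR (- (c1 * u)).
  apply: (@le_trans _ _ (2 * gtail u)); first by rewrite ler_peMl ?ler1n// ltW// gtail_gt0.
  apply: (le_trans h); rewrite ler_expR lerN2 ler_pM2l// le1r_powR// ltW//.
apply: (@le_trans _ _ (u ^+ p * expR (- (c1 * u)))); first by rewrite ler_wpM2l ?exprn_ge0.
apply: (@le_trans _ _ (p`!%:R / c1 ^+ p)); last by rewrite lerDr exprn_ge0// (le_trans _ U1).
rewrite expRN ler_pdivrMr ?expR_gt0// mulrAC ler_pdivlMr ?exprn_gt0//.
rewrite -exprMn [u * c1]mulrC.
have cu : 0 <= c1 * u by rewrite mulr_ge0 ?(ltW c1_0).
case: p => [|p]; first by rewrite expr0 mul1r (le_trans _ (expR_ge1Dx _))// lerDl.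
rewrite -ler_pdivrMl ?ltr0n ?fact_gt0// [leLHS]mulrC.
by apply: le_trans (expR_ge1Dxn p cu); rewrite lerDr.
Qed.

Lemma cos_phi_gtail u : cos (pi * phi u) = sin (pi * gtail u).
Proof. by rewrite /gtail mulrBr sinB cos_pihalf sin_pihalf mul0r subr0 mul1r. Qed.

Lemma sqr_sin_pi_le u : 0 <= u -> sin (pi * u) ^+ 2 <= (pi * u) ^+ 2.
Proof.
move=> u0; have pu : 0 <= pi * u by rewrite mulr_ge0 ?pi_ge0.
have h : `|sin (pi * u)| <= pi * u.
  rewrite ler_norml (sin_le_id pu) andbT.
  have [l|l] := leP (pi * u) pi; first by rewrite (@le_trans _ _ 0) ?oppr_le0// sin_ge0_pi// pu.
  by rewrite (@le_trans _ _ (- 1)) ?sin_geN1// lerN2 (le_trans _ (ltW l))// (le_trans _ (pi_ge2 _))// ler1n.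
by rewrite -(real_normK (num_real (sin _))) lerXn2r ?nnegrE.
Qed.

(** The factor cos (pi phi u) ^ 2 = sin (pi g u) ^ 2 in the doubling formula decays like g u ^ 2
    and absorbs the power. *)
Lemma kappa_decay p c : 0 < c ->
  exists2 C : R, 0 <= C & forall y, `|y| ^+ p * kappa (c * y) <= C * kappa (c / 2 * y).
Proof.
move=> c0; have [C C0 hC] := gtail_decay p.
exists ((2 / c) ^+ p * (pi ^+ 2 * C)).
  by rewrite mulr_ge0 ?exprn_ge0 ?divr_ge0 ?(ltW c0)// mulr_ge0 ?sqr_ge0.
move=> y; pose u := c / 2 * `|y|.
have u0 : 0 <= u by rewrite mulr_ge0// divr_ge0// ltW.
have -> : kappa (c * y) = kappa (2 * u).
  rewrite -kappa_norm normrM gtr0_norm// /u; congr kappa; by field.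
have -> : kappa (c / 2 * y) = kappa u.
  by rewrite -kappa_norm normrM gtr0_norm ?divr_gt0.
have -> : `|y| = 2 / c * u by rewrite /u; field; rewrite gt_eqF.
rewrite kappa_double exprMn cos_phi_gtail.
have [s sE] : exists s, s = sin (pi * gtail u) ^+ 2 by exists (sin (pi * gtail u) ^+ 2).
rewrite -sE -!mulrA ler_wpM2l ?exprn_ge0 ?divr_ge0 ?(ltW c0)//.
rewrite !mulrA ler_wpM2r ?kappa_ge0// sE -expr2.
apply: (@le_trans _ _ (u ^+ p * (pi * gtail u) ^+ 2)).
  by rewrite ler_wpM2l ?exprn_ge0// sqr_sin_pi_le// ltW// gtail_gt0.
have -> : u ^+ p * (pi * gtail u) ^+ 2 = pi ^+ 2 * (u ^+ p * gtail u ^+ 2).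
  by ring.
apply: ler_wpM2l; first exact: sqr_ge0.
apply: le_trans (hC u u0); rewrite ler_wpM2l ?exprn_ge0// expr2 ler_piMl ?ltW ?gtail_gt0//.
exact: gtail_lt1.
Qed.

Lemma continuous_kappaM c : continuous (fun y => kappa (c * y) : R).
Proof.
move=> y; apply: continuous_comp; last exact: continuous_kappa.
by apply: cvgM; [exact: cvg_cst|exact: cvg_id].
Qed.

Lemma is_derive_phiM c y : is_derive y (1 : R) (fun y => c^-1 * phi (c * y)) (c^-1 * (kappa (c * y) * c)).
Proof.
apply: is_deriveZ; apply: (@is_derive1_comp _ phi (fun y => c * y)); first exact: is_derive_phi.
by apply: is_derive_eq; rewrite /GRing.scale/= mulr1.
Qed.

Lemma integral_kappaM_tail c u : 0 < c ->
  (\int[lbg]_(y in `[u, +oo[) (kappa (c * y))%:E = (c^-1 * gtail (c * u))%:E)%E.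
Proof.
move=> c0; have cn : c != 0 by rewrite gt_eqF.
have h y : is_derive y (1 : R) (fun y => c^-1 * phi (c * y)) (kappa (c * y)).
  have := is_derive_phiM c y; rewrite mulrCA mulVf// mulr1//.
rewrite (@ge0_continuous_FTC2y _ (fun y => kappa (c * y)) (fun y => c^-1 * phi (c * y)) u (c^-1 * 2^-1)).
- by rewrite -EFinB /gtail mulrBr.
- by move=> y _; exact: kappa_ge0.
- exact/continuous_subspaceT/continuous_kappaM.
- apply: cvgM; first exact: cvg_cst.
  apply: (cvg_comp (fun y => c * y) phi); last exact: phi_cvg_half.
  apply/cvgryPge => M; exists (c^-1 * M); split; first exact: num_real.
  by move=> y /ltW yM /=; rewrite -ler_pdivrMl.
- by move=> y _; have [] := h y.
- by apply: cvg_at_right_filter; exact: is_derive_continuous (h u).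
- by move=> y _; rewrite derive1E; have [] := h y.
Unshelve. all: by end_near. Qed.

Lemma measurable_kappaM c : measurable_fun setT (fun y => kappa (c * y) : R).
Proof. apply: continuous_measurable_fun; exact: continuous_kappaM. Qed.

Lemma integrable_kappaM c : 0 < c -> lbg.-integrable setT (fun y => (kappa (c * y))%:E).
Proof.
move=> c0; apply/integrableP; split; first by apply/measurable_EFinP; exact: measurable_kappaM.
under eq_integral => y _ do rewrite /= ger0_norm ?kappa_ge0//.
rewrite ge0_symfun_integralT; last 3 first.
- by move=> y; exact: kappa_ge0.
- exact: continuous_kappaM.
- by move=> y /=; rewrite mulrN kappaN.
by rewrite -set_itvcy integral_kappaM_tail// -EFinM ltry.
Qed.

Lemma integrable_pow_kappaM p c : 0 < c ->
  lbg.-integrable setT (fun y => (`|y| ^+ p * kappa (c * y))%:E).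
Proof.
move=> c0; have [C C0 hC] := kappa_decay p c0.
have c20 : 0 < c / 2 by rewrite divr_gt0.
apply: (@le_integrable _ _ _ lbg setT measurableT _ (fun y => (C%:E * (kappa (c / 2 * y))%:E)%E)).
- apply/measurable_EFinP; apply: measurable_funM; last exact: measurable_kappaM.
  apply: measurable_funX; exact: (@measurableT_comp _ _ _ _ _ _ _ _ _ (@normr_measurable R setT)).
- move=> y _ /=; rewrite lee_fin.
  rewrite ger0_norm ?mulr_ge0 ?exprn_ge0 ?kappa_ge0//.
  by rewrite (le_trans (hC y))// ler_norm.
- by apply: integrableZl => //; exact: integrable_kappaM.
Qed.

Lemma integrable_moment p : lbg.-integrable setT (fun y => (y ^+ p * kappa y)%:E).
Proof.
have := @integrable_pow_kappaM p 1 ltr01; apply: le_integrable => //.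
- apply/measurable_EFinP; apply: measurable_funM; last exact: measurable_kappa.
  exact: measurable_funX.
- move=> y _ /=; rewrite lee_fin mul1r !normrM normrX.
  by rewrite normrX normr_id.
Qed.

Lemma cos_lipschitz x y : `|cos x - cos y| <= `|x - y|.
Proof.
wlog xy : x y / y <= x.
  by move=> h; have [|/ltW] := leP y x; [exact: h|rewrite distrC (distrC x); exact: h].
have [c _ ->] := @mean_value R cos (fun z => - sin z) y x xy (fun z _ => is_derive_cos z).
by rewrite normrM normrN ler_piMl// sin_max.
Qed.

Lemma cos_sqr_lipschitz x y : `|cos x ^+ 2 - cos y ^+ 2| <= `|x - y|.
Proof.
have e z : cos z ^+ 2 = (1 + cos (z *+ 2)) / 2 by rewrite cos_mulr2n mulr2n; field.
rewrite !e -mulrBl opprD addrACA subrr add0r normrM (@ger0_norm _ 2^-1)//.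
rewrite ler_pdivrMr//; apply: (le_trans (cos_lipschitz _ _)).
by rewrite -mulrnBl normrMn mulr_natr.
Qed.

Lemma cos_product_lipschitz n x y :
  `|cos_product n x - cos_product n y| <= pi * 2 ^+ n * `|x - y|.
Proof.
elim: n => [|n IH]; first by rewrite /cos_product !big_ord0 subrr normr0 !mulr_ge0 ?pi_ge0.
rewrite /cos_product !big_ord_recr /= -!/(cos_product _ _).
set a := cos_product n x; set a' := cos_product n y.
have [b bE] : exists b, b = cos (pi * iter n Bmap x) ^+ 2 by eexists.
have [b' bE'] : exists b', b' = cos (pi * iter n Bmap y) ^+ 2 by eexists.
rewrite -bE -bE'; have -> : a * b - a' * b' = (a - a') * b + a' * (b - b') by ring.
rewrite (le_trans (ler_normD _ _))// !normrM.
have hb : `|b| <= 1 by rewrite bE ger0_norm ?sqr_ge0// cos_sqr_le1.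
have ha : `|a'| <= 1 by rewrite ger0_norm ?cos_product_ge0// cos_product_le1.
have bb : `|b - b'| <= pi * 2 ^+ n * `|x - y|.
  rewrite bE bE'; apply: (le_trans (cos_sqr_lipschitz _ _)); rewrite -mulrBr normrM ger0_norm ?pi_ge0//.
  by rewrite -mulrA ler_wpM2l ?pi_ge0// iter_Bmap_lipschitz.
apply: (@le_trans _ _ (`|a - a'| + `|b - b'|)).
  by apply: lerD; [apply: ler_piMr|apply: ler_piMl].
rewrite exprS; have := lerD IH bb; rewrite -/a -/a'; lra.
Qed.

(** Products started at two points whose rescaled distance tends to 0 have the same limit; started
    at phi (y / 2 ^ n) the product equals kappa y / kappa (y / 2 ^ n). *)
Lemma cos_product_cvg (z : nat -> R) y : (fun n => 2 ^+ n * z n) @ \oo --> y ->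
  (fun n => cos_product n (z n)) @ \oo --> kappa y.
Proof.
move=> zy.
have l1 : (fun n => cos_product n (phi (y / 2 ^+ n))) @ \oo --> kappa y.
  have -> : (fun n => cos_product n (phi (y / 2 ^+ n))) = fun n => kappa y / kappa (y / 2 ^+ n).
    apply/funext => n; have := kappa_iter n (y / 2 ^+ n); rewrite mul_halves => ->.
    by rewrite mulfK// gt_eqF// kappa_gt0.
  rewrite -[X in _ --> X]divr1; apply: cvgM; first exact: cvg_cst.
  by apply: cvgV; [exact: oner_neq0|exact: kappa_halves_cvg].
have d0 : (fun n => cos_product n (z n) - cos_product n (phi (y / 2 ^+ n))) @ \oo --> (0 : R).
  apply: norm_cvg0; apply: (@squeeze_cvgr _ _ _ _ (cst 0)
    (fun n => pi * `|2 ^+ n * z n - 2 ^+ n * phi (y / 2 ^+ n)|)).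
  - near=> n; rewrite normr_ge0/= (le_trans (cos_product_lipschitz _ _ _))//.
    by rewrite -mulrBr normrM (@ger0_norm _ (2 ^+ n)) ?exprn_ge0// mulrA.
  - exact: cvg_cst.
  - rewrite -[X in _ --> X](mulr0 pi); apply: cvgM; first exact: cvg_cst.
    rewrite -(@normr0 _ R) -(subrr y); apply: cvg_norm.
    by apply: cvgB => //; exact: scaled_phi_cvg.
have -> : (fun n => cos_product n (z n)) = fun n => (cos_product n (z n) -
   cos_product n (phi (y / 2 ^+ n))) + cos_product n (phi (y / 2 ^+ n)).
  by apply/funext => n; rewrite subrK.
by rewrite -[X in _ --> X]add0r; apply: cvgD.
Unshelve. all: by end_near. Qed.

Lemma cos_product_norm n x : cos_product n `|x| = cos_product n x.
Proof.
rewrite /cos_product; apply: eq_bigr => j _.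
by have [_|_] := ger0P x; rewrite ?iter_BmapN ?mulrN ?cosN.
Qed.

(** For n steps started at a point at least phi (v / 2 ^ n) away from the
    median, the product of the squared cosines is at most that of the limit law. *)
Lemma cos_product_dominated n v x (w : R) : 0 <= v -> v / 2 ^+ n <= w ->
  v / 2 ^+ n <= `|x| -> `|x| <= 2^-1 -> cos_product n x <= kappa v / kappa w.
Proof.
move=> v0 vw vx x1; rewrite -cos_product_norm.
have vn0 : 0 <= v / 2 ^+ n by rewrite divr_ge0// exprn_ge0.
apply: (@le_trans _ _ (cos_product n (phi (v / 2 ^+ n)))).
  by apply: cos_product_le => //; rewrite ?phi_ge0// (le_trans (phi_le vn0)).
rewrite -[v in X in _ <= X](mul_halves n) kappa_iter.
rewrite ler_pdivlMr ?kappa_gt0// ler_wpM2l ?cos_product_ge0// kappa_nonincreasing//.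
Qed.

Lemma prod_cvg0 (r : nat -> R) : (forall n, 0 <= r n) -> r @ \oo --> (0 : R) ->
  (fun n => \prod_(j < n) r j) @ \oo --> (0 : R).
Proof.
move=> r0 rc; have /cvgrPdist_le/(_ 2^-1) := rc; rewrite invr_gt0 ltr0n => /(_ isT)[N _ hN].
have le d : \prod_(j < N + d) r j <= (\prod_(j < N) r j) * 2^-1 ^+ d.
  elim: d => [|d IH]; first by rewrite addn0 expr0 mulr1.
  rewrite addnS big_ord_recr /= exprSr mulrA ler_pM ?prodr_ge0//.
  have := hN (N + d)%N (leq_addr _ _); rewrite /= sub0r normrN.
  by rewrite ger0_norm.
rewrite -(cvg_shiftn N); set l := \prod_(j < N) r j in le.
apply: (@squeeze_cvgr _ _ _ _ (cst 0) (fun n => l * 2^-1 ^+ n)).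
- by near=> n; rewrite prodr_ge0//= addnC le.
- exact: cvg_cst.
- rewrite -[X in _ --> X](mulr0 l); apply: cvgM; first exact: cvg_cst.
  by apply: cvg_expr; rewrite ger0_norm// invf_lt1// ltr1n.
Unshelve. all: by end_near. Qed.

End Decay.

(** * Convergence of moments *)
Section Moments.
Context {R : realType}.
Notation lbg := (@lebesgue_measure R).
Variables (a b : \bar R) (f : R -> R) (m : R).
Hypothesis fD : positive_density a b f.
Hypothesis fm : forall n, measurable_fun setT (iter n rho f).
Hypothesis f1 : forall n, (\int[lbg]_x (iter n rho f x)%:E = 1)%E.
Hypothesis Fm : density_cdf f m = 2^-1.
Local Notation F := (density_cdf f).
Implicit Types (x y z u v d e : R) (n k p : nat).

Lemma median_interior : (a < m%:E < b)%E.
Proof.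
apply/andP; split; rewrite ltNge; apply/negP.
  by move=> /(cdf_left fD); rewrite Fm => /eqP; rewrite invr_eq0 pnatr_eq0.
move=> /(cdf_right fD); rewrite Fm => /eqP.
by move/eqP; lra.
Qed.

Lemma median_density_gt0 : 0 < f m.
Proof. by have [h1 _ _ _] := fD; have [] := h1 m median_interior. Qed.

(** On this neighbourhood F - 1/2 is comparable to x - m. *)
Lemma median_neighbourhood : exists2 d, 0 < d &
  forall x, `|x - m| <= d -> (a < x%:E < b)%E /\ f m / 2 <= f x <= 2 * f m.
Proof.
have [h1 _ _ _] := fD; have [fm0 fmc] := h1 m median_interior.
have /andP[am mb] := median_interior.
have Na : \forall x \near m, (a < x%:E)%E.
  case: a am => [r|//|_]; last by near=> x; exact: ltNyr.
  by rewrite lte_fin => rm; near=> x; rewrite lte_fin; near: x; exact: lt_nbhsr.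
have Nb : \forall x \near m, (x%:E < b)%E.
  case: b mb => [r|_|//]; last by near=> x; exact: ltry.
  by rewrite lte_fin => rm; near=> x; rewrite lte_fin; near: x; exact: lt_nbhsl.
have N : \forall x \near m, (a < x%:E < b)%E.
  by near=> x; apply/andP; split; near: x.
have fm2 : 0 < f m / 2 by rewrite divr_gt0.
have /cvgrPdist_le/(_ _ fm2) C := fmc.
have [d /= d0 hd] := filterI N C.
exists (d / 2); first by rewrite divr_gt0.
move=> x xd; have [/=|hx hf] := hd x.
  by rewrite distrC (le_lt_trans xd)// ltr_pdivrMr// ltr_pMr// ltr1n.
split=> //; move: hf; rewrite ler_norml => /andP[l1 l2]; apply/andP; split; lra.
Unshelve. all: by end_near. Qed.

Let s n := 2 ^+ n * f m.

Let s_gt0 n : 0 < s n.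
Proof. by rewrite mulr_gt0 ?exprn_gt0 ?median_density_gt0. Qed.

(** F has derivative f m at m. *)
Lemma cdf_rescaled_cvg y :
  (fun n => 2 ^+ n * (F (m + y / s n) - 2^-1)) @ \oo --> y.
Proof.
have fm0 := median_density_gt0.
have -> : y = f m * (y / f m) by field; rewrite gt_eqF.
rewrite -Fm; apply: (derive_seq (is_derive_cdf fD median_interior)).
  have -> : (fun n => f m * (y / f m) / s n) = fun n => y / f m / 2 ^+ n.
    by apply/funext => n; rewrite /s; field; rewrite !gt_eqF ?exprn_gt0.
  exact: cvg_halves.
have -> : (fun n => 2 ^+ n * (f m * (y / f m) / s n)) = cst (y / f m).
  by apply/funext => n /=; rewrite /s; field; rewrite !gt_eqF ?exprn_gt0.
exact: cvg_cst.
Qed.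

(** The limit law: the orbit of B starts at a point equivalent to y / 2 ^ n. *)
Lemma cdf_iter_rescaled_cvg y :
  (fun n => density_cdf (iter n rho f) (m + y / s n)) @ \oo --> 2^-1 + phi y.
Proof.
under eq_cvg do rewrite (cdf_iter_rho fD fm f1).
apply: cvgD; first exact: cvg_cst.
exact/iter_Bmap_cvg/cdf_rescaled_cvg.
Qed.

Section Near.
Variable d : R.
Hypothesis d0 : 0 < d.
Hypothesis hd : forall x, `|x - m| <= d -> (a < x%:E < b)%E /\ f m / 2 <= f x <= 2 * f m.

Lemma cdf_near x : `|x - m| <= d -> f m / 2 * `|x - m| <= `|F x - 2^-1|.
Proof.
move=> xd; rewrite (_ : F x - 2^-1 = F x - F m); last by rewrite Fm.
wlog : x xd / m <= x => [h|mx].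
  have [/h->//|/ltW xm] := leP m x.
  have [|c cx e] := @mean_value _ F f x m xm.
    move=> z /andP[xz zm]; apply: (is_derive_cdf fD).
    apply: (hd _).1; rewrite distrC ger0_norm ?subr_ge0// (le_trans _ xd)//.
    by rewrite distrC ger0_norm ?subr_ge0// lerD2l lerN2.
  have [_ /andP[c1 _]] : (a < c%:E < b)%E /\ f m / 2 <= f c <= 2 * f m.
    case/andP: cx => xc cm; apply: hd.
    rewrite distrC ger0_norm ?subr_ge0// (le_trans _ xd)//.
    by rewrite distrC ger0_norm ?subr_ge0// lerD2l lerN2.
  rewrite distrC [leRHS]distrC e ger0_norm ?subr_ge0// ger0_norm.
    by rewrite ler_wpM2r ?subr_ge0.
  by rewrite mulr_ge0 ?subr_ge0// (pd_ge0 fD).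
have [|c cx ->] := @mean_value _ F f m x mx.
  move=> z /andP[mz zx]; apply: (is_derive_cdf fD); apply: (hd _).1.
  rewrite ger0_norm ?subr_ge0// (le_trans _ xd)//.
  by rewrite ger0_norm ?subr_ge0// lerD2r.
have [_ /andP[c1 _]] : (a < c%:E < b)%E /\ f m / 2 <= f c <= 2 * f m.
  case/andP: cx => mc cx; apply: hd.
  rewrite ger0_norm ?subr_ge0// (le_trans _ xd)//.
  by rewrite ger0_norm ?subr_ge0// lerD2r.
rewrite ger0_norm ?subr_ge0// ger0_norm.
  by rewrite ler_wpM2r ?subr_ge0.
by rewrite mulr_ge0 ?subr_ge0// (pd_ge0 fD).
Qed.

Lemma cdf_far x : d <= `|x - m| -> f m / 2 * d <= `|F x - 2^-1|.
Proof.
have e1 : `|(m + d) - m| = d by rewrite addrAC subrr add0r gtr0_norm.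
have e2 : `|(m - d) - m| = d by rewrite addrAC subrr add0r normrN gtr0_norm.
have [mx|xm] := leP m x.
  rewrite ger0_norm ?subr_ge0// => h.
  have /(cdf_nd fD) Fx : m + d <= x by lra.
  have := @cdf_near (m + d); rewrite e1 => /(_ (lexx _)) /le_trans; apply.
  have /(cdf_nd fD) F1 : m <= m + d by rewrite lerDl ltW.
  rewrite -Fm !ger0_norm ?subr_ge0 ?(le_trans F1)//; lra.
rewrite distrC ger0_norm ?subr_ge0 ?(ltW xm)// => h.
have /(cdf_nd fD) Fx : x <= m - d by lra.
have := @cdf_near (m - d); rewrite e2 => /(_ (lexx _)) /le_trans; apply.
have /(cdf_nd fD) F1 : m - d <= m by rewrite gerBl ltW.
rewrite -Fm distrC [leRHS]distrC !ger0_norm ?subr_ge0 ?(le_trans Fx)//; lra.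
Qed.

Lemma cdf_dist_half x : `|F x - 2^-1| <= 2^-1.
Proof.
have := cdf_ge0' fD x; have := cdf_le1' fD x; rewrite ler_norml => h1 h2.
by apply/andP; split; lra.
Qed.

Let G k n y := y ^+ k * (cos_product n (F (m + y / s n) - 2^-1) * (f (m + y / s n) / f m)).

Let rescale_near n y : `|y| <= s n * d -> `|m + y / s n - m| <= d.
Proof.
move=> yd; rewrite addrAC subrr add0r normrM (@gtr0_norm _ (s n)^-1) ?invr_gt0//.
by rewrite ler_pdivrMr// mulrC.
Qed.

(** The dominating function is kappa (y / 2): F - 1/2 is at least f m / 2 * |x - m|, half of its
    first-order value. *)
Lemma near_dominated k n y : `|y| <= s n * d ->
  `|G k n y| <= 2 / kappa (f m / 2 * d) * (`|y| ^+ k * kappa (2^-1 * y)).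
Proof.
move=> yd; have fm0 := median_density_gt0.
have /hd[_ /andP[_ fx]] := rescale_near yd.
have h := @cos_product_dominated R n (`|y| / 2) (F (m + y / s n) - 2^-1) (f m / 2 * d).
rewrite /G normrM normrX [leRHS]mulrCA; apply: ler_wpM2l; first exact: exprn_ge0.
have dv : `|y| / 2 / 2 ^+ n = f m / 2 * (`|y| / s n).
  by rewrite /s; field; rewrite !gt_eqF ?exprn_gt0.
have c1 : cos_product n (F (m + y / s n) - 2^-1) <= kappa (`|y| / 2) / kappa (f m / 2 * d).
  apply: h; rewrite ?cdf_dist_half ?divr_ge0//.
    rewrite dv ler_wpM2l ?divr_ge0 ?(ltW fm0)//.
    by rewrite ler_pdivrMr// mulrC.
  rewrite dv; apply: le_trans (cdf_near (rescale_near yd)).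
  by rewrite addrAC subrr add0r normrM (@gtr0_norm _ (s n)^-1) ?invr_gt0.
rewrite ger0_norm ?mulr_ge0 ?cos_product_ge0 ?invr_ge0 ?(pd_ge0 fD) ?(ltW fm0)//.
have -> : 2 / kappa (f m / 2 * d) * kappa (2^-1 * y) = kappa (`|y| / 2) / kappa (f m / 2 * d) * 2.
  rewrite [2 / _]mulrC -mulrA mulrCA -[RHS]mulrA [RHS]mulrC [kappa (_ * y)](_ : _ = kappa (`|y| / 2)); last first.
    by rewrite -kappa_norm normrM (@gtr0_norm _ 2^-1) ?invr_gt0// mulrC.
  ring.
apply: ler_pM; rewrite ?cos_product_ge0 ?divr_ge0 ?(pd_ge0 fD) ?(ltW fm0)//.
by rewrite ler_pdivrMr.
Qed.

Lemma near_pointwise k y : (fun n => G k n y) @ \oo --> y ^+ k * kappa y.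
Proof.
have fm0 := median_density_gt0.
rewrite -[kappa y]mulr1; apply: cvgM; first exact: cvg_cst.
apply: cvgM; first exact/cos_product_cvg/cdf_rescaled_cvg.
rewrite -(divff (lt0r_neq0 fm0)); apply: cvgM; last exact: cvg_cst.
have [h1 _ _ _] := fD; have [_ fc] := h1 m median_interior.
suff h : (fun n => m + y / s n) @ \oo --> m.
  exact: (cvg_comp (fun n => m + y / s n) f h fc).
rewrite -[X in _ --> X]addr0; apply: cvgD; first exact: cvg_cst.
have -> : (fun n => y / s n) = fun n => y / f m / 2 ^+ n.
  by apply/funext => n; rewrite /s; field; rewrite !gt_eqF ?exprn_gt0.
exact: cvg_halves.
Qed.

Lemma continuous_iter_rho_near n x : `|x - m| <= d -> {for x, continuous (iter n rho f)}.
Proof.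
move=> /hd[xab _]; have [h1 _ _ _] := iter_rho_positive_density fD fm f1 n.
by have [] := h1 x xab.
Qed.

(** The substitution x = m + y / s n with s n = 2 ^ n * f m. *)
Lemma near_substitution k n :
  (\int[lbg]_(x in `[(m - d)%R, (m + d)%R]) ((s n * (x - m)) ^+ k * iter n rho f x)%:E =
   \int[lbg]_y ((fun y => (G k n y)%:E) \_ `[(- (s n * d))%R, (s n * d)%R]) y)%E.
Proof.
have fm0 := median_density_gt0; have sn := s_gt0 n.
have snn : s n != 0 by rewrite gt_eqF.
pose L y := m + y / s n.
have dL y : is_derive y (1 : R) L (s n)^-1.
  by rewrite /L; apply: is_derive_eq; rewrite /GRing.scale/= !(mulr1, mul1r, mulr0, add0r).
have L' : derive1 L = cst (s n)^-1.
  by apply/funext => y; rewrite derive1E; have [_ ->] := dL y.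
have Lm : L (- (s n * d)) = m - d by rewrite /L; field.
have Lp : L (s n * d) = m + d by rewrite /L; field.
rewrite -Lm -Lp (@integration_by_substitution_increasing _ L _ (- (s n * d)) (s n * d)).
- rewrite integral_mkcond; apply: eq_integral => y _; rewrite !patchE.
  case: ifPn => // _; congr (_%:E).
  have -> : G k n y = (s n * (L y - m)) ^+ k * iter n rho f (L y) * (s n)^-1.
    have -> : s n * (L y - m) = y by rewrite /L; field.
    rewrite /G (iter_rhoE fD fm f1) -/(L y) /s.
    by field; rewrite !gt_eqF ?exprn_gt0.
  by rewrite L'.
- by rewrite ge0_cp// mulr_ge0 ?ltW.
- by move=> x y _ _ xy; rewrite /L ltrD2l ltr_pM2r ?invr_gt0.
- by move=> x _; rewrite L'; exact: cvg_cst.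
- by rewrite L'; exact: is_cvg_cst.
- by rewrite L'; exact: is_cvg_cst.
- split.
  + by move=> y _; have [] := dL y.
  + by apply: cvg_at_right_filter; exact: is_derive_continuous (dL _).
  + by apply: cvg_at_left_filter; exact: is_derive_continuous (dL _).
- rewrite Lm Lp; apply: continuous_in_subspaceT => x; rewrite inE/= in_itv/= => /andP[x1 x2].
  apply: cvgM; last first.
    by apply: continuous_iter_rho_near; rewrite ler_norml; apply/andP; split; lra.
  have c1 : {for x, continuous (fun x => s n * (x - m))}.
    by apply: cvgM; [exact: cvg_cst|apply: cvgB; [exact: cvg_id|exact: cvg_cst]].
  exact: (continuous_comp c1 (@exprn_continuous _ k _)).
Qed.

Lemma near_cvg k :
  (fun n => \int[lbg]_(x in `[(m - d)%R, (m + d)%R]) ((s n * (x - m)) ^+ k * iter n rho f x)%:E)%E @ \oo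
   --> (\int[lbg]_y (y ^+ k * kappa y)%:E)%E.
Proof.
under eq_cvg do rewrite near_substitution.
pose C := 2 / kappa (f m / 2 * d).
have fm0 := median_density_gt0.
have C0 : 0 <= C by rewrite divr_ge0// kappa_ge0.
pose g := fun y => (C%:E * (`|y| ^+ k * kappa (2^-1 * y))%:E)%E.
have ig : lbg.-integrable setT g.
  by apply: integrableZl => //; apply: integrable_pow_kappaM; rewrite invr_gt0.
have gE y : g y = (C * (`|y| ^+ k * kappa (2^-1 * y)))%:E by [].
have mm n : measurable_fun setT
    ((fun y => (G k n y)%:E) \_ `[(- (s n * d))%R, (s n * d)%R] : measurableTypeR R -> \bar R).
  apply/(measurable_restrictT _ (measurable_itv _)); apply: measurable_funTS.
  have -> : (fun y => (G k n y)%:E) = fun y => (y ^+ k * (iter n rho f (m + y / s n) / s n))%:E.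
    apply/funext => y; rewrite /G (iter_rhoE fD fm f1) /s; congr (_%:E).
    by field; rewrite !gt_eqF ?exprn_gt0.
  apply/measurable_EFinP; apply: measurable_funM; first exact: measurable_funX.
  apply: measurable_funM => //.
  apply: (@measurableT_comp _ _ _ _ _ _ (iter n rho f) _ (fun x => m + x / s n) (fm n)).
  by apply: measurable_funD => //; apply: measurable_funM.
have h1 : {ae lbg, forall y, setT y ->
    (fun n => ((fun y => (G k n y)%:E) \_ `[(- (s n * d))%R, (s n * d)%R]) y) @ \oo
      --> (y ^+ k * kappa y)%:E}.
  apply: aeW => y _.
  have h : (fun n => (G k n y)%:E) @ \oo --> (y ^+ k * kappa y)%:E.
    by apply: cvg_EFin; [exact: nearW|exact: near_pointwise].
  apply: cvg_trans h; apply: near_eq_cvg.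
  have [N hN] := natr_expr_bound (`|y| / (f m * d)).
  exists N => // n /= Nn; rewrite patchE mem_set//= in_itv/= -ler_norml.
  rewrite /s mulrAC -mulrA mulrC -ler_pdivrMl ?mulr_gt0// mulrC.
  rewrite [d * _]mulrC (le_trans hN)//.
  by rewrite ler_weXn2l// ler1n.
have h2 : {ae lbg, forall y n, setT y ->
    (`|((fun y => (G k n y)%:E) \_ `[(- (s n * d))%R, (s n * d)%R]) y| <= g y)%E}.
  apply: aeW => y n _; rewrite patchE; case: ifPn => [|_].
    by rewrite inE/= in_itv/= -ler_norml => h; rewrite gE lee_fin near_dominated.
  by change (`|0%E| <= g y)%E; rewrite abse0 gE lee_fin mulr_ge0// mulr_ge0 ?kappa_ge0 ?exprn_ge0.
by have [_ _] := dominated_convergence measurableT mm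
  (measurable_int _ (integrable_moment k)) h1 ig h2.
Qed.

End Near.

(** ** Tail contributions *)

(** The distance to the fixed point 1/2 is at most doubled by a step, and is at most that of the
    orbit of phi u0, which tends to 1/2 like the tail of the limit law. *)
Lemma iter_Bmap_tail j z u0 : 0 <= u0 -> phi u0 <= z -> z <= 2^-1 ->
  let g := 2^-1 - iter j Bmap z in
  [/\ 0 <= g, g <= 2 ^+ j * (2^-1 - z) & g <= gtail (2 ^+ j * u0)].
Proof.
move=> u00 uz z1 /=; have hi : forall x y, x <= y -> iter j Bmap x <= iter j Bmap y.
  by elim: j => [//|j IH] x y xy; rewrite !iterS Bmap_nondecreasing// IH.
have half : iter j Bmap 2^-1 = 2^-1 :> R.
  by elim: j {hi} => [//|j IH]; rewrite iterS IH Bmap_half.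
have le1 : iter j Bmap z <= 2^-1 by rewrite -[leRHS]half hi.
split; first by rewrite subr_ge0.
- have := iter_Bmap_lipschitz j 2^-1 z.
  by rewrite half !ger0_norm ?subr_ge0.
- by rewrite /gtail phi_iter lerD2l lerN2 hi.
Qed.

(** One factor is at most (pi g) ^ 2 with g the distance of the orbit to 1/2; the two bounds on g,
    one proportional to q = 1/2 - |z| and one decaying super-exponentially, are used for one
    factor g each. Then p factors keep q, and the others drop it. *)
Lemma cos_product_tail u0 : 0 < u0 ->
  exists t : nat -> R, [/\ (forall j, 0 <= t j),
    (forall k, (fun j => 2 ^+ k * t j) @ \oo --> (0 : R)) &
    forall n p z, (p <= n)%N -> phi u0 <= `|z| -> `|z| <= 2^-1 ->
      cos_product n z <= (2^-1 - `|z|) ^+ p * \prod_(j < n) t j].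
Proof.
move=> u00; have p0 := @pi_gt0 R.
exists (fun j => pi ^+ 2 * (2 ^+ j * gtail (2 ^+ j * u0))); split=> [j|k|n p z pn uz z1].
- by rewrite mulr_ge0 ?sqr_ge0// mulr_ge0 ?exprn_ge0// ltW// gtail_gt0.
- have [C C0 hC] := @gtail_decay R 2.
  apply: (@squeeze_cvgr _ _ _ _ (cst 0) (fun j => (2 ^+ k * pi ^+ 2 * C / u0 ^+ 2) / 2 ^+ j)).
  + near=> j; have h := hC (2 ^+ j * u0) (mulr_ge0 (exprn_ge0 _ (ler0n _ 2)) (ltW u00)).
    apply/andP; split; first by rewrite !mulr_ge0 ?sqr_ge0 ?exprn_ge0// ltW// gtail_gt0.
    have -> : 2 ^+ k * pi ^+ 2 * C / u0 ^+ 2 / 2 ^+ j = 2 ^+ k * pi ^+ 2 * (C / u0 ^+ 2 / 2 ^+ j).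
      by ring.
    rewrite mulrA; apply: ler_wpM2l; first by rewrite mulr_ge0 ?sqr_ge0 ?exprn_ge0.
    rewrite ler_pdivlMr ?exprn_gt0// ler_pdivlMr ?exprn_gt0//.
    have -> // : 2 ^+ j * gtail (2 ^+ j * u0) * 2 ^+ j * u0 ^+ 2 =
      (2 ^+ j * u0) ^+ 2 * gtail (2 ^+ j * u0) by ring.
  + exact: cvg_cst.
  + exact: cvg_halves.
- rewrite -cos_product_norm; set w := `|z| in uz z1 *; set q := 2^-1 - w.
  have q0 : 0 <= q by rewrite subr_ge0.
  have q1 : q <= 1 by rewrite /q; have := normr_ge0 z; rewrite -/w; lra.
  have t0 j : 0 <= pi ^+ 2 * (2 ^+ j * gtail (2 ^+ j * u0)).
    by rewrite mulr_ge0 ?sqr_ge0// mulr_ge0 ?exprn_ge0// ltW// gtail_gt0.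
  have step j : cos (pi * iter j Bmap w) ^+ 2 <=
      q * (pi ^+ 2 * (2 ^+ j * gtail (2 ^+ j * u0))).
    have [g0 g1 g2] := iter_Bmap_tail j (ltW u00) uz z1.
    have -> : cos (pi * iter j Bmap w) = sin (pi * (2^-1 - iter j Bmap w)).
      by rewrite mulrBr sinB cos_pihalf sin_pihalf mul0r subr0 mul1r.
    apply: (le_trans (sqr_sin_pi_le g0)); rewrite exprMn.
    rewrite [leRHS]mulrCA; apply: ler_wpM2l; first exact: sqr_ge0.
    by rewrite expr2 mulrA [q * _]mulrC; apply: ler_pM.
  have -> : \prod_(j < n) (pi ^+ 2 * (2 ^+ j * gtail (2 ^+ j * u0))) =
            \prod_(0 <= j < n) (pi ^+ 2 * (2 ^+ j * gtail (2 ^+ j * u0))) by rewrite big_mkord.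
  rewrite /cos_product -(big_mkord xpredT (fun j => cos (pi * iter j Bmap w) ^+ 2)).
  rewrite (big_cat_nat (n := p))//= [in leRHS](big_cat_nat (n := p))//= mulrA.
  apply: ler_pM; [by apply: prodr_ge0 => j _; exact: sqr_ge0|by apply: prodr_ge0 => j _; exact: sqr_ge0| |].
    rewrite -[p in q ^+ p]subn0 -prodr_const_nat -big_split/=.
    by apply: ler_prod => j _; rewrite sqr_ge0/= step.
  apply: ler_prod => j _; rewrite sqr_ge0/= (le_trans (step j))//.
  by rewrite ler_piMl.
Unshelve. all: by end_near. Qed.

(** Markov's inequality, on the half-line beyond x. *)
Lemma cdf_power_tail e : 0 < e -> (\int[lbg]_x ((`|x| `^ e) * f x)%:E < +oo)%E ->
  exists2 M, 0 <= M & forall x, (x <= 0 -> F x * `|x| `^ e <= M) /\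
    (0 <= x -> (1 - F x) * `|x| `^ e <= M).
Proof.
move=> e0 fin; have [_ _ _ mf] := fD.
have mp : measurable_fun setT (fun x : R => `|x| `^ e).
  by apply: (@measurableT_comp _ _ _ _ _ _ (fun x : R => x `^ e) _ (@Num.norm R R)).
have i0 : lbg.-integrable setT (EFin \o (fun x => (`|x| `^ e) * f x)).
  apply/integrableP; split; first by apply/measurable_EFinP; exact: measurable_funM.
  by under eq_integral => x _ do rewrite /= ger0_norm ?mulr_ge0 ?powR_ge0 ?(pd_ge0 fD)//.
have iS D : measurable D -> lbg.-integrable D (EFin \o (fun x => (`|x| `^ e) * f x)).
  by move=> mD; apply: integrableS i0.
have g0 x : 0 <= (`|x| `^ e) * f x by rewrite mulr_ge0 ?powR_ge0 ?(pd_ge0 fD).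
pose M := \int[lbg]_x ((`|x| `^ e) * f x).
have main (D : set (measurableTypeR R)) c : measurable D -> (forall t, D t -> c <= `|t|) -> 0 <= c ->
    (\int[lbg]_(t in D) f t) * c `^ e <= M.
  move=> mD hD c0; rewrite mulrC -(RintegralZl _ mD (pd_integrableS fD mD)).
  apply: (@le_trans _ _ (\int[lbg]_(t in D) ((`|t| `^ e) * f t))).
    apply: le_Rintegral => //; [|exact: iS|].
      have := @integrableZl _ _ _ lbg D mD (c `^ e) (EFin \o f) (pd_integrableS fD mD).
      by apply: eq_integrable => // z _.
    move=> t Dt; rewrite ler_wpM2r ?(pd_ge0 fD)// ge0_ler_powR ?nnegrE ?(ltW e0)//.
    exact: hD.
  rewrite /M /Rintegral; apply: fine_le.
  - by apply: integrable_fin_num => //; exact: iS.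
  - exact: integrable_fin_num.
  - apply: ge0_subset_integral => //; first by apply/measurable_EFinP; exact: measurable_funM.
    by move=> x _; rewrite lee_fin.
exists M; first by apply: Rintegral_ge0.
move=> x; split=> x0.
  apply: main => // t; rewrite /= in_itv/= => tx.
  by rewrite !ler0_norm// ?lerN2// (le_trans tx).
rewrite (cdf_compl fD); apply: main => // t; rewrite /= in_itv/= andbT => xt.
by rewrite !ger0_norm// ?(ltW xt)// (le_trans x0)// ltW.
Qed.

(** q is at most of order |x| ^ - eps, so a power p with p * eps >= k compensates |x - m| ^ k. *)
Lemma cdf_polynomial_tail k e : 0 < e -> (\int[lbg]_x ((`|x| `^ e) * f x)%:E < +oo)%E ->
  exists p, exists2 C, 0 <= C & forall x,
    (2^-1 - `|F x - 2^-1|) ^+ p * `|x - m| ^+ k <= C.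
Proof.
move=> e0 /(cdf_power_tail e0)[M M0 hM].
have [p hp] : exists p : nat, k%:R <= p%:R * e.
  exists (Num.bound (k%:R / e)); rewrite -ler_pdivrMr//.
  by apply/ltW/archi_boundP; rewrite divr_ge0// ltW.
exists p; exists ((2 * `|m| + 1) ^+ k + 2 ^+ k * M ^+ p).
  by rewrite addr_ge0 ?exprn_ge0 ?mulr_ge0 ?exprn_ge0// addr_ge0 ?mulr_ge0.
move=> x; set q := 2^-1 - _.
have q0 : 0 <= q by rewrite subr_ge0 cdf_dist_half.
have q1 : q <= 1 by rewrite /q; have := normr_ge0 (F x - 2^-1); lra.
have xm : `|x - m| <= `|x| + `|m| by exact: ler_normB.
have [xs|xl] := leP `|x| (`|m| + 1).
  rewrite (@le_trans _ _ ((2 * `|m| + 1) ^+ k))//; last first.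
    by rewrite lerDl mulr_ge0 ?exprn_ge0.
  rewrite (@le_trans _ _ (`|x - m| ^+ k))//; first by rewrite ler_piMl ?exprn_ge0// exprn_ile1.
  by apply: lerXn2r; rewrite ?nnegrE ?addr_ge0 ?mulr_ge0//; lra.
have x1 : 1 <= `|x| by have := normr_ge0 m; lra.
have qM : q * `|x| `^ e <= M.
  have [F0 F1] := (cdf_ge0' fD x, cdf_le1' fD x).
  have pe : 0 <= `|x| `^ e by exact: powR_ge0.
  have [x0|x0] := leP x 0.
    apply: le_trans ((hM x).1 x0); apply: ler_wpM2r => //.
    by rewrite /q; have := ler_norm (- (F x - 2^-1)); rewrite normrN; lra.
  apply: le_trans ((hM x).2 (ltW x0)); apply: ler_wpM2r => //.
  by rewrite /q; have := ler_norm (F x - 2^-1); lra.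
rewrite (@le_trans _ _ (2 ^+ k * M ^+ p))//; last by rewrite lerDr exprn_ge0// addr_ge0 ?mulr_ge0.
have h1 : `|x - m| ^+ k <= 2 ^+ k * (`|x| `^ e) ^+ p.
  apply: (@le_trans _ _ (2 ^+ k * `|x| ^+ k)).
    rewrite -exprMn; apply: lerXn2r; rewrite ?nnegrE ?mulr_ge0//.
    by have := normr_ge0 m; lra.
  rewrite ler_wpM2l ?exprn_ge0//.
  rewrite -[(_ `^ e) ^+ p]powR_mulrn ?powR_ge0// -powRrM -[leLHS]powR_mulrn//.
  by rewrite ler_powR// mulrC.
apply: (@le_trans _ _ (q ^+ p * (2 ^+ k * (`|x| `^ e) ^+ p))).
  by rewrite ler_wpM2l ?exprn_ge0.
rewrite mulrCA -exprMn ler_wpM2l ?exprn_ge0//.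
by apply: lerXn2r; rewrite ?nnegrE// mulr_ge0 ?powR_ge0.
Qed.

(** The rescaling contributes 2 ^ (n k) and the density 2 ^ n; distributed over the n factors
    t_j this is 2 ^ (k + 1) * t_j, which still tends to 0. *)
Lemma far_dominated d k e : 0 < d ->
  (forall x, `|x - m| <= d -> (a < x%:E < b)%E /\ f m / 2 <= f x <= 2 * f m) ->
  0 < e -> (\int[lbg]_x ((`|x| `^ e) * f x)%:E < +oo)%E ->
  exists2 eta : nat -> R, eta @ \oo --> (0 : R) &
    \forall n \near \oo, 0 <= eta n /\ forall x, d <= `|x - m| ->
      `|(s n * (x - m)) ^+ k * iter n rho f x| <= eta n * f x.
Proof.
move=> d0 hd e0 fin; have fm0 := median_density_gt0.
have [p [C C0 hC]] := cdf_polynomial_tail k e0 fin.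
have z0 : 0 < f m / 2 * d by rewrite mulr_gt0// divr_gt0.
have [t [t0 tk ht]] := cos_product_tail z0.
exists (fun n => f m ^+ k * C * \prod_(j < n) (2 ^+ k.+1 * t j)).
  rewrite -[X in _ --> X](mulr0 (f m ^+ k * C)); apply: cvgM; first exact: cvg_cst.
  by apply: (prod_cvg0 _ (tk _)) => j; rewrite mulr_ge0 ?exprn_ge0.
exists p => // n /= pn; split.
  rewrite !mulr_ge0 ?exprn_ge0 ?(ltW fm0)// prodr_ge0// => j _.
  by rewrite mulr_ge0 ?exprn_ge0.
move=> x dx; rewrite (iter_rhoE fD fm f1).
have z1 := cdf_far d0 hd dx.
have h := ht n p (F x - 2^-1) pn (le_trans (phi_le (ltW z0)) z1) (cdf_dist_half x).
rewrite normrM normrX normrM (@gtr0_norm _ (s n))// [`|2 ^+ n * _ * _|]ger0_norm; last first.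
  by rewrite mulr_ge0 ?(pd_ge0 fD)// mulr_ge0 ?exprn_ge0 ?cos_product_ge0.
rewrite mulrA; apply: ler_wpM2r; first exact: (pd_ge0 fD).
apply: (@le_trans _ _ ((s n * `|x - m|) ^+ k * (2 ^+ n * ((2^-1 - `|F x - 2^-1|) ^+ p * \prod_(j < n) t j)))).
  apply: ler_wpM2l; first by rewrite exprn_ge0// mulr_ge0// ltW.
  by apply: ler_wpM2l => //; exact: exprn_ge0.
have -> : \prod_(j < n) (2 ^+ k.+1 * t j) = (2 ^+ n) ^+ k.+1 * \prod_(j < n) t j.
  by rewrite big_split/= prodr_const card_ord -!exprM mulnC.
have P0 : 0 <= \prod_(j < n) t j by rewrite prodr_ge0.
have -> : (s n * `|x - m|) ^+ k * (2 ^+ n * ((2^-1 - `|F x - 2^-1|) ^+ p * \prod_(j < n) t j)) =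
  f m ^+ k * ((2^-1 - `|F x - 2^-1|) ^+ p * `|x - m| ^+ k) * ((2 ^+ n) ^+ k.+1 * \prod_(j < n) t j).
  rewrite /s !exprMn [(2 ^+ n) ^+ k.+1]exprS.
  by ring.
apply: ler_wpM2r; first by rewrite mulr_ge0// exprn_ge0// exprn_ge0.
by apply: ler_wpM2l; [rewrite exprn_ge0// ltW|exact: hC].
Qed.

(** The integral is cut at distance d from the median: the inner part converges by domination,
    the outer part tends to 0. *)
Lemma moment_cvg k e : 0 < e -> (\int[lbg]_x ((`|x| `^ e) * f x)%:E < +oo)%E ->
  (\forall n \near \oo,
     lbg.-integrable setT (fun x => ((s n * (x - m)) ^+ k * iter n rho f x)%:E)) /\
  (fun n => \int[lbg]_x ((s n * (x - m)) ^+ k * iter n rho f x)%:E)%E @ \oo -->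
    (\int[lbg]_y (y ^+ k * kappa y)%:E)%E.
Proof.
move=> e0 fin; have [d d0 hd] := median_neighbourhood.
have [eta eta0 heta] := far_dominated k d0 hd e0 fin.
pose I : set R := `[m - d, m + d]%classic.
have mI : measurable (I : set (measurableTypeR R)) by exact: measurable_itv.
have IE x : I x = (`|x - m| <= d) :> Prop.
  rewrite /I /= in_itv/= ler_norml; apply/propext; split => /andP[h1 h2]; apply/andP; split; lra.
pose h n x := (s n * (x - m)) ^+ k * iter n rho f x.
have mh n : measurable_fun setT (h n : measurableTypeR R -> R).
  apply: measurable_funM; last exact: fm.
  apply: measurable_funX.
  by apply: measurable_funM => //; exact: measurable_funB.
have i1 n : lbg.-integrable setT (EFin \o iter n rho f).
  exact: pd_integrable (iter_rho_positive_density fD fm f1 n).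
have iI n : lbg.-integrable I (EFin \o h n).
  apply: (@le_integrable _ _ _ lbg I mI _ (fun x => (((s n * d) ^+ k)%:E * (iter n rho f x)%:E)%E)).
  - by apply/measurable_EFinP; apply: measurable_funTS; exact: mh.
  - move=> x; rewrite IE => xd /=; rewrite lee_fin !normrM ler_wpM2r//.
    rewrite !normrX (normrM (s n) d) (normrM (s n) (x - m)) (gtr0_norm (s_gt0 n)) (gtr0_norm d0).
    have s0 : 0 <= s n by exact/ltW/s_gt0.
    apply: lerXn2r; rewrite ?nnegrE; [exact: mulr_ge0|exact: (mulr_ge0 s0 (ltW d0))|].
    by apply: ler_wpM2l.
  - by apply: integrableZl => //; apply: integrableS (i1 n).
have ICE x : (~` I) x -> d <= `|x - m|.
  by move=> nI; rewrite leNgt; apply/negP => /ltW; rewrite -IE.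
have iC : \forall n \near \oo, lbg.-integrable (~` I) (EFin \o h n).
  near=> n; have [en hn] : 0 <= eta n /\ forall x, d <= `|x - m| ->
      `|(s n * (x - m)) ^+ k * iter n rho f x| <= eta n * f x by near: n.
  apply: (@le_integrable _ _ _ lbg _ (measurableC mI) _ (fun x => ((eta n)%:E * (f x)%:E)%E)).
  - by apply/measurable_EFinP; apply: measurable_funTS; exact: mh.
  - move=> x /ICE xd /=; rewrite lee_fin (le_trans (hn x xd))// ler_norm//.
  - apply: integrableZl; first exact: measurableC.
    by apply: integrableS (i1 0%N) => //; exact: measurableC.
have bC : \forall n \near \oo, (`|\int[lbg]_(x in ~` I) (h n x)%:E| <= (eta n)%:E)%E.
  near=> n; have [en hn] : 0 <= eta n /\ forall x, d <= `|x - m| ->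
      `|(s n * (x - m)) ^+ k * iter n rho f x| <= eta n * f x by near: n.
  have iCn : lbg.-integrable (~` I) (EFin \o h n) by near: n.
  apply: (le_trans (le_abse_integral _ (measurableC mI) (measurable_int _ iCn))).
  have -> : (eta n)%:E = (\int[lbg]_x ((eta n)%:E * (f x)%:E))%E.
    have [_ _ ff _] := fD.
    by rewrite integralZl ?ff ?mule1//; exact: (i1 0%N).
  have mf := (let: And4 _ _ _ w := fD in w).
  apply: (@le_trans _ _ (\int[lbg]_(x in ~` I) ((eta n)%:E * (f x)%:E))%E).
    apply: ge0_le_integral => //.
    + exact: measurableC.
    + by apply: measurableT_comp => //; apply/measurable_EFinP; apply: measurable_funTS; exact: mh.
    + apply/measurable_EFinP/measurable_funTS; exact: measurable_funM.
    + by move=> x /ICE xd /=; rewrite lee_fin hn.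
  apply: ge0_subset_integral => //; first exact: measurableC.
  + by apply/measurable_EFinP; exact: measurable_funM.
  + by move=> x _; rewrite -EFinM lee_fin mulr_ge0 ?(pd_ge0 fD).
split.
  near=> n; have iCn : lbg.-integrable (~` I) (EFin \o h n) by near: n.
  apply/integrableP; split; first by apply/measurable_EFinP; exact: mh.
  rewrite -(setUv I) ge0_integral_setU//.
  - apply: lte_add_pinfty; first by have /integrableP[] := iI n.
    by have /integrableP[] := iCn.
  - exact: measurableC.
  - rewrite setUv; apply: measurableT_comp => //; apply/measurable_EFinP; exact: mh.
  - by apply/disj_setPCl; exact: subset_refl.
have sp n : (\int[lbg]_x (h n x)%:E = \int[lbg]_(x in I) (h n x)%:E + \int[lbg]_(x in ~` I) (h n x)%:E)%E.
  rewrite -integral_setU ?setUv//; first exact: measurableC.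
  - by apply/measurable_EFinP; exact: mh.
  - by apply/disj_setPCl; exact: subset_refl.
suff : (fun n => \int[lbg]_(x in I) (h n x)%:E + \int[lbg]_(x in ~` I) (h n x)%:E)%E @ \oo -->
    (\int[lbg]_y (y ^+ k * kappa y)%:E + 0)%E.
  by rewrite adde0; under eq_fun do rewrite -sp.
apply: cvgeD.
- by rewrite fin_num_adde_defl.
- exact: near_cvg.
- have ee : (fun n => (eta n)%:E) @ \oo --> 0%E by apply: cvg_EFin => //; exact: nearW.
  apply/cvg_abse0P; apply: (squeeze_cvge (f := cst 0%E) (h := fun n => (eta n)%:E)) => //.
  + by near=> n; rewrite abse_ge0/=; near: n.
  + exact: cvg_cst.
Unshelve. all: by end_near. Qed.

End Moments.

(** * Limit theorem for the random variables *)
Section Transfer.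
Context {R : realType}.
Notation lbg := (@lebesgue_measure R).
Implicit Types (x y z u v e s m : R) (n k p : nat).

Section OneVariable.
Context d (T : measurableType d) (P : probability T R).

(** The same random variable, valued in the type that carries Lebesgue measure. *)
Definition borel_rv (X : {RV P >-> R}) : T -> measurableTypeR R := X.

HB.instance Definition _ (X : {RV P >-> R}) :=
  isMeasurableFun.Build _ _ T (measurableTypeR R) (borel_rv X) (@measurable_funP _ _ _ _ setT X).

Lemma rv_integral (X : {RV P >-> R}) (g h : R -> R) :
  has_density (distribution P X) g -> measurable_fun setT h ->
  lbg.-integrable setT (fun x => (h x * g x)%:E) ->
  P.-integrable setT (fun w => (h (X w))%:E) /\
  (\int[P]_w (h (X w))%:E = \int[lbg]_x (h x * g x)%:E)%E.
Proof.
move=> Xg mh ih; pose X' := borel_rv X : {RV P >-> measurableTypeR R}.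
have Xg' : has_density (distribution P X') g := Xg.
have iD := integrable_density Xg' mh ih.
have iP : P.-integrable setT (fun w => (h (X w))%:E).
  apply/integrableP; split.
    by apply/measurable_EFinP; exact: (@measurableT_comp _ _ _ _ _ _ h _ X).
  have /integrableP[_] := iD; rewrite ge0_integral_distribution//.
  by apply: measurableT_comp => //; exact/measurable_EFinP.
split=> //; rewrite -(integral_density Xg' mh ih) integral_distribution//.
exact/measurable_EFinP.
Qed.

(** The variance is read off from the first two moments of the rescaled variable. *)
Lemma variance_affine (X Y : T -> R) s m : 0 < s ->
  (forall w, Y w = s * (X w - m)) ->
  P.-integrable setT (fun w => (Y w)%:E) ->
  P.-integrable setT (fun w => (Y w ^+ 2)%:E) ->
  ('V_P[X] = ((fine 'E_P[fun w => (Y w ^+ 2)%R] - fine 'E_P[Y] ^+ 2) / s ^+ 2)%:E)%E.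
Proof.
move=> s0 YX i1 i2; have sn : s != 0 by rewrite gt_eqF.
have XE w : X w = m + s^-1 * Y w by rewrite YX; field.
have PT : fine (P setT) = 1 by rewrite probability_setT.
have ic c : P.-integrable setT (EFin \o (cst c : T -> R)).
  exact: finite_measure_integrable_cst.
have iZ c (h : T -> R) : P.-integrable setT (EFin \o h) -> P.-integrable setT (EFin \o (fun w => c * h w)).
  move=> ih; have := @integrableZl _ _ _ P setT measurableT c _ ih.
  by apply: eq_integrable.
have iA (h1 h2 : T -> R) : P.-integrable setT (EFin \o h1) -> P.-integrable setT (EFin \o h2) ->
    P.-integrable setT (EFin \o (fun w => h1 w + h2 w)).
  by move=> i3 i4; have := integrableD measurableT i3 i4; apply: eq_integrable.
set E1 := fine 'E_P[Y]; set E2 := fine _.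
have E1E : \int[P]_w Y w = E1 by rewrite /E1 unlock.
have E2E : \int[P]_w (Y w ^+ 2) = E2 by rewrite /E2 unlock.
have cE : fine 'E_P[X] = m + s^-1 * E1.
  rewrite unlock -[LHS]/(\int[P]_w X w).
  have -> : \int[P]_w X w = \int[P]_w (m + s^-1 * Y w) by apply: eq_Rintegral => w _.
  rewrite RintegralD//; [|exact: ic|exact: iZ].
  by rewrite Rintegral_cst// PT mulr1 RintegralZl// E1E.
rewrite /variance unlock cE [in LHS]unlock.
have e w : (((X \- cst (m + s^-1 * E1)) * (X \- cst (m + s^-1 * E1))) w =
   s ^- 2 * (Y w ^+ 2 + (- (2 * E1) * Y w + E1 ^+ 2)))%R.
  change ((X w - (m + s^-1 * E1)) * (X w - (m + s^-1 * E1)) =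
    s ^- 2 * (Y w ^+ 2 + (- (2 * E1) * Y w + E1 ^+ 2))).
  by rewrite XE; field.
under eq_integral do rewrite e.
have iq : P.-integrable setT (EFin \o (fun w => Y w ^+ 2 + (- (2 * E1) * Y w + E1 ^+ 2))).
  by apply: (iA _ _ i2); apply: iA; [exact: iZ|exact: ic].
rewrite -[LHS]fineK; last by apply: integrable_fin_num => //; exact: iZ.
congr (_%:E); rewrite -[LHS]/(\int[P]_w _) RintegralZl//.
rewrite RintegralD//; last by apply: iA; [exact: iZ|exact: ic].
rewrite RintegralD//; [|exact: iZ|exact: ic].
rewrite RintegralZl// Rintegral_cst// PT E1E E2E.
by rewrite mulrC; congr (_ / _); ring.
Qed.

End OneVariable.

(** ** Moments of the limit law *)
(** The moments of the limit law. *)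
Definition kmoment k : R := \int[lbg]_y (y ^+ k * kappa y).

Lemma koenigs_law_moment k :
  (koenigs_law : probability (measurableTypeR R) R).-integrable setT (fun x => (x ^+ k)%:E) /\
  ('E_koenigs_law[fun x : R => (x ^+ k)%R] = (kmoment k)%:E)%E.
Proof.
have mk : measurable_fun setT (fun x : R => x ^+ k) by exact: measurable_funX.
have i := @integrable_moment R k.
have id := integrable_density koenigs_law_density mk i.
split=> //; rewrite unlock (integral_density koenigs_law_density mk i) /kmoment /Rintegral.
by rewrite fineK//; exact: integrable_fin_num.
Qed.

(** By symmetry the mean is its own opposite. *)
Lemma koenigs_law_mean : ('E_koenigs_law[fun x : R => x] = 0)%E.
Proof.
have [i1 e1] := koenigs_law_moment 1.
have e : ('E_koenigs_law[fun x : R => x] = (kmoment 1)%:E)%E.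
  by rewrite -e1; congr expectation; apply/funext => x.
rewrite e; suff : kmoment 1 = - kmoment 1 by move=> h; congr (_%:E); lra.
apply: EFin_inj; rewrite EFinN -e unlock.
pose Q : probability (measurableTypeR R) R :=
  distribution koenigs_law (reflection : {RV koenigs_law >-> measurableTypeR R}).
have QE : (\int[koenigs_law]_x x%:E = \int[Q]_x x%:E)%E.
  apply: eq_measure_integral => B mB _.
  by rewrite /Q /= /pushforward -(koenigs_law_symmetric mB).
rewrite [LHS]QE integral_distribution//; last first.
  by have := integrableN i1; apply: eq_integrable => // x _ /=.
by rewrite -integralN/=; [|exact: (integrable_add_def measurableT i1)].
Qed.

Lemma koenigs_law_variance : ('V_koenigs_law[fun x : R => x] = (kmoment 2)%:E)%E.
Proof.
have [i1 e1] := koenigs_law_moment 1; have [i2 e2] := koenigs_law_moment 2.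
rewrite (@variance_affine _ _ koenigs_law _ (fun x : R => x) 1 0) ?ltr01//.
- by rewrite e2 koenigs_law_mean/= expr0n subr0 expr1n divr1.
- by move=> w; rewrite subr0 mul1r.
Qed.

Lemma law_variance_kmoment : law_variance (koenigs_law : probability _ R) = kmoment 2.
Proof. by rewrite /law_variance koenigs_law_variance. Qed.

Lemma excess_kurtosis_kmoment :
  excess_kurtosis (koenigs_law : probability _ R) = kmoment 4 / kmoment 2 ^+ 2 - 3.
Proof.
rewrite /excess_kurtosis law_variance_kmoment /law_mean koenigs_law_mean /=.
have [_ e4] := koenigs_law_moment 4.
have -> // : (fun x : measurableTypeR R => ((x - 0) ^+ 4)%R) = fun x => (x ^+ 4)%R.
  by apply/funext => x; rewrite subr0.
by rewrite e4.
Qed.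

(** ** The rescaled random variables *)
Section Sequence.
Variables (f : R -> R) (m : R) (fD : Dplus f) (fm : is_median f m).
Variables (d : nat -> measure_display) (T : forall n, measurableType (d n)).
Variables (P : forall n, probability (T n) R) (X : forall n, {RV P n >-> R}).
Hypothesis Xf : forall n, has_density (distribution (P n) (X n)) (iter n rho f).
Let Y n := fun w : T n => 2 ^+ n * f m * (X n w - m).

Let mf n : measurable_fun setT (iter n rho f). Proof. by have [] := Xf n. Qed.

Let f1 n : (\int[lbg]_x (iter n rho f x)%:E = 1)%E.
Proof. by have [_ _ /(_ _ measurableT)] := Xf n; rewrite probability_setT. Qed.

Let pd : exists a b, positive_density a b f.
Proof.
by have [a [b [h1 h2 h3]]] := fD; exists a, b; split => //; exact: (mf 0).
Qed.

Let s_gt0 n : 0 < 2 ^+ n * f m.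
Proof.
have [a [b h]] := pd.
by rewrite mulr_gt0 ?exprn_gt0// (median_density_gt0 h fm).
Qed.

Lemma rescaled_cvg_in_distribution : cvg_in_distribution P Y koenigs_law.
Proof.
move=> x _; have [a [b h]] := pd.
have -> : (fun n => P n [set w | @Y n w <= x]) =
    fun n => (density_cdf (iter n rho f) (m + x / (2 ^+ n * f m)))%:E.
  apply/funext => n.
  have -> : [set w | @Y n w <= x] = X n @^-1` `]-oo, m + x / (2 ^+ n * f m)]%classic.
    apply/seteqP; split=> w /=; rewrite in_itv/= /Y -lerBlDl ler_pdivlMr// mulrC//.
  rewrite -[LHS]/(distribution (P n) (X n) `]-oo, m + x / (2 ^+ n * f m)]%classic).
  have [_ _ ->//] := Xf n; rewrite /density_cdf /Rintegral fineK//.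
  apply: integrable_fin_num => //.
  exact: (pd_integrableS (iter_rho_positive_density h mf f1 n)).
have -> : law_cdf koenigs_law x = (2^-1 + phi x)%:E.
  rewrite /law_cdf -koenigs_law_cdf; congr (koenigs_law _).
by apply: cvg_EFin; [exact: nearW|exact: cdf_iter_rescaled_cvg h mf f1 fm x].
Qed.

Variable eps : R.
Hypothesis eps0 : 0 < eps.
Hypothesis Xeps : ('E_(P 0%N)[fun w => (`|X 0%N w| `^ eps)%R] < +oo)%E.

Let feps : (\int[lbg]_x ((`|x| `^ eps) * f x)%:E < +oo)%E.
Proof.
have mp : measurable_fun setT (fun x : R => `|x| `^ eps).
  by apply: (@measurableT_comp _ _ _ _ _ _ (fun x : R => x `^ eps) _ (@Num.norm R R)).
move: Xeps; rewrite unlock.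
pose X' := borel_rv (X 0%N) : {RV P 0%N >-> measurableTypeR R}.
have Xf' : has_density (distribution (P 0%N) X') f := Xf 0%N.
have -> : (\int[P 0%N]_x (`|X 0%N x| `^ eps)%:E =
           \int[distribution (P 0%N) X']_x (`|x| `^ eps)%:E)%E.
  by rewrite ge0_integral_distribution//; exact/measurable_EFinP.
by rewrite (ge0_integral_density Xf')//; exact/measurable_EFinP.
Qed.

Let Y_moment k :
  (\forall n \near \oo, (P n).-integrable setT (fun w => (@Y n w ^+ k)%:E)) /\
  ('E_(P n)[fun w => (@Y n w ^+ k)%R])%E @[n --> \oo] --> (kmoment k)%:E.
Proof.
have [a [b h]] := pd.
have [near_i cv] := moment_cvg h mf f1 fm k eps0 feps.
have mk n : measurable_fun setT (fun x => (2 ^+ n * f m * (x - m)) ^+ k).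
  apply: measurable_funX; apply: measurable_funM => //; exact: measurable_funB.
have key n (i : lbg.-integrable setT (fun x => ((2 ^+ n * f m * (x - m)) ^+ k * iter n rho f x)%:E)) :=
  rv_integral (Xf n) (mk n) i.
split.
  by apply: filterS near_i => n /key[].
have -> : (kmoment k)%:E = (\int[lbg]_y (y ^+ k * kappa y)%:E)%E.
  rewrite /kmoment /Rintegral fineK//; apply: integrable_fin_num => //.
  exact: integrable_moment.
apply: cvg_trans cv; apply: near_eq_cvg; apply: filterS near_i => n /key[_ e].
by rewrite unlock e.
Qed.

Lemma rescaled_cvg_moments : cvg_moments P Y koenigs_law.
Proof.
move=> k; have [i e] := koenigs_law_moment k; have [i' e'] := Y_moment k.
by split=> //; rewrite e.
Qed.

Lemma variance_equivalent : 0 < kmoment 2 ->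
  (fun n => fine ('V_(P n)[X n])%E : R^o) ~_\oo
  (fun n => law_variance koenigs_law * f m ^- 2 * 4 ^- n : R^o).
Proof.
move=> v0; have [i1 c1] := Y_moment 1; have [i2 c2] := Y_moment 2.
have fm0 : 0 < f m by have := s_gt0 0; rewrite expr0 mul1r.
have m1 : kmoment 1 = 0.
  have [_ e1] := koenigs_law_moment 1; have := koenigs_law_mean.
  rewrite (_ : (fun x => x) = fun x : R => x ^+ 1) ?e1; last exact/funext.
  by move=> [].
pose v n := fine 'E_(P n)[fun w => (@Y n w ^+ 2)%R] - fine 'E_(P n)[fun w => (@Y n w ^+ 1)%R] ^+ 2.
have vc : v @ \oo --> kmoment 2.
  have -> : kmoment 2 = kmoment 2 - kmoment 1 ^+ 2 by rewrite m1 expr0n subr0.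
  apply: cvgB; first exact: (fine_cvg c2).
  by rewrite !expr2; apply: cvgM; exact: (fine_cvg c1).
have VE : \forall n \near \oo, fine 'V_(P n)[X n] = v n / (2 ^+ n * f m) ^+ 2.
  near=> n; have j1 : (P n).-integrable setT (fun w => (@Y n w ^+ 1)%:E) by near: n.
  have j2 : (P n).-integrable setT (fun w => (@Y n w ^+ 2)%:E) by near: n.
  by rewrite (@variance_affine _ _ (P n) (X n) (@Y n) _ m (s_gt0 n)).
have gE n : law_variance koenigs_law * f m ^- 2 * 4 ^- n = kmoment 2 / (2 ^+ n * f m) ^+ 2.
  rewrite law_variance_kmoment exprMn -exprM mulnC exprM (_ : 4 = 2 ^+ 2); last by rewrite -natrX.
  by field; rewrite !gt_eqF ?exprn_gt0// ?ltr0n.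
apply/eqaddoP => e e0; near=> n.
rewrite /= fctE gE.
have -> : fine 'V_(P n)[X n] = v n / (2 ^+ n * f m) ^+ 2 by near: n.
change (`|v n / (2 ^+ n * f m) ^+ 2 - law_variance koenigs_law * f m ^- 2 * 4 ^- n| <=
  e * `|kmoment 2 / (2 ^+ n * f m) ^+ 2|).
rewrite gE -mulrBl !normrM mulrA ler_wpM2r// (@gtr0_norm _ (kmoment 2))//.
rewrite distrC; near: n; move/cvgrPdist_le : vc; apply; exact: mulr_gt0.
Unshelve. all: by end_near. Qed.

End Sequence.
End Transfer.

(** * The rescaled linearizer *)
Section Rescaled.
Context {R : realType}.
Notation lbg := (@lebesgue_measure R).
Implicit Types (x y z u v c : R) (n p k : nat).

(** In the variable v = 2 pi u the doubling relation has rational coefficients: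
    psi (2 v) = psi v + sin (psi v). *)
Definition psi v : R := 2 * pi * phi (v / (2 * pi)).
Definition kap v : R := kappa (v / (2 * pi)).
(** The map B in the variable 2 pi y. *)
Definition hmap y : R := y + sin y.

Lemma twopiK z : 2 * pi * z / (2 * pi) = z :> R.
Proof. by rewrite [2 * pi * z]mulrC mulfK// twopi_neq0. Qed.

Lemma hmap_Bmap y : hmap y = 2 * pi * Bmap (y / (2 * pi)).
Proof.
have e z : 2 * pi * (z / (2 * pi)) = z :> R by rewrite mulrA twopiK.
by rewrite /hmap /Bmap mulrDr !e.
Qed.

Lemma iter_hmap n y : iter n hmap y = 2 * pi * iter n Bmap (y / (2 * pi)).
Proof.
elim: n => [|n IH]; first by rewrite /= mulrA twopiK.
by rewrite !iterS IH hmap_Bmap twopiK.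
Qed.

Lemma hmap_nondecreasing x y : x <= y -> hmap x <= hmap y.
Proof.
move=> xy; rewrite !hmap_Bmap ler_pM2l ?twopi_gt0// Bmap_nondecreasing//.
by rewrite ler_pM2r ?invr_gt0 ?twopi_gt0.
Qed.

Lemma hmap_lipschitz x y : x <= y -> hmap y - hmap x <= 2 * (y - x).
Proof.
move=> xy; have := @cos_lipschitz R 0 0.
have [c _ e] := @mean_value R hmap (fun z => 1 + cos z) x y xy
  (fun z _ => is_deriveD (is_derive_id z 1) (is_derive_sin z)).
move=> _; rewrite e ler_wpM2r ?subr_ge0//; have := cos_le1 c; lra.
Qed.

Lemma psi_double v : psi (2 * v) = psi v + sin (psi v).
Proof.
by rewrite -/(hmap _) hmap_Bmap /psi -(mulrA 2 v) phi_double twopiK.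
Qed.

Lemma psi0 : psi 0 = 0. Proof. by rewrite /psi mul0r phi0 mulr0. Qed.

Lemma is_derive_psi v : is_derive v (1 : R) psi (kap v).
Proof.
have d : is_derive v (1 : R) (fun v => v / (2 * pi)) (2 * pi)^-1.
  by apply: is_derive_eq; rewrite /GRing.scale/= mulr0 add0r mulr1.
have h := @is_derive1_comp R phi (fun v => v / (2 * pi)) v _ _ (is_derive_phi _) d.
have := is_deriveZ (2 * pi) h; rewrite /GRing.scale /= mulrCA mulfV ?twopi_neq0// mulr1.
by [].
Qed.

Lemma kap_ge0 v : 0 <= kap v. Proof. exact: kappa_ge0. Qed.

Lemma kap_le1 v : kap v <= 1. Proof. exact: kappa_le1. Qed.

Lemma kap_nonincreasing u v : 0 <= u -> u <= v -> kap v <= kap u.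
Proof.
move=> u0 uv; apply: kappa_nonincreasing; first by rewrite divr_ge0// ltW// twopi_gt0.
by rewrite ler_pM2r ?invr_gt0 ?twopi_gt0.
Qed.

Lemma kap_double v : kap (2 * v) = cos (psi v / 2) ^+ 2 * kap v.
Proof.
rewrite /kap -mulrA kappa_double /psi; congr (cos _ ^+ 2 * _).
by rewrite mulrAC -mulrA mulrC; field.
Qed.

Lemma psi_nondecreasing u v : u <= v -> psi u <= psi v.
Proof.
move=> uv; rewrite ler_pM2l ?twopi_gt0// phi_nondecreasing//.
by rewrite ler_pM2r ?invr_gt0 ?twopi_gt0.
Qed.

Lemma psi_ge0 v : 0 <= v -> 0 <= psi v.
Proof. by move=> v0; rewrite -psi0 psi_nondecreasing. Qed.

Lemma psi_lt_pi v : psi v < pi.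
Proof.
have := phi_lt_half (v / (2 * pi)); rewrite ltr_norml => /andP[_ h].
have -> : pi = 2 * pi * 2^-1 :> R by field.
by rewrite ltr_pM2l ?twopi_gt0.
Qed.

(** Any starting point tangent to the identity leads to psi. *)
Lemma psi_iter_cvg (Q : R -> R) v : {for 0, continuous Q} -> Q 0 = 1 ->
  (fun n => iter n hmap (v / 2 ^+ n * Q (v / 2 ^+ n))) @ \oo --> psi v.
Proof.
move=> cQ Q0; under eq_cvg do rewrite iter_hmap.
apply: cvgM; first exact: cvg_cst.
apply: iter_Bmap_cvg.
have -> : (fun n => 2 ^+ n * (v / 2 ^+ n * Q (v / 2 ^+ n) / (2 * pi))) =
          fun n => v / (2 * pi) * Q (v / 2 ^+ n).
  apply/funext => n; move: (2 * pi : R) (@twopi_neq0 R) => q q0.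
  by field; rewrite q0 expf_neq0.
rewrite -[X in _ --> X]mulr1; apply: cvgM; first exact: cvg_cst.
have h := cvg_comp (fun n => v / 2 ^+ n) Q (@cvg_halves R v) cQ.
by rewrite Q0 in h.
Qed.

(** A function with the right tangent at 0 that grows at most as fast as the
    doubling relation prescribes stays below psi. *)
Lemma psi_subsolution (Q : R -> R) b v : {for 0, continuous Q} -> Q 0 = 1 ->
  (forall u, 0 <= u <= b -> 2 * u * Q (2 * u) <= hmap (u * Q u)) ->
  0 <= v <= b -> v * Q v <= psi v.
Proof.
move=> cQ Q0 h /andP[v0 vb].
have mono n x y : x <= y -> iter n hmap x <= iter n hmap y.
  by elim: n => [//|n IH] xy; rewrite !iterS hmap_nondecreasing// IH.
have key n : v * Q v <= iter n hmap (v / 2 ^+ n * Q (v / 2 ^+ n)).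
  elim: n => [|n IH]; first by rewrite expr0 divr1.
  apply: (le_trans IH); rewrite iterSr; apply: mono.
  have e : v / 2 ^+ n = 2 * (v / 2 ^+ n.+1) by rewrite exprS; field; rewrite expf_neq0.
  rewrite e; apply: h; rewrite divr_ge0 ?exprn_ge0//= (le_trans _ vb)//.
  by rewrite ler_pdivrMr ?exprn_gt0// ler_peMr// exprn_ege1// ler1n.
have cv := @psi_iter_cvg Q v cQ Q0; rewrite -(cvg_lim _ cv)//.
by apply: limr_ge; [exact: cvgP cv|exact: nearW].
Qed.

Lemma psi_supersolution (Q : R -> R) b v : {for 0, continuous Q} -> Q 0 = 1 ->
  (forall u, 0 <= u <= b -> hmap (u * Q u) <= 2 * u * Q (2 * u)) ->
  0 <= v <= b -> psi v <= v * Q v.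
Proof.
move=> cQ Q0 h /andP[v0 vb].
have mono n x y : x <= y -> iter n hmap x <= iter n hmap y.
  by elim: n => [//|n IH] xy; rewrite !iterS hmap_nondecreasing// IH.
have key n : iter n hmap (v / 2 ^+ n * Q (v / 2 ^+ n)) <= v * Q v.
  elim: n => [|n IH]; first by rewrite expr0 divr1.
  apply: le_trans IH; rewrite iterSr; apply: mono.
  have e : v / 2 ^+ n = 2 * (v / 2 ^+ n.+1) by rewrite exprS; field; rewrite expf_neq0.
  rewrite e; apply: h; rewrite divr_ge0 ?exprn_ge0//= (le_trans _ vb)//.
  by rewrite ler_pdivrMr ?exprn_gt0// ler_peMr// exprn_ege1// ler1n.
have cv := @psi_iter_cvg Q v cQ Q0; rewrite -(cvg_lim _ cv)//.
by apply: limr_le; [exact: cvgP cv|exact: nearW].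
Qed.

(** The coefficient - 1 / 36 is that of v ^ 3 in the Taylor series of psi: it solves
    8 c = 2 c - 1 / 6. *)
Lemma psi_ge_cubic v : 0 <= v <= 10^-1 -> v - v ^+ 3 / 36 <= psi v.
Proof.
pose Q (u : R) := 1 - u ^+ 2 / 36.
have cQ : {for 0, continuous Q}.
  apply: cvgB; first exact: cvg_cst.
  by apply: cvgM; [exact: exprn_continuous|exact: cvg_cst].
have Q0 : Q 0 = 1 by rewrite /Q expr0n mul0r subr0.
have -> : v - v ^+ 3 / 36 = v * Q v by rewrite /Q; ring.
apply: (psi_subsolution cQ Q0) => u /andP[u0 u1].
have uQ : 0 <= u * Q u by rewrite mulr_ge0// /Q; nra.
have := sin_ge_cubic uQ; rewrite /hmap => s.
suff : 2 * u * Q (2 * u) <= 2 * (u * Q u) - (u * Q u) ^+ 3 / 6 by lra.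
have -> : 2 * (u * Q u) - (u * Q u) ^+ 3 / 6 = 2 * u * Q (2 * u) +
   (u ^+ 3 / 6) * (1 - Q u ^+ 3) by rewrite /Q; field.
rewrite lerDl mulr_ge0 ?divr_ge0 ?exprn_ge0// subr_ge0 exprn_ile1 ?/Q//; nra.
Qed.

(** The comparison with the doubling relation needs 30 c >= 1 / 45 at order v ^ 5. *)
Lemma psi_le_quintic c v : 1 <= 30 * (45 * c) -> c <= 1 ->
  0 <= v <= 10^-1 -> psi v <= v - v ^+ 3 / 36 + v ^+ 5 * c.
Proof.
move=> c1 c2; pose Q (u : R) := 1 - u ^+ 2 / 36 + u ^+ 4 * c.
have cQ : {for 0, continuous Q}.
  apply: cvgD.
    apply: cvgB; first exact: cvg_cst.
    by apply: cvgM; [exact: exprn_continuous|exact: cvg_cst].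
  by apply: cvgM; [exact: exprn_continuous|exact: cvg_cst].
have Q0 : Q 0 = 1 by rewrite /Q !expr0n !mul0r subr0 addr0.
have -> : v - v ^+ 3 / 36 + v ^+ 5 * c = v * Q v by rewrite /Q; ring.
apply: (psi_supersolution cQ Q0) => u /andP[u0 u1].
have u2 : u ^+ 2 <= 100^-1 by have : 0 <= (10^-1 - u) * (10^-1 + u) by [apply: mulr_ge0; lra]; rewrite expr2; lra.
have Q1 : 1 - u ^+ 2 / 36 <= Q u by rewrite /Q lerDl mulr_ge0 ?exprn_ge0//; lra.
have Qle : Q u <= 1.
  rewrite /Q; have -> : u ^+ 4 = u ^+ 2 * u ^+ 2 by ring.
  have := sqr_ge0 u; move: (u ^+ 2) u2 => t t1 t0.
  rewrite -subr_ge0 (_ : _ - _ = t * (36^-1 - t * c)); last by field.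
  by rewrite mulr_ge0// subr_ge0 (@le_trans _ _ (100^-1 * 1))//; [apply: ler_pM => //; lra|lra].
have Q2 : 0 <= 1 - u ^+ 2 / 36 by lra.
have uQ : 0 <= u * Q u by rewrite mulr_ge0//; lra.
have := sin_le_quintic uQ; rewrite /hmap => s.
suff : 2 * (u * Q u) - (u * Q u) ^+ 3 / 6 + (u * Q u) ^+ 5 / 120 <= 2 * u * Q (2 * u) by lra.
have c3 : (1 - u ^+ 2 / 36) ^+ 3 <= Q u ^+ 3 by apply: lerXn2r; rewrite ?nnegrE//; lra.
have c3' : 1 - u ^+ 2 / 12 <= Q u ^+ 3.
  apply: le_trans c3; have := sqr_ge0 u; move: (u ^+ 2) u2 Q2 => t t1 t2 t0.
  rewrite -subr_ge0 (_ : _ - _ = t ^+ 2 / 432 * (1 - t / 108)); last by field.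
  by apply: mulr_ge0; [apply: divr_ge0; [exact: sqr_ge0|exact: ler0n]|lra].
have c5 : Q u ^+ 5 <= 1 by apply: exprn_ile1 => //; lra.
have u3 : 0 <= u ^+ 3 by exact: exprn_ge0.
have u5 : 0 <= u ^+ 5 by exact: exprn_ge0.
have e3 : (u * Q u) ^+ 3 = u ^+ 3 * Q u ^+ 3 by ring.
have e5 : (u * Q u) ^+ 5 = u ^+ 5 * Q u ^+ 5 by ring.
rewrite e3 e5.
have h3 : u ^+ 3 * (1 - u ^+ 2 / 12) <= u ^+ 3 * Q u ^+ 3 by exact: ler_wpM2l.
have h5 : u ^+ 5 * Q u ^+ 5 <= u ^+ 5 * 1 by exact: ler_wpM2l.
have E1 : 2 * (u * Q u) = 2 * u - u ^+ 3 / 18 + u ^+ 5 * (2 * c) by rewrite /Q; field.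
have E2 : 2 * u * Q (2 * u) = 2 * u - u ^+ 3 * 2 / 9 + u ^+ 5 * (32 * c) by rewrite /Q; field.
have E3 : u ^+ 3 * (1 - u ^+ 2 / 12) = u ^+ 3 - u ^+ 5 / 12 by field.
have h30 : u ^+ 5 * (1 / 45) <= u ^+ 5 * (30 * c) by apply: ler_wpM2l => //; lra.
rewrite E1 E2; lra.
Qed.

(** ** Truncated moments *)
Definition truncated_kmoment p u : R := \int[lbg]_(y in `]-oo, u]) (y ^+ p * kappa y).
(** The moment of psi' = kap up to v, with lower limit - oo; only differences are used. *)
Definition wmoment p v : R := (2 * pi) ^+ p.+1 * truncated_kmoment p (v / (2 * pi)).

Lemma continuous_moment p : continuous (fun y : R => y ^+ p * kappa y).
Proof. by move=> y; apply: cvgM; [exact: exprn_continuous|exact: continuous_kappa]. Qed.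

Lemma is_derive_truncated_kmoment p u :
  is_derive u (1 : R) (truncated_kmoment p) (u ^+ p * kappa u).
Proof.
have hb : ((-oo%O : itv_bound R) < BRight u)%E by exact: ltNyr.
have i : lbg.-integrable `]-oo, u + 1] (EFin \o (fun y : R => y ^+ p * kappa y)).
  exact: (integrableS _ _ _ (integrable_moment p)).
have [dF Fx] := @continuous_FTC1 _ (fun y : R => y ^+ p * kappa y) -oo%O u (u + 1)
  (ltr_pwDr ltr01 (lexx u)) i hb (@continuous_moment p u).
by split; [exact: dF|rewrite -derive1E].
Qed.

Lemma is_derive_wmoment p v : is_derive v (1 : R) (wmoment p) (v ^+ p * kap v).
Proof.
have d : is_derive v (1 : R) (fun v => v / (2 * pi)) (2 * pi)^-1.
  by apply: is_derive_eq; rewrite /GRing.scale/= mulr0 add0r mulr1.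
have h := @is_derive1_comp R (truncated_kmoment p) (fun v => v / (2 * pi)) v _ _
  (is_derive_truncated_kmoment p _) d.
have := is_deriveZ ((2 * pi) ^+ p.+1) h; rewrite /GRing.scale /=.
rewrite [X in is_derive _ _ _ X](_ : _ = v ^+ p * kap v)//.
rewrite -/(kap v) expr_div_n exprS; move: (2 * pi : R) (@twopi_neq0 R) => q q0.
by field; rewrite q0 expf_neq0.
Qed.

(** Half of the moment of even order is carried by the positive half-line. *)
Lemma kmoment_wmoment p B : ~~ odd p ->
  (forall v, 0 <= v -> wmoment p v - wmoment p 0 <= B) ->
  (2 * pi) ^+ p.+1 * kmoment p <= 2 * B /\
  forall v, 0 <= v -> 2 * (wmoment p v - wmoment p 0) <= (2 * pi) ^+ p.+1 * @kmoment R p.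
Proof.
move=> pe hB; have c0 : 0 < (2 * pi : R) ^+ p.+1 by rewrite exprn_gt0 ?twopi_gt0.
pose f y : R := y ^+ p * kappa y.
have f0 y : 0 <= f y.
  by rewrite /f mulr_ge0 ?kappa_ge0// exprn_even_ge0.
have i : lbg.-integrable setT (EFin \o f) := integrable_moment p.
pose F := truncated_kmoment p.
have nd : {homo F : x y / x <= y}.
  move=> x y xy; rewrite -subr_ge0 /F /truncated_kmoment Rintegral_itvB ?bnd_simp//.
    by apply: Rintegral_ge0 => z _; exact: f0.
  exact: (integrableS _ _ _ i).
have wE v : wmoment p v = (2 * pi) ^+ p.+1 * F (v / (2 * pi)) by [].
have uE u : u = (2 * pi * u) / (2 * pi) by rewrite [2 * pi * u]mulrC mulfK ?twopi_neq0.
have FB u : 0 <= u -> F u <= F 0 + B / (2 * pi) ^+ p.+1.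
  move=> u0; have := hB (2 * pi * u); rewrite !wE -uE mul0r -mulrBr => h.
  by rewrite -lerBlDl ler_pdivlMr// mulrC; apply: h; rewrite mulr_ge0// ltW// twopi_gt0.
have ub : has_ubound (range F).
  exists (F 0 + B / (2 * pi) ^+ p.+1) => _ [u _ <-].
  have [u0|/ltW u0] := leP 0 u; first exact: FB.
  by rewrite (le_trans (nd _ _ u0))// FB.
have Fl := nondecreasing_cvgr nd ub; set l := sup _ in Fl.
have half : (\int[lbg]_(y in `[0%R, +oo[) (f y)%:E = (l - F 0)%:E)%E.
  have dF u := is_derive_truncated_kmoment p u.
  rewrite (@ge0_continuous_FTC2y _ f F 0 l) ?EFinB//.
  - exact/continuous_subspaceT/continuous_moment.
  - by apply: cvg_at_right_filter; exact: is_derive_continuous (dF _).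
  - by move=> u _; rewrite derive1E; have [_] := dF u.
have mE : kmoment p = 2 * (l - F 0).
  apply: EFin_inj; rewrite EFinM -half /kmoment /Rintegral fineK; last first.
    exact: integrable_fin_num.
  rewrite ge0_symfun_integralT//; last 2 first.
  - exact: continuous_moment.
  - move=> y /=; by rewrite kappaN exprNn -signr_odd (negbTE pe) expr0 mul1r.
  by rewrite -set_itvcy.
have lB : l - F 0 <= B / (2 * pi) ^+ p.+1.
  rewrite lerBlDl; apply: ge_sup; first by exists (F 0), 0.
  move=> _ [u _ <-]; have [u0|/ltW u0] := leP 0 u; first exact: FB.
  by rewrite (le_trans (nd _ _ u0))// FB.
split; first by rewrite mE mulrCA ler_pM2l// mulrC -ler_pdivlMr.
move=> v v0; rewrite mE mulrCA ler_pM2l// !wE mul0r -mulrBr ler_pM2l// lerD2r.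
by apply: ub_le_sup => //; exists (v / (2 * pi)).
Qed.

End Rescaled.

(** * Quadrature inequalities for the moments *)
Section Quadrature.
Context {R : realType}.
Implicit Types (x y z u v c a b h m : R) (n p k : nat).

Lemma is_derive_exprS p v : is_derive v (1 : R) (fun v : R => v ^+ p.+1) (p.+1%:R * v ^+ p).
Proof.
have := @is_deriveX R _ id p.+1 v (1 : R) 1 (is_derive_id v (1 : R)).
have -> : (fun v : R => v ^+ p.+1) = id ^+ p.+1 by apply/funext => z; rewrite exprfctE.
by rewrite /GRing.scale /= mulr1.
Qed.

(** kap decreases while v ^ p increases, so the mean of their product is at most
    the product of the means. *)
Lemma wmoment_chebyshev p a b : 0 <= a -> a <= b ->
  p.+1%:R * (b - a) * (wmoment p b - wmoment p a) <= (b ^+ p.+1 - a ^+ p.+1) * (psi b - psi a).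
Proof.
move=> a0 ab; have [c /andP[ac cb] e] := @mean_value R _ _ a b ab (fun v _ => is_derive_exprS p v).
have c0 : 0 <= c by exact: le_trans ac.
rewrite e -mulrA -[leRHS]mulrA [leRHS]mulrA [_ * (b - a)]mulrC.
pose G v := c ^+ p * psi v + kap c * (p.+1%:R^-1 * v ^+ p.+1 - c ^+ p * v).
have dG v : is_derive v (1 : R) G (c ^+ p * kap v + kap c * (v ^+ p - c ^+ p)).
  have d1 := is_deriveZ (c ^+ p) (is_derive_psi v).
  have d2 : is_derive v (1 : R) (fun v : R => p.+1%:R^-1 * v ^+ p.+1 - c ^+ p * v) (v ^+ p - c ^+ p).
    have e1 := is_deriveZ p.+1%:R^-1 (is_derive_exprS p v).
    have := is_deriveB e1 (is_deriveZ (c ^+ p) (is_derive_id v (1 : R))).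
    by rewrite /GRing.scale /= mulr1 mulrA mulVf ?pnatr_eq0// mul1r.
  exact: (is_deriveD d1 (is_deriveZ (kap c) d2)).
have h : wmoment p b - wmoment p a <= G b - G a.
  pose G1 v := G v - G a + wmoment p a.
  suff : wmoment p b <= G1 b by rewrite /G1; lra.
  apply: (@ler_deriv _ (wmoment p) G1 (fun v => v ^+ p * kap v)
    (fun v => c ^+ p * kap v + kap c * (v ^+ p - c ^+ p)) a b ab).
  - by move=> v _; exact: is_derive_wmoment.
  - move=> v _; have := is_deriveD (is_deriveB (dG v) (is_derive_cst (G a) v 1)) (is_derive_cst (wmoment p a) v 1).
    by rewrite subr0 addr0.
  - move=> v /andP[av vb]; have v0 : 0 <= v by exact: le_trans av.
    rewrite -subr_ge0 (_ : _ - _ = (kap c - kap v) * (v ^+ p - c ^+ p)); last by ring.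
    have [vc|/ltW cv] := leP v c.
      rewrite -mulrNN mulr_ge0// oppr_ge0 subr_le0; first exact: kap_nonincreasing.
      by apply: lerXn2r; rewrite ?nnegrE.
    rewrite mulr_ge0// subr_ge0; first exact: kap_nonincreasing.
    by apply: lerXn2r; rewrite ?nnegrE.
  - by rewrite /G1 subrr add0r.
have GE : p.+1%:R * (b - a) * (G b - G a) = p.+1%:R * (b - a) * (c ^+ p * (psi b - psi a)).
  have eb : b ^+ p.+1 = a ^+ p.+1 + p.+1%:R * c ^+ p * (b - a) by rewrite -e addrC subrK.
  rewrite /G eb; have : p.+1%:R != 0 :> R by rewrite pnatr_eq0.
  by move: (p.+1%:R : R) => q q0; field.
rewrite [X in _ <= X](_ : _ = p.+1%:R * (b - a) * (c ^+ p * (psi b - psi a))); last by ring.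
rewrite [X in X <= _](_ : _ = p.+1%:R * (b - a) * (wmoment p b - wmoment p a)); last by ring.
by rewrite -GE ler_wpM2l// mulr_ge0// subr_ge0.
Qed.

Lemma exprn_tangent p m v : 0 <= m -> 0 <= v ->
  m ^+ p.+1 + p.+1%:R * m ^+ p * (v - m) <= v ^+ p.+1.
Proof.
move=> m0 v0; have [vm|/ltW mv] := leP v m.
  have [c /andP[vc cm] e] := @mean_value R _ _ v m vm (fun v _ => is_derive_exprS p v).
  have : p.+1%:R * c ^+ p * (m - v) <= p.+1%:R * m ^+ p * (m - v).
    rewrite ler_wpM2r ?subr_ge0// ler_wpM2l//; apply: lerXn2r; rewrite ?nnegrE//.
    exact: le_trans vc.
  by rewrite -e; lra.
have [c /andP[mc cv] e] := @mean_value R _ _ m v mv (fun v _ => is_derive_exprS p v).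
have : p.+1%:R * m ^+ p * (v - m) <= p.+1%:R * c ^+ p * (v - m).
  rewrite ler_wpM2r ?subr_ge0// ler_wpM2l//; apply: lerXn2r; rewrite ?nnegrE//.
  exact: le_trans mc.
by rewrite -e; lra.
Qed.

Section Midpoint.
Variables (p : nat) (m h : R).
Hypothesis h0 : 0 <= h.
Hypothesis mh : h <= m.
Let k0 := kap m.
Let D := p.+1%:R * m ^+ p.

(** On each half of the cell v ^ (p + 1) is bounded below by its tangent at m, and
    (v - m) * (kap v - kap m) by the value of v - m at the far end. *)
Let comparison (sgn v : R) := m ^+ p.+1 * psi v +
  D * (sgn * h * (psi v - k0 * v) + k0 * (v ^+ 2 / 2 - m * v)).

Let comparison_derive sgn v : is_derive v (1 : R) (comparison sgn)
  (m ^+ p.+1 * kap v + D * (sgn * h * (kap v - k0) + k0 * (v - m))).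
Proof.
have d1 := is_deriveZ (m ^+ p.+1) (is_derive_psi v).
have d2 : is_derive v (1 : R) (fun v => psi v - k0 * v) (kap v - k0).
  have := is_deriveB (is_derive_psi v) (is_deriveZ k0 (is_derive_id v (1 : R))).
  by rewrite /GRing.scale/= mulr1.
have d3 : is_derive v (1 : R) (fun v : R => v ^+ 2 / 2 - m * v) (v - m).
  by apply: is_derive_eq; rewrite /GRing.scale/=; field.
exact: (is_deriveD d1 (is_deriveZ D (is_deriveD (is_deriveZ (sgn * h) d2) (is_deriveZ k0 d3)))).
Qed.

Lemma wmoment_midpoint :
  m ^+ p.+1 * (psi (m + h) - psi (m - h)) + D * h * (psi (m + h) - 2 * psi m + psi (m - h))
  <= wmoment p.+1 (m + h) - wmoment p.+1 (m - h).
Proof.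
have m0 : 0 <= m by exact: le_trans mh.
have D0 : 0 <= D by rewrite mulr_ge0// exprn_ge0.
have half sgn a b : 0 <= a -> a <= b ->
    (forall v, a <= v <= b -> 0 <= (v - m - sgn * h) * (kap v - k0)) ->
    comparison sgn b - comparison sgn a <= wmoment p.+1 b - wmoment p.+1 a.
  move=> a0 ab hv; pose G1 v := wmoment p.+1 v - wmoment p.+1 a + comparison sgn a.
  suff : comparison sgn b <= G1 b by rewrite /G1; lra.
  apply: (@ler_deriv _ _ G1 _ (fun v => v ^+ p.+1 * kap v) a b ab (fun v _ => comparison_derive sgn v)).
  - move=> v _; have := is_deriveD (is_deriveB (is_derive_wmoment p.+1 v)
      (is_derive_cst (wmoment p.+1 a) v 1)) (is_derive_cst (comparison sgn a) v 1).
    by rewrite subr0 addr0.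
  - move=> v vab; have v0 : 0 <= v by case/andP: vab => av _; exact: le_trans av.
    apply: (@le_trans _ _ ((m ^+ p.+1 + D * (v - m)) * kap v)); last first.
      by rewrite ler_wpM2r ?kap_ge0// /D exprn_tangent.
    rewrite -subr_ge0 (_ : _ - _ = D * ((v - m - sgn * h) * (kap v - k0))); last by ring.
    by rewrite mulr_ge0// hv.
  - by rewrite /G1 subrr add0r.
have left : comparison (-1) m - comparison (-1) (m - h) <= wmoment p.+1 m - wmoment p.+1 (m - h).
  apply: half; rewrite ?subr_ge0 ?gerBl// => v /andP[av vm].
  rewrite mulr_ge0//; first by lra.
  by rewrite subr_ge0; apply: kap_nonincreasing => //; apply: le_trans av; rewrite subr_ge0.
have right : comparison 1 (m + h) - comparison 1 m <= wmoment p.+1 (m + h) - wmoment p.+1 m.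
  apply: half; rewrite ?lerDl// => v /andP[mv vb].
  rewrite -mulrNN mulr_ge0// oppr_ge0; first by lra.
  by rewrite subr_le0 kap_nonincreasing.
apply: le_trans (_ : (comparison (-1) m - comparison (-1) (m - h)) +
  (comparison 1 (m + h) - comparison 1 m) <= _); last by lra.
by rewrite le_eqVlt; apply/orP; left; apply/eqP; rewrite /comparison; field.
Qed.

End Midpoint.

(** ** Tails *)
Lemma deficit_double v : pi - psi (2 * v) = (pi - psi v) - sin (pi - psi v).
Proof. by rewrite psi_double sinB sinpi cospi mul0r sub0r mulN1r opprK opprD addrA. Qed.

Lemma deficit_ge0 v : 0 <= pi - psi v.
Proof. by rewrite subr_ge0 ltW// psi_lt_pi. Qed.

(** In terms of w = pi - psi a doubling is w - sin w <= w ^ 3 / 6, so v ^ 2 * w decreases along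
    the doublings as soon as w <= 1. *)
Lemma deficit_decay U v : 0 < U -> pi - psi U <= 1 -> U <= v ->
  v ^+ 2 * (pi - psi v) <= 4 * U ^+ 2 * (pi - psi U).
Proof.
move=> U0 U1 Uv; have [n vn] := natr_expr_bound (v / U).
have {}vn : v <= 2 ^+ n * U by rewrite -ler_pdivrMr.
elim: n v Uv vn => [|n IH] v Uv vn.
  have -> : v = U by apply/eqP; rewrite eq_le Uv andbT; rewrite expr0 mul1r in vn.
  by rewrite ler_wpM2r ?deficit_ge0// ler_peMl ?exprn_ge0 ?ltW// ltr1n.
have [v2|/ltW v2] := leP v (2 * U).
  rewrite (_ : 4 * U ^+ 2 = (2 * U) ^+ 2); last by ring.
  apply: ler_pM; rewrite ?deficit_ge0 ?exprn_ge0//; first by lra.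
  - by apply: lerXn2r; rewrite ?nnegrE; lra.
  - by rewrite lerD2l lerN2 psi_nondecreasing.
pose u := v / 2; have vE : v = 2 * u by rewrite /u; field.
have Uu : U <= u by rewrite /u; lra.
apply: le_trans (IH u Uu _); last by move: vn; rewrite exprS vE -mulrA ler_pM2l.
rewrite vE deficit_double; set w := pi - psi u.
have w0 : 0 <= w by exact: deficit_ge0.
have w1 : w <= 1 by apply: le_trans U1; rewrite lerD2l lerN2 psi_nondecreasing.
have s := sin_ge_cubic w0.
have w2 : w ^+ 2 <= 1 by exact: exprn_ile1.
have w3 : w ^+ 3 <= w by rewrite exprS ler_piMr.
rewrite exprMn [2 ^+ 2 * _]mulrC -mulrA ler_wpM2l ?sqr_ge0//.
have -> : 2 ^+ 2 = 4 :> R by ring.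
lra.
Qed.

(** kap v = sin ((pi - psi (v / 2)) / 2) ^ 2 * kap (v / 2), and the sine absorbs v ^ 4 by the decay of
    the deficit; what remains is the integral of kap. *)
Lemma wmoment4_tail U v : 0 < U -> pi - psi U <= 1 -> 2 * U <= v ->
  wmoment 4 v - wmoment 4 (2 * U) <=
  8 * (4 * U ^+ 2 * (pi - psi U)) ^+ 2 * (pi - psi U).
Proof.
move=> U0 U1 Uv; set C := 4 * _ * _.
have C0 : 0 <= C by rewrite !mulr_ge0 ?deficit_ge0 ?ltW.
pose G v := 8 * C ^+ 2 * psi (2^-1 * v).
have dG z : is_derive z (1 : R) G (4 * C ^+ 2 * kap (2^-1 * z)).
  have d : is_derive z (1 : R) (fun z => 2^-1 * z) 2^-1.
    by apply: is_derive_eq; rewrite /GRing.scale/= mulr1.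
  have := is_deriveZ (8 * C ^+ 2) (@is_derive1_comp R psi (fun z => 2^-1 * z) z _ _ (is_derive_psi _) d).
  rewrite /GRing.scale/= (_ : 8 * C ^+ 2 * (kap (2^-1 * z) / 2) = 4 * C ^+ 2 * kap (2^-1 * z))//.
  by field.
have G0 : G v - G (2 * U) <= 8 * C ^+ 2 * (pi - psi U).
  have e : 2^-1 * (2 * U) = U by field.
  rewrite /G e -mulrBr; apply: ler_wpM2l; first by rewrite mulr_ge0 ?sqr_ge0.
  by rewrite lerD2r ltW// psi_lt_pi.
apply: le_trans G0; pose G1 v := G v - G (2 * U) + wmoment 4 (2 * U).
suff : wmoment 4 v <= G1 v by rewrite /G1; lra.
apply: (@ler_deriv _ (wmoment 4) G1 (fun v => v ^+ 4 * kap v)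
    (fun v => 4 * C ^+ 2 * kap (2^-1 * v)) (2 * U) v Uv).
- by move=> z _; exact: is_derive_wmoment.
- move=> z _; have := is_deriveD (is_deriveB (dG z) (is_derive_cst (G (2 * U)) z 1))
    (is_derive_cst (wmoment 4 (2 * U)) z 1).
  by rewrite subr0 addr0.
- move=> z /andP[Uz _]; pose u := 2^-1 * z; have zE : z = 2 * u by rewrite /u; field.
  rewrite -/u {1 2}zE kap_double.
  have Uu : U <= u by rewrite /u; lra.
  have hd := deficit_decay U0 U1 Uu; rewrite -/C in hd.
  have -> : cos (psi u / 2) = sin ((pi - psi u) / 2).
    by rewrite mulrBl sinB cos_pihalf sin_pihalf mul0r subr0 mul1r.
  have s2 : sin ((pi - psi u) / 2) ^+ 2 <= ((pi - psi u) / 2) ^+ 2.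
    have w0 : 0 <= (pi - psi u) / 2 by rewrite divr_ge0 ?deficit_ge0.
    apply: lerXn2r; rewrite ?nnegrE ?sin_le_id//.
    apply: sin_ge0_pi; rewrite w0/=.
    have u0 : 0 <= u by lra.
    have := psi_ge0 u0; have := @pi_ge0 R; lra.
  rewrite mulrA ler_wpM2r ?kap_ge0//.
  apply: (@le_trans _ _ ((2 * u) ^+ 4 * ((pi - psi u) / 2) ^+ 2)).
    by rewrite ler_wpM2l// exprn_ge0//; lra.
  rewrite (_ : (2 * u) ^+ 4 * _ = 4 * (u ^+ 2 * (pi - psi u)) ^+ 2); last by field.
  rewrite ler_wpM2l//; apply: lerXn2r; rewrite ?nnegrE//.
  by rewrite mulr_ge0 ?sqr_ge0 ?deficit_ge0.
- by rewrite /G1 subrr add0r.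
Qed.

Lemma wmoment_nondecreasing p a b : 0 <= a -> a <= b -> wmoment p a <= wmoment p b.
Proof.
move=> a0 ab; have [c /andP[ac _] e] := @mean_value R _ _ a b ab (fun v _ => is_derive_wmoment p v).
by rewrite -subr_ge0 e !mulr_ge0 ?subr_ge0 ?kap_ge0// exprn_ge0// (le_trans a0).
Qed.

Lemma wmoment_small p a : 0 <= a -> wmoment p a - wmoment p 0 <= a ^+ p.+1.
Proof.
move=> a0; have [c /andP[c0 ca] ->] := @mean_value R _ _ 0 a a0 (fun v _ => is_derive_wmoment p v).
rewrite subr0 exprSr ler_wpM2r// -[leRHS]mulr1; apply: ler_pM; rewrite ?exprn_ge0 ?kap_ge0 ?kap_le1//.
by apply: lerXn2r; rewrite ?nnegrE.
Qed.

Lemma wmoment2_tail T v : 0 < T -> T <= v ->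
  T ^+ 2 * (wmoment 2 v - wmoment 2 T) <= wmoment 4 v - wmoment 4 T.
Proof.
move=> T0 Tv; pose G1 v := wmoment 4 v - wmoment 4 T + T ^+ 2 * wmoment 2 T.
suff : T ^+ 2 * wmoment 2 v <= G1 v by rewrite /G1; lra.
apply: (@ler_deriv _ (fun v => T ^+ 2 * wmoment 2 v) G1 (fun v => T ^+ 2 * (v ^+ 2 * kap v))
    (fun v => v ^+ 4 * kap v) T v Tv).
- by move=> z _; exact: (is_deriveZ (T ^+ 2) (is_derive_wmoment 2 z)).
- move=> z _; have := is_deriveD (is_deriveB (is_derive_wmoment 4 z) (is_derive_cst (wmoment 4 T) z 1))
    (is_derive_cst (T ^+ 2 * wmoment 2 T) z 1).
  by rewrite subr0 addr0.
- move=> z /andP[Tz _]; rewrite mulrA ler_wpM2r ?kap_ge0// (_ : z ^+ 4 = z ^+ 2 * z ^+ 2); last by ring.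
  rewrite ler_wpM2r ?sqr_ge0//; apply: lerXn2r; rewrite ?nnegrE ?(ltW T0)//.
  exact: le_trans (ltW T0) Tz.
- by rewrite /G1 subrr add0r.
Qed.

End Quadrature.

(** * Certified evaluation *)

(** The ring map from binary integers to the reals, sealed so that large numerals never unfold. *)
HB.lock Definition ZR {R : realType} (z : Z) : R := (int_of_Z z)%:~R.
Canonical ZR_unlockable := Unlockable ZR.unlock.

Section FixedPoint.
Context {R : realType}.
Implicit Types (a b c t x z : Z) (cs xs : seq Z).
Local Notation ZR := (@ZR R).

Lemma ZRD a b : ZR (a + b)%Z = ZR a + ZR b.
Proof. by rewrite unlock -intrD; congr (_%:~R); lia. Qed.

Lemma ZRN a : ZR (- a)%Z = - ZR a.
Proof. by rewrite unlock -mulrNz; congr (_%:~R); lia. Qed.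

Lemma ZRB a b : ZR (a - b)%Z = ZR a - ZR b.
Proof. by rewrite -ZRN -ZRD. Qed.

Lemma ZRM a b : ZR (a * b)%Z = ZR a * ZR b.
Proof. by rewrite unlock -intrM; congr (_%:~R); lia. Qed.

Lemma ZR_le a b : (a <= b)%Z -> ZR a <= ZR b.
Proof. by move=> ab; rewrite unlock ler_int; lia. Qed.

Lemma ZR_lt a b : (a < b)%Z -> ZR a < ZR b.
Proof. by move=> ab; rewrite unlock ltr_int; lia. Qed.

Lemma ZR_nat n : ZR (Z.of_nat n) = n%:R.
Proof. by rewrite unlock; have -> : int_of_Z (Z.of_nat n) = n%:Z by lia. Qed.

Lemma ZR_num p : ZR (Z.pos p) = (Pos.to_nat p)%:R.
Proof. by rewrite -ZR_nat; congr (ZR _); lia. Qed.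

Lemma ZR0 : ZR 0 = 0. Proof. by rewrite unlock. Qed.

Lemma ZR1 : ZR 1 = 1. Proof. by rewrite ZR_num. Qed.
Lemma ZR6 : ZR 6 = 6. Proof. by rewrite ZR_num. Qed.
Lemma ZR16 : ZR 16 = 16. Proof. by rewrite ZR_num. Qed.
Lemma ZR20 : ZR 20 = 20. Proof. by rewrite ZR_num. Qed.

Lemma ZRX2 n : ZR (2 ^ Z.of_nat n)%Z = 2 ^+ n.
Proof.
elim: n => [|n IH]; first by rewrite ZR_num.
by rewrite Nat2Z.inj_succ Z.pow_succ_r; [rewrite ZRM IH exprS ZR_num|lia].
Qed.

Lemma ZR_ge0 a : (0 <= a)%Z -> 0 <= ZR a.
Proof. by rewrite -ZR0; exact: ZR_le. Qed.

(** Numbers are stored as integer multiples of 2 ^ - 48. *)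
Definition scale : Z := (2 ^ 48)%Z.
Notation S := (ZR scale).

Lemma scale_ge : 100 <= S.
Proof.
have -> : 100 = ZR 100 by rewrite ZR_num.
exact: ZR_le.
Qed.

Definition fxmul a b : Z := Z.shiftr (a * b) 48.

Lemma fxmul_bounds a b : ZR a * ZR b - S <= S * ZR (fxmul a b) <= ZR a * ZR b.
Proof.
rewrite -!ZRM -ZRB /fxmul Z.shiftr_div_pow2 // -/scale.
have s0 : (0 < scale)%Z by [].
have := Z.mul_div_le (a * b) scale s0; have := Z.mul_succ_div_gt (a * b) scale s0.
move: scale s0 => s s0 h1 h2; apply/andP; split; apply: ZR_le; lia.
Qed.

Lemma Zdiv_bounds a c : (0 < c)%Z -> ZR a - ZR c <= ZR c * ZR (a / c)%Z <= ZR a.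
Proof.
move=> c0; rewrite -!ZRM -ZRB.
have := Z.mul_div_le a c c0; have := Z.mul_succ_div_gt a c c0.
by move=> h1 h2; apply/andP; split; apply: ZR_le; lia.
Qed.

#[local] Opaque scale.

(** ** The sine *)
(** The Horner scheme 1 - t / c1 * (1 - t / c2 * ...) of the Taylor polynomial of sin x / x at
    t = x ^ 2, in fixed point. *)
Fixpoint horner_fx cs t : Z :=
  if cs is c :: cs' then (scale - fxmul t (horner_fx cs' t) / c)%Z else scale.

Fixpoint horner_real cs (tau : R) : R :=
  if cs is c :: cs' then 1 - tau / ZR c * horner_real cs' tau else 1.

(** The quotients of successive odd factorials. *)
Definition sine_coef (k : nat) : Z := ((2 * Z.of_nat k + 2) * (2 * Z.of_nat k + 3))%Z.

Lemma sin_taylor_horner n (x : R) :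
  (sin_taylor n.+1).[x] = x * horner_real [seq sine_coef k | k <- iota 0 n] (x ^+ 2).
Proof.
pose T j n (tau : R) := \sum_(i < n) (-1) ^+ i * ((j.*2.+1)`!%:R / ((j + i).*2.+1)`!%:R) * tau ^+ i.
have key tau m : forall j, T j m.+1 tau = horner_real [seq sine_coef k | k <- iota j m] tau.
  elim: m => [|m IH] j.
    by rewrite /T big_ord1 addn0 !expr0 mul1r divff ?mulr1// pnatr_eq0 -lt0n fact_gt0.
  rewrite /= -IH /T big_ord_recl addn0 !expr0 mul1r mulr1 divff; last by rewrite pnatr_eq0 -lt0n fact_gt0.
  congr (_ + _); rewrite mulr_sumr -sumrN; apply: eq_bigr => i _.
  rewrite !lift0 addnS addSn.
  have -> : ZR (sine_coef j) = (j.*2.+3)%:R * (j.*2.+2)%:R.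
    rewrite -natrM -ZR_nat; congr (ZR _); rewrite /sine_coef; lia.
  have -> : (j.+1.*2.+1)`!%:R = (j.*2.+3)%:R * ((j.*2.+2)%:R * (j.*2.+1)`!%:R) :> R.
    by rewrite doubleS factS natrM factS natrM.
  rewrite !exprS; have f0 : ((j + i).+1.*2.+1)`!%:R != 0 :> R by rewrite pnatr_eq0 -lt0n fact_gt0.
  have a0 : (j.*2.+3)%:R != 0 :> R by rewrite pnatr_eq0.
  have b0 : (j.*2.+2)%:R != 0 :> R by rewrite pnatr_eq0.
  move: (((j + i).+1.*2.+1)`!%:R : R) f0 ((j.*2.+1)`!%:R : R) => f f0 C.
  move: ((j.*2.+3)%:R : R) a0 ((j.*2.+2)%:R : R) b0 => A a0 B b0.
  by field; rewrite f0 a0 b0.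
rewrite -key /T /sin_taylor horner_sum mulr_sumr; apply: eq_bigr => i _.
rewrite hornerZ hornerXn add0n -exprM mul2n [in LHS]exprS mul1r; ring.
Qed.

Definition sine_coefs : seq Z := [:: 6; 20; 42; 72; 110; 156; 210; 272; 342; 420; 506; 600; 702]%Z.

(** The error of t against s * tau, times the value, and tau times the error of the
    value. *)
Lemma fixed_point_product (s t h q tau p : R) : 100 <= s -> 0 <= tau <= 16 ->
  0 <= q <= 1 -> `|h - s * q| <= 6 -> s * tau - 1 <= t <= s * tau ->
  t * h - s <= s * p <= t * h -> s * tau * q - 99 <= p <= s * tau * q + 98.
Proof.
move=> s100 /andP[tau0 tau1] /andP[q0 q1] + /andP[t1 t2] /andP[p1 p2].
rewrite ler_norml => /andP[e1 e2]; have s0 : 0 < s by lra.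
have sq : s * q <= s by rewrite ler_piMr//; lra.
have sq0 : 0 <= s * q by rewrite mulr_ge0//; lra.
have ts : s * tau <= s * 16 by rewrite ler_pM2l.
have ts0 : 0 <= s * tau by rewrite mulr_ge0//; lra.
have n1 : `|(t - s * tau) * h| <= 1 * (2 * s).
  by rewrite normrM; apply: ler_pM => //; rewrite ler_norml; apply/andP; split; lra.
have n2 : `|s * tau * (h - s * q)| <= s * 16 * 6.
  by rewrite normrM; apply: ler_pM => //; rewrite ?ler_norml; apply/andP; split; lra.
have e : t * h = s * (s * tau * q) + ((t - s * tau) * h + s * tau * (h - s * q)) by ring.
move: n1 n2 e; rewrite !ler_norml.
move: ((t - _) * h) (s * tau * (h - _)) => A B /andP[a1 a2] /andP[b1 b2] e.
rewrite -(ler_pM2l s0) -[p <= _](ler_pM2l s0) mulrBr mulrDr.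
by apply/andP; split; lra.
Qed.

(** From the second coefficient on, t <= 16 is smaller than the divisor, so an error of 6 units is
    divided by more than it is multiplied and, rounding included, does not grow. *)
Lemma horner_fx_tail cs t (tau : R) : all (Z.leb 20) cs -> 0 <= tau <= 16 ->
  S * tau - 1 <= ZR t <= S * tau ->
  0 <= horner_real cs tau <= 1 /\ `|ZR (horner_fx cs t) - S * horner_real cs tau| <= 6.
Proof.
move=> + /andP[tau0 tau1]; have S100 := scale_ge.
have [s sE] : exists s : R, s = S by exists S.
rewrite -!sE in S100 * => hcs /andP[t1 t2].
elim: cs hcs => [_|c cs IH /= /andP[c20 /IH[/andP[q0 q1] e]]].
  by rewrite /= -sE lexx ler01 mulr1 subrr normr0.
have cpos : (0 < c)%Z by lia.
have {}c20 : 20 <= ZR c by rewrite -ZR20; apply: ZR_le; lia.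
set q := horner_real cs tau in q0 q1 e *; set h := horner_fx cs t in e *.
have /andP[m1 m2] := fxmul_bounds t h; set mm := fxmul t h in m1 m2 *.
rewrite -!sE in m1 m2.
have /andP[d1 d2] := Zdiv_bounds mm cpos; rewrite ZRB -sE; set dd := (mm / c)%Z in d1 d2 *.
have tc0 : 0 <= tau / ZR c by rewrite divr_ge0//; lra.
have tc1 : tau / ZR c <= 1 by rewrite ler_pdivrMr; lra.
split.
  have h1 : tau / ZR c * q <= 1 * 1 by apply: ler_pM.
  have h2 : 0 <= tau / ZR c * q by apply: mulr_ge0.
  by apply/andP; split; lra.
move: e; rewrite ler_norml => /andP[e1 e2].
have -> : s - ZR dd - s * (1 - tau / ZR c * q) = (s * tau * q - ZR c * ZR dd) / ZR c.
  by field; apply/eqP => c00; lra.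
rewrite normrM normfV (@ger0_norm _ (ZR c)); last by lra.
rewrite ler_pdivrMr; last by lra.
have /andP[g1 g2] : s * tau * q - 99 <= ZR mm <= s * tau * q + 98.
  by apply: (@fixed_point_product s (ZR t) (ZR h) q tau); rewrite ?tau0 ?q0 ?t1 ?m1 ?ler_norml ?e1.
by rewrite ler_norml; apply/andP; split; lra.
Qed.

Fixpoint Zprod cs : Z := if cs is c :: cs' then (c * Zprod cs')%Z else 1%Z.

(** One more coefficient changes the value by at most the last term of the series. *)
Lemma horner_real_rcons cs c (tau : R) : 0 <= tau <= 16 -> all (Z.leb 1) (rcons cs c) ->
  `|horner_real (rcons cs c) tau - horner_real cs tau| * ZR (Zprod (rcons cs c)) <= 16 ^+ (size cs).+1.
Proof.
move=> /andP[t0 t1]; have pos a : Z.leb 1 a -> 0 < ZR a.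
  by move=> a1; rewrite -ZR0; apply: ZR_lt; lia.
have prod_pos : forall l, all (Z.leb 1) l -> 0 < ZR (Zprod l).
  by elim=> [_|a l IH /= /andP[/pos a1 /IH l1]]; rewrite ?ZRM ?mulr_gt0// ZR1 ltr01.
elim: cs => [|a cs IH] /=.
  rewrite andbT => /pos c0; rewrite ZRM ZR1 expr1 !mulr1 (_ : 1 - tau / ZR c - 1 = - (tau / ZR c)); last by ring.
  by rewrite normrN ger0_norm ?divr_ge0 ?(ltW c0)// divfK ?gt_eqF.
move=> /andP[a1 al]; have a0 := pos _ a1.
set X := horner_real (rcons cs c) tau in IH *; set Y := horner_real cs tau in IH *.
have -> : 1 - tau / ZR a * X - (1 - tau / ZR a * Y) = - (tau / ZR a * (X - Y)) by ring.
rewrite normrN normrM ger0_norm ?divr_ge0 ?(ltW a0)// ZRM.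
have -> : tau / ZR a * `|X - Y| * (ZR a * ZR (Zprod (rcons cs c))) = tau * (`|X - Y| * ZR (Zprod (rcons cs c))).
  by field; rewrite gt_eqF.
rewrite exprS; apply: ler_pM => //; last exact: IH.
by rewrite mulr_ge0// ltW// prod_pos.
Qed.

(** The offset 72 makes the value a lower bound. *)
Definition sine_fx x : Z := (fxmul x (horner_fx sine_coefs (fxmul x x)) - 72)%Z.

(** Rounding costs at most 72 units on each side; the first omitted term of the Taylor series is
    below 10 units for x <= 4. *)
Lemma sine_fx_bounds x : 0 <= ZR x / S <= 4 ->
  ZR (sine_fx x) <= S * sin (ZR x / S) <= ZR (sine_fx x) + 160.
Proof.
have S100 := scale_ge; have [s sE] : exists s : R, s = S by exists S.
rewrite -!sE in S100 * => /andP[X0 X4]; have s0 : 0 < s by lra.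
set X := ZR x / s in X0 X4 *; have xE : ZR x = s * X by rewrite /X mulrC divfK ?gt_eqF.
move: X X0 X4 xE => X X0 X4 xE.
have tau01 : 0 <= X ^+ 2 <= 16.
  rewrite sqr_ge0/= expr2 (_ : 16 = 4 * 4); last by rewrite -natrM.
  by apply: ler_pM.
rewrite /sine_fx; have := fxmul_bounds x x; set t := fxmul x x.
rewrite -!sE xE => /andP[t1 t2].
have ht : s * X ^+ 2 - 1 <= ZR t <= s * X ^+ 2.
  rewrite -(ler_pM2l s0) -[_ <= s * X ^+ 2](ler_pM2l s0).
  have e1 : s * (s * X ^+ 2 - 1) = s * X * (s * X) - s by ring.
  have e2 : s * (s * X ^+ 2) = s * X * (s * X) by ring.
  by rewrite e1 e2 t1.
have [|/andP[q0 q1] e] := @horner_fx_tail (behead sine_coefs) t _ isT tau01.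
  by rewrite -!sE.
have -> : horner_fx sine_coefs t = (scale - fxmul t (horner_fx (behead sine_coefs) t) / 6)%Z by [].
have rE : horner_real sine_coefs (X ^+ 2) =
    1 - X ^+ 2 / 6 * horner_real (behead sine_coefs) (X ^+ 2).
  by rewrite /sine_coefs /= ZR6.
move: (horner_fx _ t) (horner_real (behead _) _) q0 q1 e rE => h q q0 q1 e rE.
have := fxmul_bounds t h; set mm := fxmul t h; rewrite -!sE => /andP[m1 m2].
have := @Zdiv_bounds mm 6 erefl; set dd := (mm / 6)%Z; rewrite ZR6 => /andP[d1 d2].
set H := (scale - dd)%Z.
have HE : ZR H = s - ZR dd by rewrite ZRB -sE.
have := fxmul_bounds x H; set y := fxmul x H; rewrite -!sE HE xE => /andP[y1 y2].
have /andP[g1 g2] : s * X ^+ 2 * q - 99 <= ZR mm <= s * X ^+ 2 * q + 98.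
  by apply: (@fixed_point_product s (ZR t) (ZR h) q (X ^+ 2)); rewrite ?q0 ?m1// sE.
rewrite ZRB (_ : ZR 72 = 72); last by rewrite ZR_num.
set Q := horner_real sine_coefs (X ^+ 2) in rE.
have sQ : s * Q = s - s * X ^+ 2 * q / 6 by rewrite rE; field.
have HQ : `|(s - ZR dd) - s * Q| <= 18 by rewrite ler_norml sQ; apply/andP; split; lra.
have XHQ : `|X * ((s - ZR dd) - s * Q)| <= 4 * 18.
  by rewrite normrM (ger0_norm X0); apply: ler_pM.
have s14 : X * Q <= sin X.
  by have := sin_taylor_le 6 X0; rewrite sin_taylor_horner.
have s15 : sin X <= X * horner_real (rcons sine_coefs 812) (X ^+ 2).
  by have := sin_taylor_ge 7 X0; rewrite sin_taylor_horner.
have rem : s * (X * (horner_real (rcons sine_coefs 812) (X ^+ 2) - Q)) <= 10.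
  have := @horner_real_rcons sine_coefs 812 _ tau01 isT; rewrite -/Q.
  set P := Zprod _; set D := horner_real _ _ - Q => hP.
  have P0 : 0 < ZR P by rewrite -ZR0; apply: ZR_lt.
  have chk : s * 4 * 16 ^+ 14 <= 10 * ZR P.
    have -> : s * 4 * 16 ^+ 14 = ZR (scale * (4 * (16 ^ 14)))%Z.
      rewrite ZRM -sE -mulrA; congr (s * _); rewrite ZRM; congr (_ * _); first by rewrite ZR_num.
      have -> : (16 ^ 14)%Z = (2 ^ Z.of_nat 56)%Z by [].
      have -> : 16 = 2 ^+ 4 :> R by rewrite -natrX.
      by rewrite ZRX2 -exprM.
    have -> : 10 * ZR P = ZR (10 * P)%Z by rewrite ZRM ZR_num.
    by apply: ZR_le; apply: Zle_bool_imp_le; vm_compute.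
  have XD : s * (X * D) <= s * (4 * `|D|).
    rewrite ler_pM2l//; apply: (@le_trans _ _ (X * `|D|)).
      by rewrite ler_wpM2l// ler_norm.
    by rewrite ler_wpM2r.
  apply: (le_trans XD); rewrite -(ler_pM2r P0).
  have : s * 4 * (`|D| * ZR P) <= s * 4 * 16 ^+ 14 by rewrite ler_wpM2l// mulr_ge0// ltW.
  by move: chk; move: (16 ^+ 14) => K chk hK; lra.
have m14 : s * (X * Q) <= s * sin X by rewrite ler_pM2l.
have m15 : s * sin X <= s * (X * horner_real (rcons sine_coefs 812) (X ^+ 2)) by rewrite ler_pM2l.
have [l1 l2] : X * (s - ZR dd) - 1 <= ZR y /\ ZR y <= X * (s - ZR dd).
  by split; rewrite -(ler_pM2l s0); lra.
move: XHQ; rewrite ler_norml => /andP[x1 x2].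
by apply/andP; split; lra.
Qed.

End FixedPoint.

(** * Quadrature sums *)
Section Sums.
Context {R : realType}.
Implicit Types (i E x y z : Z) (xs : seq Z) (d v : R) (p k n : nat).
Local Notation ZR := (@ZR R).
Local Notation S := (ZR scale).

(** One doubling of the argument of psi, rounded down. *)
Definition step x : Z := Z.max 0 (x + sine_fx x).

Definition encloses E v x : Prop := (0 <= x)%Z /\ ZR x <= S * psi v <= ZR x + ZR E.

Lemma scale_gt0 : 0 < S.
Proof. by have := @scale_ge R; lra. Qed.

(** The doubling map is increasing with slope at most 2, so the error doubles; the sine adds 160. *)
Lemma encloses_step E v x : 0 <= v -> encloses E v x ->
  encloses (2 * E + 160) (2 * v) (step x).
Proof.
move=> v0 [x0 /andP[l u]]; have s0 := scale_gt0.
have X0 : 0 <= ZR x / S by rewrite divr_ge0 ?ZR_ge0// ltW.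
have Xpsi : ZR x / S <= psi v by rewrite ler_pdivrMr// mulrC.
have p4 : (pi : R) < 4 by have := @pihalf_lt2 R; lra.
have X4 : ZR x / S <= 4 by have := @psi_lt_pi R v; lra.
have /andP[b1 b2] := @sine_fx_bounds R x (introT andP (conj X0 X4)).
have xE : ZR x = S * (ZR x / S) by rewrite mulrC divfK ?gt_eqF.
have h1 := hmap_nondecreasing Xpsi; have h2 := hmap_lipschitz Xpsi.
have psi2 : psi (2 * v) = hmap (psi v) by rewrite psi_double.
have hx : ZR x + ZR (sine_fx x) <= S * hmap (ZR x / S) <= ZR x + ZR (sine_fx x) + 160.
  by rewrite /hmap mulrDr -xE; apply/andP; split; lra.
case/andP: hx => hx1 hx2.
have low : ZR x + ZR (sine_fx x) <= S * psi (2 * v).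
  by apply: (le_trans hx1); rewrite psi2 ler_pM2l.
have up : S * psi (2 * v) <= ZR x + ZR (sine_fx x) + (2 * ZR E + 160).
  have : S * (hmap (psi v) - hmap (ZR x / S)) <= S * (2 * (psi v - ZR x / S)) by rewrite ler_pM2l.
  have : S * (2 * (psi v - ZR x / S)) = 2 * (S * psi v - ZR x) by rewrite {2}xE; ring.
  by rewrite psi2; lra.
have e : ZR (2 * E + 160)%Z = 2 * ZR E + 160.
  have e2 : ZR 2 = 2 by rewrite ZR_num.
  have e160 : ZR 160 = 160 by rewrite ZR_num.
  by rewrite ZRD ZRM e2 e160.
split; first exact: Z.le_max_l.
rewrite e /step; case: (Z.max_spec 0 (x + sine_fx x)%Z) => -[h ->].
  by rewrite ZRD low up.
have p0 : 0 <= S * psi (2 * v) by rewrite mulr_ge0 ?psi_ge0 ?mulr_ge0// ltW.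
rewrite ZR0 p0/=; have : ZR (x + sine_fx x)%Z <= 0 by rewrite -ZR0; exact: ZR_le.
by rewrite ZRD; lra.
Qed.

Lemma encloses_iter E v x n : 0 <= v -> encloses E v x ->
  exists E', encloses E' (2 ^+ n * v) (iter n step x).
Proof.
move=> v0 h; elim: n => [|n [E' IH]]; first by exists E; rewrite expr0 mul1r.
exists (2 * E' + 160)%Z; rewrite exprS -mulrA iterS.
by apply: encloses_step IH; rewrite mulr_ge0// exprn_ge0.
Qed.

Fixpoint enclosed E d i xs : Prop :=
  if xs is x :: xs' then encloses E (d * ZR i) x /\ enclosed E d (i + 1) xs' else True.

Lemma enclosed_step E d i xs : 0 <= d -> (0 <= i)%Z -> enclosed E d i xs ->
  enclosed (2 * E + 160) (2 * d) i [seq step x | x <- xs].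
Proof.
move=> d0; elim: xs i => [//|x xs IH] i i0 /= [h1 h2]; split; last by apply: IH => //; lia.
by rewrite -mulrA; apply: encloses_step => //; rewrite mulr_ge0// ZR_ge0.
Qed.

(** By partial integration this is the integral of psi against the derivative of v ^ p; it is
    additive over cells, and only the values of psi at the cell ends have to be computed.
    Lower bounds come from wmoment_chebyshev, upper bounds from wmoment_midpoint. *)
Definition parts p (a b : R) : R :=
  b ^+ p * psi b - a ^+ p * psi a - (wmoment p b - wmoment p a).

Lemma parts_cat p a b c : parts p a b + parts p b c = parts p a c.
Proof. by rewrite /parts; lra. Qed.

(** In units of the mesh d, and with psi scaled: 5 / d ^ 4 times the lower bound for parts 4,
    summed over the cells [i, i + 1]. *)
Fixpoint lower_sum4 i xs : Z :=
  if xs is x :: xs' then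
    if xs' is y :: _ then
      ((10 * (i * i * i) + 20 * (i * i) + 15 * i + 4) * y +
       (10 * (i * i * i) + 10 * (i * i) + 5 * i + 1) * x + lower_sum4 (i + 1) xs')%Z
    else 0%Z
  else 0%Z.

(** As lower_sum4, with 3 / d ^ 2 times the bound for parts 2. *)
Fixpoint lower_sum2 i xs : Z :=
  if xs is x :: xs' then
    if xs' is y :: _ then
      ((3 * i + 2) * y + (3 * i + 1) * x + lower_sum2 (i + 1) xs')%Z
    else 0%Z
  else 0%Z.

(** Cells have two steps here, centred at m = i + 1. *)
Fixpoint upper_sum4 E i xs : Z :=
  if xs is x :: xs1 then
    if xs1 is y :: xs2 then
      if xs2 is z :: _ then
        let m := (i + 1)%Z in
        ((6 * (m * m) + 4 * m + 1) * (z + E) - (6 * (m * m) - 4 * m + 1) * x +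
         8 * (m * m * m) * (y + E) + upper_sum4 E (i + 2) xs2)%Z
      else 0%Z
    else 0%Z
  else 0%Z.

Fixpoint upper_sum2 E i xs : Z :=
  if xs is x :: xs1 then
    if xs1 is y :: xs2 then
      if xs2 is z :: _ then
        (z + E - x + 4 * (i + 1) * (y + E) + upper_sum2 E (i + 2) xs2)%Z
      else 0%Z
    else 0%Z
  else 0%Z.

Let Z2 : ZR 2 = 2. Proof. by rewrite ZR_num. Qed.
Let Z3 : ZR 3 = 3. Proof. by rewrite ZR_num. Qed.
Let Z4 : ZR 4 = 4. Proof. by rewrite ZR_num. Qed.
Let Z5 : ZR 5 = 5. Proof. by rewrite ZR_num. Qed.
Let Z8 : ZR 8 = 8. Proof. by rewrite ZR_num. Qed.
Let Z10 : ZR 10 = 10. Proof. by rewrite ZR_num. Qed.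
Let Z15 : ZR 15 = 15. Proof. by rewrite ZR_num. Qed.
Let ZRE := (Z2, Z3, Z4, Z5, @ZR6 R, Z8, Z10, Z15, @ZR16 R, @ZR20 R, @ZR1 R, @ZR0 R, @ZRB R, @ZRD R, @ZRM R).

Let scale_lower (s u1 u2 p q P Q : R) : 0 <= u1 -> 0 <= u2 -> P <= s * p -> Q <= s * q ->
  u1 * P + u2 * Q <= s * (u1 * p + u2 * q).
Proof.
move=> a1 a2 h1 h2; have := ler_wpM2l a1 h1; have := ler_wpM2l a2 h2; lra.
Qed.

Let scale_upper (s u1 u2 u3 p q r P Q T : R) : 0 <= u1 -> 0 <= u2 -> 0 <= u3 ->
  s * p <= P -> Q <= s * q -> s * r <= T ->
  s * (u1 * p - u2 * q + u3 * r) <= u1 * P - u2 * Q + u3 * T.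
Proof.
move=> a1 a2 a3 h1 h2 h3.
by have := ler_wpM2l a1 h1; have := ler_wpM2l a2 h2; have := ler_wpM2l a3 h3; lra.
Qed.

Lemma parts4_lower d i x y E : 0 < d -> (0 <= i)%Z ->
  encloses E (d * ZR i) x -> encloses E (d * (ZR i + 1)) y ->
  d ^+ 4 * ((10 * ZR i ^+ 3 + 20 * ZR i ^+ 2 + 15 * ZR i + 4) * ZR y +
     (10 * ZR i ^+ 3 + 10 * ZR i ^+ 2 + 5 * ZR i + 1) * ZR x)
  <= 5 * S * parts 4 (d * ZR i) (d * (ZR i + 1)).
Proof.
move=> d0 /(@ZR_ge0 R) i0 [_ /andP[x1 _]] [_ /andP[y1 _]]; have s0 := scale_gt0.
move: (ZR i) i0 x1 y1 => I i0; set a := d * I; set b := d * (I + 1) => x1 y1.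
have ab : a <= b by rewrite ler_pM2l// lerDl.
have a0 : 0 <= a by rewrite mulr_ge0// ltW.
have h := wmoment_chebyshev 4 a0 ab.
have {}h : 5 * (wmoment 4 b - wmoment 4 a) <=
    d ^+ 4 * (5 * I ^+ 4 + 10 * I ^+ 3 + 10 * I ^+ 2 + 5 * I + 1) * (psi b - psi a).
  rewrite -(ler_pM2l d0); apply: le_trans (_ : _ <= (b ^+ 5 - a ^+ 5) * (psi b - psi a)) _.
    by apply: le_trans h; rewrite (_ : b - a = d) ?mulrA ?[d * 5]mulrC// /b /a; ring.
  by rewrite (_ : b ^+ 5 - a ^+ 5 = d * (d ^+ 4 * (5 * I ^+ 4 + 10 * I ^+ 3 + 10 * I ^+ 2 + 5 * I + 1))) ?mulrA// /a /b; ring.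
have c1 : 0 <= 10 * I ^+ 3 + 20 * I ^+ 2 + 15 * I + 4 by rewrite !addr_ge0 ?mulr_ge0 ?exprn_ge0.
have c2 : 0 <= 10 * I ^+ 3 + 10 * I ^+ 2 + 5 * I + 1 by rewrite !addr_ge0 ?mulr_ge0 ?exprn_ge0.
have h5 : d ^+ 4 * ((10 * I ^+ 3 + 20 * I ^+ 2 + 15 * I + 4) * psi b +
     (10 * I ^+ 3 + 10 * I ^+ 2 + 5 * I + 1) * psi a) <= 5 * parts 4 a b.
  have e : 5 * parts 4 a b = d ^+ 4 * ((10 * I ^+ 3 + 20 * I ^+ 2 + 15 * I + 4) * psi b +
     (10 * I ^+ 3 + 10 * I ^+ 2 + 5 * I + 1) * psi a) +
    (d ^+ 4 * (5 * I ^+ 4 + 10 * I ^+ 3 + 10 * I ^+ 2 + 5 * I + 1) * (psi b - psi a)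
      - 5 * (wmoment 4 b - wmoment 4 a)).
    rewrite /parts; move: (psi a) (psi b) (wmoment 4 a) (wmoment 4 b) => pa pb wa wb.
    by rewrite /a /b; ring.
  by rewrite e lerDl subr_ge0.
apply: (@le_trans _ _ (S * (d ^+ 4 * ((10 * I ^+ 3 + 20 * I ^+ 2 + 15 * I + 4) * psi b +
     (10 * I ^+ 3 + 10 * I ^+ 2 + 5 * I + 1) * psi a)))); last first.
  by rewrite (_ : 5 * S * parts 4 a b = S * (5 * parts 4 a b)) ?ler_pM2l//; ring.
rewrite [leRHS]mulrCA; apply: ler_wpM2l; first exact/exprn_ge0/ltW.
exact: scale_lower.
Qed.

Lemma parts2_lower d i x y E : 0 < d -> (0 <= i)%Z ->
  encloses E (d * ZR i) x -> encloses E (d * (ZR i + 1)) y ->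
  d ^+ 2 * ((3 * ZR i + 2) * ZR y + (3 * ZR i + 1) * ZR x)
  <= 3 * S * parts 2 (d * ZR i) (d * (ZR i + 1)).
Proof.
move=> d0 /(@ZR_ge0 R) i0 [_ /andP[x1 _]] [_ /andP[y1 _]]; have s0 := scale_gt0.
move: (ZR i) i0 x1 y1 => I i0; set a := d * I; set b := d * (I + 1) => x1 y1.
have ab : a <= b by rewrite ler_pM2l// lerDl.
have a0 : 0 <= a by rewrite mulr_ge0// ltW.
have h := wmoment_chebyshev 2 a0 ab.
have {}h : 3 * (wmoment 2 b - wmoment 2 a) <=
    d ^+ 2 * (3 * I ^+ 2 + 3 * I + 1) * (psi b - psi a).
  rewrite -(ler_pM2l d0); apply: le_trans (_ : _ <= (b ^+ 3 - a ^+ 3) * (psi b - psi a)) _.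
    by apply: le_trans h; rewrite (_ : b - a = d) ?mulrA ?[d * 3]mulrC// /b /a; ring.
  by rewrite (_ : b ^+ 3 - a ^+ 3 = d * (d ^+ 2 * (3 * I ^+ 2 + 3 * I + 1))) ?mulrA// /a /b; ring.
have c1 : 0 <= 3 * I + 2 by rewrite !addr_ge0 ?mulr_ge0.
have c2 : 0 <= 3 * I + 1 by rewrite !addr_ge0 ?mulr_ge0.
have h5 : d ^+ 2 * ((3 * I + 2) * psi b + (3 * I + 1) * psi a) <= 3 * parts 2 a b.
  have e : 3 * parts 2 a b = d ^+ 2 * ((3 * I + 2) * psi b + (3 * I + 1) * psi a) +
    (d ^+ 2 * (3 * I ^+ 2 + 3 * I + 1) * (psi b - psi a) - 3 * (wmoment 2 b - wmoment 2 a)).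
    rewrite /parts; move: (psi a) (psi b) (wmoment 2 a) (wmoment 2 b) => pa pb wa wb.
    by rewrite /a /b; ring.
  by rewrite e lerDl subr_ge0.
apply: (@le_trans _ _ (S * (d ^+ 2 * ((3 * I + 2) * psi b + (3 * I + 1) * psi a)))); last first.
  by rewrite (_ : 3 * S * parts 2 a b = S * (3 * parts 2 a b)) ?ler_pM2l//; ring.
rewrite [leRHS]mulrCA; apply: ler_wpM2l; first exact/exprn_ge0/ltW.
exact: scale_lower.
Qed.

Lemma parts4_upper d i x y z E : 0 < d -> (0 <= i)%Z ->
  encloses E (d * ZR i) x -> encloses E (d * (ZR i + 1)) y ->
  encloses E (d * (ZR i + 2)) z ->
  S * parts 4 (d * ZR i) (d * (ZR i + 2)) <=
  d ^+ 4 * ((6 * (ZR i + 1) ^+ 2 + 4 * (ZR i + 1) + 1) * (ZR z + ZR E)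
     - (6 * (ZR i + 1) ^+ 2 - 4 * (ZR i + 1) + 1) * ZR x + 8 * (ZR i + 1) ^+ 3 * (ZR y + ZR E)).
Proof.
move=> d0 /(@ZR_ge0 R) i0 [_ /andP[x1 _]] [_ /andP[_ y2]] [_ /andP[_ z2]]; have s0 := scale_gt0.
move: (ZR i) i0 x1 y2 z2 => I i0.
have [M ME] : exists M, M = I + 1 by eexists.
have -> : d * I = d * M - d by rewrite ME; ring.
have -> : d * (I + 2) = d * M + d by rewrite ME; ring.
rewrite -ME; set m := d * M => x1 y2 z2.
have dm : d <= m by rewrite /m ler_peMr//; lra.
have h := wmoment_midpoint 3 (ltW d0) dm.
have c1 : 0 <= 6 * M ^+ 2 + 4 * M + 1 by rewrite !addr_ge0 ?mulr_ge0 ?exprn_ge0; lra.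
have c2 : 0 <= 6 * M ^+ 2 - 4 * M + 1.
  have : 0 <= (M - 1) ^+ 2 by exact: sqr_ge0.
  by have : 0 <= M ^+ 2 by [exact: sqr_ge0]; lra.
have c3 : 0 <= 8 * M ^+ 3 by rewrite mulr_ge0// exprn_ge0; lra.
have h5 : parts 4 (m - d) (m + d) <= d ^+ 4 * ((6 * M ^+ 2 + 4 * M + 1) * psi (m + d)
    - (6 * M ^+ 2 - 4 * M + 1) * psi (m - d) + 8 * M ^+ 3 * psi m).
  rewrite /parts; move: h.
  move: (psi (m - d)) (psi m) (psi (m + d)) (wmoment 4 (m - d)) (wmoment 4 (m + d)) => pa pm pb wa wb.
  have -> : m ^+ 4 * (pb - pa) + 4%:R * m ^+ 3 * d * (pb - 2 * pm + pa) =
    (m + d) ^+ 4 * pb - (m - d) ^+ 4 * pa - d ^+ 4 * ((6 * M ^+ 2 + 4 * M + 1) * pb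
    - (6 * M ^+ 2 - 4 * M + 1) * pa + 8 * M ^+ 3 * pm) by rewrite /m; ring.
  by lra.
apply: (@le_trans _ _ (S * (d ^+ 4 * ((6 * M ^+ 2 + 4 * M + 1) * psi (m + d)
    - (6 * M ^+ 2 - 4 * M + 1) * psi (m - d) + 8 * M ^+ 3 * psi m)))); first by rewrite ler_pM2l.
rewrite mulrCA; apply: ler_wpM2l; first exact/exprn_ge0/ltW.
exact: scale_upper.
Qed.

Lemma parts2_upper d i x y z E : 0 < d -> (0 <= i)%Z ->
  encloses E (d * ZR i) x -> encloses E (d * (ZR i + 1)) y ->
  encloses E (d * (ZR i + 2)) z ->
  S * parts 2 (d * ZR i) (d * (ZR i + 2)) <=
  d ^+ 2 * (ZR z + ZR E - ZR x + 4 * (ZR i + 1) * (ZR y + ZR E)).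
Proof.
move=> d0 /(@ZR_ge0 R) i0 [_ /andP[x1 _]] [_ /andP[_ y2]] [_ /andP[_ z2]]; have s0 := scale_gt0.
move: (ZR i) i0 x1 y2 z2 => I i0.
have [M ME] : exists M, M = I + 1 by eexists.
have -> : d * I = d * M - d by rewrite ME; ring.
have -> : d * (I + 2) = d * M + d by rewrite ME; ring.
rewrite -ME; set m := d * M => x1 y2 z2.
have dm : d <= m by rewrite /m ler_peMr//; lra.
have h := wmoment_midpoint 1 (ltW d0) dm.
have c3 : 0 <= 4 * M by lra.
have h5 : parts 2 (m - d) (m + d) <= d ^+ 2 * (psi (m + d) - psi (m - d) + 4 * M * psi m).
  rewrite /parts; move: h.
  move: (psi (m - d)) (psi m) (psi (m + d)) (wmoment 2 (m - d)) (wmoment 2 (m + d)) => pa pm pb wa wb.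
  have -> : m ^+ 2 * (pb - pa) + 2%:R * m ^+ 1 * d * (pb - 2 * pm + pa) =
    (m + d) ^+ 2 * pb - (m - d) ^+ 2 * pa - d ^+ 2 * (pb - pa + 4 * M * pm) by rewrite /m; ring.
  by lra.
apply: (@le_trans _ _ (S * (d ^+ 2 * (psi (m + d) - psi (m - d) + 4 * M * psi m)))); first by rewrite ler_pM2l.
rewrite mulrCA; apply: ler_wpM2l; first exact/exprn_ge0/ltW.
by have := @scale_upper S 1 1 (4 * M) _ _ _ _ _ _ ler01 ler01 c3 z2 x1 y2; rewrite !mul1r.
Qed.

Lemma lower_sum4_cons i x y xs : ZR (lower_sum4 i (x :: y :: xs)) =
  (10 * ZR i ^+ 3 + 20 * ZR i ^+ 2 + 15 * ZR i + 4) * ZR y +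
  (10 * ZR i ^+ 3 + 10 * ZR i ^+ 2 + 5 * ZR i + 1) * ZR x + ZR (lower_sum4 (i + 1) (y :: xs)).
Proof.
rewrite -[lower_sum4 i _]/((10 * (i * i * i) + 20 * (i * i) + 15 * i + 4) * y +
       (10 * (i * i * i) + 10 * (i * i) + 5 * i + 1) * x + lower_sum4 (i + 1) (y :: xs))%Z.
by move: (lower_sum4 _ _) => L; rewrite !ZRE; ring.
Qed.

Lemma lower_sum2_cons i x y xs : ZR (lower_sum2 i (x :: y :: xs)) =
  (3 * ZR i + 2) * ZR y + (3 * ZR i + 1) * ZR x + ZR (lower_sum2 (i + 1) (y :: xs)).
Proof.
rewrite -[lower_sum2 i _]/((3 * i + 2) * y + (3 * i + 1) * x + lower_sum2 (i + 1) (y :: xs))%Z.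
by move: (lower_sum2 _ _) => L; rewrite !ZRE.
Qed.

Lemma upper_sum4_cons E i x y z xs : ZR (upper_sum4 E i (x :: y :: z :: xs)) =
  (6 * (ZR i + 1) ^+ 2 + 4 * (ZR i + 1) + 1) * (ZR z + ZR E)
  - (6 * (ZR i + 1) ^+ 2 - 4 * (ZR i + 1) + 1) * ZR x + 8 * (ZR i + 1) ^+ 3 * (ZR y + ZR E)
  + ZR (upper_sum4 E (i + 2) (z :: xs)).
Proof.
rewrite -[upper_sum4 E i _]/((6 * ((i + 1) * (i + 1)) + 4 * (i + 1) + 1) * (z + E)
  - (6 * ((i + 1) * (i + 1)) - 4 * (i + 1) + 1) * x + 8 * ((i + 1) * (i + 1) * (i + 1)) * (y + E)
  + upper_sum4 E (i + 2) (z :: xs))%Z.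
by move: (upper_sum4 _ _ _) => L; rewrite !ZRE; ring.
Qed.

Lemma upper_sum2_cons E i x y z xs : ZR (upper_sum2 E i (x :: y :: z :: xs)) =
  ZR z + ZR E - ZR x + 4 * (ZR i + 1) * (ZR y + ZR E) + ZR (upper_sum2 E (i + 2) (z :: xs)).
Proof.
rewrite -[upper_sum2 E i _]/(z + E - x + 4 * (i + 1) * (y + E) + upper_sum2 E (i + 2) (z :: xs))%Z.
by move: (upper_sum2 _ _ _) => L; rewrite !ZRE.
Qed.

Lemma parts_refl p a : parts p a a = 0.
Proof. by rewrite /parts !subrr. Qed.

Lemma lower_sum4P E d xs x i : 0 < d -> (0 <= i)%Z -> enclosed E d i (x :: xs) ->
  d ^+ 4 * ZR (lower_sum4 i (x :: xs)) <= 5 * S * parts 4 (d * ZR i) (d * (ZR i + (size xs)%:R)).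
Proof.
move=> d0; elim: xs x i => [|y xs IH] x i i0; first by rewrite /= ZR0 addr0 parts_refl !mulr0.
move=> [hx hxs]; have i10 : (0 <= i + 1)%Z by lia.
have h2 := IH y (i + 1)%Z i10 hxs; case: hxs => hy _.
have iE : ZR (i + 1)%Z = ZR i + 1 by rewrite ZRD ZR1.
rewrite iE in hy h2; have h1 := parts4_lower d0 i0 hx hy.
rewrite -addrA nat1r in h2.
rewrite lower_sum4_cons -(parts_cat _ _ (d * (ZR i + 1))) [leLHS]mulrDr [leRHS]mulrDr.
exact: lerD.
Qed.

Lemma lower_sum2P E d xs x i : 0 < d -> (0 <= i)%Z -> enclosed E d i (x :: xs) ->
  d ^+ 2 * ZR (lower_sum2 i (x :: xs)) <= 3 * S * parts 2 (d * ZR i) (d * (ZR i + (size xs)%:R)).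
Proof.
move=> d0; elim: xs x i => [|y xs IH] x i i0; first by rewrite /= ZR0 addr0 parts_refl !mulr0.
move=> [hx hxs]; have i10 : (0 <= i + 1)%Z by lia.
have h2 := IH y (i + 1)%Z i10 hxs; case: hxs => hy _.
have iE : ZR (i + 1)%Z = ZR i + 1 by rewrite ZRD ZR1.
rewrite iE in hy h2; have h1 := parts2_lower d0 i0 hx hy.
rewrite -addrA nat1r in h2.
rewrite lower_sum2_cons -(parts_cat _ _ (d * (ZR i + 1))) [leLHS]mulrDr [leRHS]mulrDr.
exact: lerD.
Qed.

Let two_steps E d i x y z xs : (0 <= i)%Z -> enclosed E d i (x :: y :: z :: xs) ->
  [/\ encloses E (d * ZR i) x, encloses E (d * (ZR i + 1)) y,
      encloses E (d * (ZR i + 2)) z & enclosed E d (i + 2) (z :: xs)].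
Proof.
move=> i0 [hx [hy hz]]; have e : (i + 1 + 1 = i + 2)%Z by lia.
rewrite e in hz; case: (hz) => hz1 _; rewrite !ZRD ZR1 Z2 in hy hz1.
by split.
Qed.

Lemma upper_sum4P E d k xs x i : 0 < d -> (0 <= i)%Z -> size xs = k.*2 ->
  enclosed E d i (x :: xs) ->
  S * parts 4 (d * ZR i) (d * (ZR i + (size xs)%:R)) <= d ^+ 4 * ZR (upper_sum4 E i (x :: xs)).
Proof.
move=> d0; elim: k xs x i => [|k IH] xs x i i0.
  by move/size0nil => ->; rewrite /= ZR0 addr0 parts_refl !mulr0.
case: xs => [|y [|z xs]] //= [sz] h; have [hx hy hz hzs] := two_steps i0 h.
have i20 : (0 <= i + 2)%Z by lia.
have h2 := IH xs z (i + 2)%Z i20 sz hzs; have h1 := parts4_upper d0 i0 hx hy hz.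
have iE : ZR (i + 2)%Z = ZR i + 2 by rewrite ZRD Z2.
rewrite iE -addrA -natrD add2n in h2.
rewrite -/(upper_sum4 _ _ _) upper_sum4_cons -(parts_cat _ _ (d * (ZR i + 2))).
rewrite [leLHS]mulrDr [leRHS]mulrDr; exact: lerD.
Qed.

Lemma upper_sum2P E d k xs x i : 0 < d -> (0 <= i)%Z -> size xs = k.*2 ->
  enclosed E d i (x :: xs) ->
  S * parts 2 (d * ZR i) (d * (ZR i + (size xs)%:R)) <= d ^+ 2 * ZR (upper_sum2 E i (x :: xs)).
Proof.
move=> d0; elim: k xs x i => [|k IH] xs x i i0.
  by move/size0nil => ->; rewrite /= ZR0 addr0 parts_refl !mulr0.
case: xs => [|y [|z xs]] //= [sz] h; have [hx hy hz hzs] := two_steps i0 h.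
have i20 : (0 <= i + 2)%Z by lia.
have h2 := IH xs z (i + 2)%Z i20 sz hzs; have h1 := parts2_upper d0 i0 hx hy hz.
have iE : ZR (i + 2)%Z = ZR i + 2 by rewrite ZRD Z2.
rewrite iE -addrA -natrD add2n in h2.
rewrite -/(upper_sum2 _ _ _) upper_sum2_cons -(parts_cat _ _ (d * (ZR i + 2))).
rewrite [leLHS]mulrDr [leRHS]mulrDr; exact: lerD.
Qed.

(** ** Dyadic shells *)

(** The four sums are quadratures over all shells in units of d ^ p, p = 4 or 2, for
    the mesh d of the innermost one; last_node is the scaled value of psi at the outer
    end. *)
Record sums := Sums { low4 : Z; low2 : Z; up4 : Z; up2 : Z; last_node : Z; last_error : Z }.

(** Going outwards a shell has the same index range and twice the mesh, hence the weights
    2 ^ 4 and 2 ^ 2. *)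
Fixpoint shell_sums n E i xs : sums :=
  if n is n'.+1 then
    let r := shell_sums n' (2 * E + 160) i [seq step x | x <- xs] in
    Sums (lower_sum4 i xs + 16 * low4 r) (lower_sum2 i xs + 4 * low2 r)
         (upper_sum4 E i xs + 16 * up4 r) (upper_sum2 E i xs + 4 * up2 r)
         (last_node r) (last_error r)
  else Sums 0 0 0 0 (head 0%Z xs) E.

Lemma shell_sumsS n E i xs : shell_sums n.+1 E i xs =
  let r := shell_sums n (2 * E + 160) i [seq step x | x <- xs] in
  Sums (lower_sum4 i xs + 16 * low4 r) (lower_sum2 i xs + 4 * low2 r)
       (upper_sum4 E i xs + 16 * up4 r) (upper_sum2 E i xs + 4 * up2 r)
       (last_node r) (last_error r).
Proof. by []. Qed.

Lemma shell_sumsP n E d k x xs : 0 < d -> size xs = k.*2 ->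
  enclosed E d (Z.of_nat k.*2) (x :: xs) ->
  let r := shell_sums n E (Z.of_nat k.*2) (x :: xs) in
  let a := d * (k.*2)%:R in let b := 2 ^+ n * a in
  [/\ d ^+ 4 * ZR (low4 r) <= 5 * S * parts 4 a b,
      d ^+ 2 * ZR (low2 r) <= 3 * S * parts 2 a b,
      S * parts 4 a b <= d ^+ 4 * ZR (up4 r),
      S * parts 2 a b <= d ^+ 2 * ZR (up2 r)
    & encloses (last_error r) b (last_node r)].
Proof.
move=> + sz; have i0 : (0 <= Z.of_nat k.*2)%Z by lia.
have iE : ZR (Z.of_nat k.*2) = (k.*2)%:R by exact: ZR_nat.
elim: n E d x xs sz => [|n IH] E d x xs sz d0 h.
  move: (h) => [hx _]; rewrite iE in hx.
  by rewrite /= expr0 mul1r !parts_refl !ZR0 !mulr0.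
have l4 := lower_sum4P d0 i0 h; have l2 := lower_sum2P d0 i0 h.
have u4 := upper_sum4P d0 i0 sz h; have u2 := upper_sum2P d0 i0 sz h.
have h' := enclosed_step (ltW d0) i0 h.
have sz' : size [seq step x | x <- xs] = k.*2 by rewrite size_map.
have d20 : 0 < 2 * d by rewrite mulr_gt0.
have := IH _ (2 * d) (step x) [seq step x | x <- xs] sz' d20 h'.
rewrite shell_sumsS; move: (shell_sums n _ _ _) => r; rewrite sz iE in l4 l2 u4 u2.
have mE : d * (k.*2%:R + k.*2%:R) = 2 * (d * k.*2%:R) by ring.
rewrite mE in l4 l2 u4 u2.
move: (lower_sum4 _ _) (lower_sum2 _ _) (upper_sum4 _ _ _) (upper_sum2 _ _ _) l4 l2 u4 u2.
have bE : 2 ^+ n.+1 * (d * k.*2%:R) = 2 ^+ n * (2 * (d * k.*2%:R)) by rewrite exprSr; ring.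
move: r => [r4 r2 t4 t2 z E']; cbv beta iota zeta delta [low4 low2 up4 up2 last_node last_error].
rewrite bE -(mulrA 2 d); move: (2 * (d * _)) => c s4 s2 v4 v2 l4 l2 u4 u2.
have e16 : (2 * d) ^+ 4 = 16 * d ^+ 4 by rewrite exprMn -natrX.
have e4 : (2 * d) ^+ 2 = 4 * d ^+ 2 by rewrite exprMn -natrX.
rewrite e16 e4 => -[q1 q2 q3 q4 q5].
have z16 a b : ZR (a + 16 * b) = ZR a + 16 * ZR b by rewrite ZRD (ZRM 16) ZR16.
have z4 a b : ZR (a + 4 * b) = ZR a + 4 * ZR b by rewrite ZRD (ZRM 4) Z4.
rewrite -(parts_cat 4 _ c (2 ^+ n * c)) -(parts_cat 2 _ c (2 ^+ n * c)); move: l4 l2 u4 u2 q1 q2 q3 q4; generalize (ZR scale) => s.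
move=> l4 l2 u4 u2 q1 q2 q3 q4; split; last exact: q5.
- rewrite (z16 s4 r4); lra.
- rewrite (z4 s2 r2); lra.
- rewrite (z16 v4 t4); lra.
- rewrite (z4 v2 t2); lra.
Qed.

End Sums.

(** * The variance and the kurtosis of the limit law *)

Section Estimates.
Context {R : realType}.
Implicit Types (p : nat).

(** The node at v = I / d, in units of d ^ - 3. The remainder v ^ 5 / K amounts to at most 75
    units, and rounding to one more. *)
Lemma start_bounds (d K I q : R) : 0 < d -> 1 <= K <= 1350 -> 0 <= I -> 10 * I <= d ->
  I ^+ 5 <= 75 * (K * d ^+ 2) -> I * I * I - 36 <= 36 * q <= I * I * I ->
  I * (d * d) - q - 1 <= d ^+ 3 * psi (d^-1 * I) <= I * (d * d) - q - 1 + 76.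
Proof.
move=> d0 /andP[K1 K1350] I0 v10 I5 /andP[q1 q2].
have v0 : 0 <= d^-1 * I by rewrite mulr_ge0// invr_ge0 ltW.
have v1 : d^-1 * I <= 10^-1 by rewrite mulrC ler_pdivrMr// mulrC ler_pdivlMr// mulrC.
have dn0 : d != 0 by rewrite gt_eqF.
have K0 : 0 < K by lra.
have Kn0 : K != 0 by rewrite gt_eqF.
have l := psi_ge_cubic (introT andP (conj v0 v1)).
have u : psi (d^-1 * I) <= d^-1 * I - (d^-1 * I) ^+ 3 / 36 + (d^-1 * I) ^+ 5 * K^-1.
  apply: psi_le_quintic; [|by rewrite invf_le1|by rewrite v0].
  by rewrite mulrA ler_pdivlMr//; lra.
have d3 : 0 < d ^+ 3 by rewrite exprn_gt0.
rewrite -(ler_pM2l d3) in l; rewrite -(ler_pM2l d3) in u.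
have el : d ^+ 3 * (d^-1 * I - (d^-1 * I) ^+ 3 / 36) = I * (d * d) - I * I * I / 36.
  by field.
have eu : d ^+ 3 * (d^-1 * I - (d^-1 * I) ^+ 3 / 36 + (d^-1 * I) ^+ 5 * K^-1) =
   I * (d * d) - I * I * I / 36 + I ^+ 5 / (K * d ^+ 2).
  by field; rewrite dn0 Kn0.
have : I ^+ 5 / (K * d ^+ 2) <= 75.
  by rewrite ler_pdivrMr// mulr_gt0// exprn_gt0.
rewrite el in l; rewrite eu in u; move: (psi _) l u => P l u h.
by apply/andP; split; lra.
Qed.

Lemma upper_scaled p (K d N b L W xa xb pa pb s : R) : 0 <= K -> 0 < d -> 0 <= N -> 0 <= b ->
  (d^-1) ^+ p * L <= K * s * (b ^+ p * pb - (d^-1 * N) ^+ p * pa - W) ->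
  s * pb <= xb -> xa <= s * pa ->
  d ^+ p * (K * s) * W <= K * (d ^+ p * b ^+ p * xb) - K * (N ^+ p * xa) - L.
Proof.
move=> K0 d0 N0 b0 h hb ha; have dp : 0 < d ^+ p by rewrite exprn_gt0.
rewrite -(ler_pM2l dp) in h; rewrite !exprMn exprVn in h.
have dn : d ^+ p != 0 by rewrite gt_eqF.
move: (d ^+ p) (b ^+ p) (N ^+ p) dp dn h (exprn_ge0 p b0) (exprn_ge0 p N0) => e f g e0 en h f0 g0.
have e1 : e * (K * s * (f * pb - e^-1 * g * pa - W)) =
  K * (e * f * (s * pb)) - K * (g * (s * pa)) - e * (K * s) * W by field.
have e2 : e * (e^-1 * L) = L by rewrite mulVKf.
rewrite e1 e2 in h.
have h1 : K * (e * f * (s * pb)) <= K * (e * f * xb).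
  by apply: ler_wpM2l => //; apply: ler_wpM2l => //; rewrite mulr_ge0// ltW.
have h2 : K * (g * xa) <= K * (g * (s * pa)) by apply: ler_wpM2l => //; apply: ler_wpM2l.
by lra.
Qed.

Lemma lower_scaled p (d N b U W xa xb pa pb s : R) : 0 < d -> 0 <= N -> 0 <= b ->
  s * (b ^+ p * pb - (d^-1 * N) ^+ p * pa - W) <= (d^-1) ^+ p * U ->
  xb <= s * pb -> s * pa <= xa ->
  d ^+ p * b ^+ p * xb - N ^+ p * xa - U <= d ^+ p * s * W.
Proof.
move=> d0 N0 b0 h hb ha; have dp : 0 < d ^+ p by rewrite exprn_gt0.
rewrite -(ler_pM2l dp) in h; rewrite !exprMn exprVn in h.
have dn : d ^+ p != 0 by rewrite gt_eqF.
move: (d ^+ p) (b ^+ p) (N ^+ p) dp dn h (exprn_ge0 p b0) (exprn_ge0 p N0) => e f g e0 en h f0 g0.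
have e1 : e * (s * (f * pb - e^-1 * g * pa - W)) =
  (e * f * (s * pb)) - (g * (s * pa)) - e * s * W by field.
have e2 : e * (e^-1 * U) = U by rewrite mulVKf.
rewrite e1 e2 in h.
have h1 : (e * f * xb) <= (e * f * (s * pb)).
  by apply: ler_wpM2l => //; rewrite mulr_ge0// ltW.
have h2 : (g * (s * pa)) <= (g * xa) by apply: ler_wpM2l.
by lra.
Qed.

(** The common power of q = 2 pi cancels in the kurtosis up to one factor. *)
Lemma moment_ratio (q lo hi m2 m4 a4 b4 a2 b2 : R) : 0 < lo -> lo <= q <= hi ->
  0 < a4 -> 0 < a2 -> a4 <= q ^+ 5 * m4 <= b4 -> a2 <= q ^+ 3 * m2 <= b2 ->
  [/\ 0 < m2, a2 / hi ^+ 3 <= m2 <= b2 / lo ^+ 3 &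
      lo * a4 / b2 ^+ 2 <= m4 / m2 ^+ 2 <= hi * b4 / a2 ^+ 2].
Proof.
move=> lo0 /andP[q1 q2] a40 a20 /andP[m41 m42] /andP[m21 m22].
have q0 : 0 < q := lt_le_trans lo0 q1.
have hi0 : 0 < hi := lt_le_trans q0 q2.
have b20 : 0 < b2 := lt_le_trans a20 (le_trans m21 m22).
have q30 : 0 < q ^+ 3 by rewrite exprn_gt0.
have q60 : 0 < (q ^+ 3) ^+ 2 by rewrite !exprn_gt0.
have m20 : 0 < m2 by rewrite -(pmulr_rgt0 _ q30) (lt_le_trans a20).
have l3 : lo ^+ 3 <= q ^+ 3 by apply: lerXn2r => //; rewrite nnegrE ltW.
have u3 : q ^+ 3 <= hi ^+ 3 by apply: lerXn2r => //; rewrite nnegrE ltW.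
have s1 : a2 ^+ 2 <= (q ^+ 3 * m2) ^+ 2.
  by apply: lerXn2r (m21); rewrite nnegrE ltW// mulr_gt0.
have s2 : (q ^+ 3 * m2) ^+ 2 <= b2 ^+ 2.
  by apply: lerXn2r (m22); rewrite nnegrE ltW// mulr_gt0.
have m4q : (q ^+ 3) ^+ 2 * m4 = q * (q ^+ 5 * m4) by ring.
have rE : m4 / m2 ^+ 2 = q * (q ^+ 5 * m4) / (q ^+ 3 * m2) ^+ 2.
  by field; rewrite !gt_eqF.
have sq0 : 0 < (q ^+ 3 * m2) ^+ 2 by rewrite exprn_gt0// mulr_gt0.
split=> //.
  rewrite ler_pdivrMr ?exprn_gt0// ler_pdivlMr ?exprn_gt0//.
  rewrite ![m2 * _]mulrC; apply/andP; split.
    by apply: (le_trans m21); rewrite ler_pM2r.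
  by apply: le_trans m22; rewrite ler_pM2r.
rewrite rE; apply/andP; split; apply: ler_pM.
- by rewrite mulr_ge0 ?ltW.
- by rewrite invr_ge0 sqr_ge0.
- by apply: ler_pM => //; rewrite ltW.
- by rewrite lef_pV2 // posrE ?sq0// exprn_gt0.
- by apply: mulr_ge0; [exact: ltW|exact: le_trans (ltW a40) m41].
- by rewrite invr_ge0 ltW.
- by apply: ler_pM => //; [exact: ltW|exact: le_trans (ltW a40) m41].
- by rewrite lef_pV2 // posrE ?sq0// exprn_gt0.
Qed.

Lemma glue_upper (v y z o t u e B : R) : v - y <= t -> y - z <= u -> z - o <= e ->
  u + e + t <= B -> v - o <= B.
Proof. by lra. Qed.

Lemma glue_lower (y z o l : R) : l <= y - z -> o <= z -> 2 * l <= 2 * (y - o).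
Proof. by lra. Qed.

Lemma slack4 : 427 + 91 / 100 + 86 / (100 * 100) + (100 * 100)^-1 + (100 * 100)^-1
  <= 427 + 91 / 100 + 88 / (100 * 100) :> R.
Proof. by lra. Qed.

Lemma slack2 : 20 + 61 / 100 + 13 / (100 * 100) + 9 / (10 * (100 * 100))
  + (100 * (100 * 100))^-1 + (100 * (100 * 100))^-1 <= 20 + 61 / 100 + 14 / (100 * 100) :> R.
Proof. by lra. Qed.

Lemma decimal_intervals (m r : R) : 1655 / (100 * 100) <= m -> m <= 1665 / (100 * 100) ->
  3 + 1635 / (100 * 100) <= r -> r <= 3 + 1645 / (100 * 100) ->
  [/\ `|m - 166 / (10 * 100)| <= 5 / (100 * 100), 0 < r - 3 &
      `|r - 3 - 164 / (10 * 100)| <= 5 / (100 * 100)].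
Proof.
move=> m1 m2 r1 r2; split; last 1 first.
- by rewrite ler_norml; apply/andP; split; clear -r1 r2; lra.
- by rewrite ler_norml; apply/andP; split; clear -m1 m2; lra.
- by clear -r1; lra.
Qed.

(** Twice the bounds found for the moments of kap of order 4 and 2 on the positive half-line, and
    bounds for 2 pi. *)
Let lo4 : R := 2 * (427 + 90 / 100 + 61 / (100 * 100)).
Let hi4 : R := 2 * (427 + 91 / 100 + 88 / (100 * 100)).
Let lo2 : R := 2 * (20 + 61 / 100 + 12 / (100 * 100) + 5 / (10 * (100 * 100))).
Let hi2 : R := 2 * (20 + 61 / 100 + 14 / (100 * 100)).
Let low_2pi : R := 6 + 283 / (10 * 100).
Let high_2pi : R := 6 + 2832 / (100 * 100).

Lemma kurtosis_arith (p m2 m4 : R) : 314 * 100 + 15 <= 100 * 100 * p <= 314 * 100 + 16 ->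
  lo4 <= (2 * p) ^+ 5 * m4 <= hi4 -> lo2 <= (2 * p) ^+ 3 * m2 <= hi2 ->
  [/\ 0 < m2, `|m2 - 166 / (10 * 100)| <= 5 / (100 * 100), 0 < m4 / m2 ^+ 2 - 3 &
      `|m4 / m2 ^+ 2 - 3 - 164 / (10 * 100)| <= 5 / (100 * 100)].
Proof.
move=> /andP[p1 p2].
have l0 : 0 < low_2pi by rewrite /low_2pi; lra.
have h0 : 0 < high_2pi by rewrite /high_2pi; lra.
have q : low_2pi <= 2 * p <= high_2pi.
  by rewrite /low_2pi /high_2pi; apply/andP; split; lra.
have l40 : 0 < lo4 by rewrite /lo4; lra.
have l20 : 0 < lo2 by rewrite /lo2; lra.
have h20 : 0 < hi2 by rewrite /hi2; lra.
have v1 : 1655 / (100 * 100) <= lo2 / high_2pi ^+ 3.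
  by rewrite ler_pdivlMr ?exprn_gt0// /lo2 /high_2pi; lra.
have v2 : hi2 / low_2pi ^+ 3 <= 1665 / (100 * 100).
  by rewrite ler_pdivrMr ?exprn_gt0// /hi2 /low_2pi; lra.
have k1 : 3 + 1635 / (100 * 100) <= low_2pi * lo4 / hi2 ^+ 2.
  by rewrite ler_pdivlMr ?exprn_gt0// /hi2 /low_2pi /lo4; lra.
have k2 : high_2pi * hi4 / lo2 ^+ 2 <= 3 + 1645 / (100 * 100).
  by rewrite ler_pdivrMr ?exprn_gt0// /hi4 /high_2pi /lo2; lra.
move=> h4 h2; have [m0 /andP[m1 m3] /andP[r1 r2]] := moment_ratio l0 q l40 l20 h4 h2.
by have [] := decimal_intervals (le_trans v1 m1) (le_trans m3 v2) (le_trans k1 r1) (le_trans r2 k2).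
Qed.

End Estimates.

Section Certificate.
Context {R : realType}.
Implicit Types (i E x y z : Z) (xs : seq Z) (d v : R) (p k n : nat).
Local Notation ZR := (@ZR R).
Local Notation S := (ZR scale).

(** psi v = v - v ^ 3 / 36 up to the error of start_bounds, at v = i / 2 ^ 16 and in units of 2 ^ - 48. *)
Definition start_node i : Z := (i * (65536 * 65536) - i * i * i / 36 - 1)%Z.

Fixpoint start_nodes n i : seq Z :=
  if n is n'.+1 then start_node i :: start_nodes n' (i + 1) else [::].

Let D : R := ZR 65536.

Let scaleE : S = D ^+ 3.
Proof.
rewrite !exprS expr0 mulr1 -!(@ZRM R); congr (ZR _).
Qed.

Let D_gt0 : 0 < D.
Proof. by rewrite -(@ZR0 R); apply: ZR_lt. Qed.

Let ZR36 : ZR 36 = 36. Proof. by rewrite ZR_num. Qed.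
Let ZR76 : ZR 76 = 76. Proof. by rewrite ZR_num. Qed.
Let ZR10 : ZR 10 = 10. Proof. by rewrite ZR_num. Qed.

Lemma start_encloses i : (1 <= i <= 800)%Z -> encloses 76 (D^-1 * ZR i) (start_node i).
Proof.
move=> [i1 i800]; have /andP[q1 q2] := @Zdiv_bounds R (i * i * i) 36 erefl.
have q0 : (36 * (i * i * i / 36) <= i * i * i)%Z by apply: Z.mul_div_le.
rewrite /start_node; move: (i * i * i / 36)%Z q1 q2 q0 => q q1 q2 q0.
split; first by nia.
have I0 : 0 <= ZR i by apply: ZR_ge0; lia.
have I5 : ZR i ^+ 5 <= 75 * (ZR 1024 * D ^+ 2).
  have -> : 75 * (ZR 1024 * D ^+ 2) = ZR (75 * (1024 * (65536 * 65536))).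
    by rewrite !(@ZRM R) (ZR_num 75) expr2.
  apply: (@le_trans _ _ (ZR 800 ^+ 5)).
    apply: lerXn2r; rewrite ?nnegrE; [exact: I0|exact: ZR_ge0|exact: ZR_le].
  by rewrite !exprS expr0 mulr1 -!(@ZRM R); apply: ZR_le.
have v10 : 10 * ZR i <= D by rewrite -ZR10 -ZRM; apply: ZR_le; lia.
have K1 : 1 <= ZR 1024 <= 1350.
  have -> : 1350 = ZR 1350 by rewrite ZR_num.
  by rewrite -(@ZR1 R); apply/andP; split; apply: ZR_le.
rewrite !ZRB (ZRM i) (ZRM 65536) (@ZR1 R) ZR76 scaleE.
rewrite !(@ZRM R) ZR36 in q1 q2.
exact: (start_bounds D_gt0 K1 I0 v10 I5 (introT andP (conj q1 q2))).
Qed.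

Lemma start_enclosed n i : (1 <= i)%Z -> (i + Z.of_nat n <= 801)%Z ->
  enclosed 76 (D^-1) i (start_nodes n i).
Proof.
elim: n i => [//|n IH] i i1 in8; split; first by apply: start_encloses; lia.
by apply: IH; lia.
Qed.

Lemma size_start_nodes n i : size (start_nodes n i) = n.
Proof. by elim: n i => //= n IH i; rewrite IH. Qed.

(** Twelve shells of 400 cells from v = 400 / 2 ^ 16 to v = 25. Their number
    is dictated by the kurtosis, which lies within 10 ^ - 4 of an end of the interval asserted for it. *)
Definition quadrature : sums := shell_sums 12 76 400 (start_nodes 401 400).

(** The boundary terms of parts and its bound, multiplied by 5 * 2 ^ 64 to make all terms integers. *)
Definition upper_bound4 (r : sums) : Z :=
  (5 * (65536 * 65536 * 65536 * 65536 * (25 * 25 * 25 * 25) * (last_node r + last_error r))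
   - 5 * (400 * 400 * 400 * 400 * start_node 400) - low4 r)%Z.

Definition lower_bound4 (r : sums) : Z :=
  (1 * (65536 * 65536 * 65536 * 65536 * (25 * 25 * 25 * 25) * last_node r)
   - 1 * (400 * 400 * 400 * 400 * (start_node 400 + 76)) - up4 r)%Z.

Definition upper_bound2 (r : sums) : Z :=
  (3 * (65536 * 65536 * (25 * 25) * (last_node r + last_error r))
   - 3 * (400 * 400 * start_node 400) - low2 r)%Z.

Definition lower_bound2 (r : sums) : Z :=
  (1 * (65536 * 65536 * (25 * 25) * last_node r)
   - 1 * (400 * 400 * (start_node 400 + 76)) - up2 r)%Z.

(** The last inequality bounds pi - psi at v = 25 / 2, for the tail. *)
Definition certificate : bool :=
  let r := quadrature in
  [&& (upper_bound4 r * 10000 <=? 4279186 * (65536 * 65536 * 65536 * 65536 * (5 * scale)))%Z,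
      (4279061 * (65536 * 65536 * 65536 * 65536 * (1 * scale)) <=? lower_bound4 r * 10000)%Z,
      (upper_bound2 r * 100000 <=? 2061139 * (65536 * 65536 * (3 * scale)))%Z,
      (2061125 * (65536 * 65536 * (1 * scale)) <=? lower_bound2 r * 100000)%Z &
      (31416 * scale * 16384 - iter 11 step (start_node 400) * 10000 * 16384
         <=? 10000 * scale)%Z].

Lemma certificateP : certificate.
Proof. by vm_cast_no_check (erefl true). Qed.

Let two_num : 2 ^+ 12 * (D^-1 * 400%:R) = ZR 25.
Proof.
have -> : 400%:R = ZR 400 by rewrite ZR_num.
have h : 2 ^+ 12 * ZR 400 = ZR 25 * D.
  by rewrite -(@ZRX2 R 12) -!(@ZRM R); congr (ZR _).
by rewrite mulrCA h mulrC mulfK// gt_eqF.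
Qed.

Lemma ratio_le (e W : R) (n m b c : Z) : 0 < e -> e = ZR c -> (0 < m)%Z ->
  e * W <= ZR b -> (b * m <= n * c)%Z -> W <= ZR n / ZR m.
Proof.
move=> e0 ec m0 h hn.
have m0' : 0 < ZR m by rewrite -(@ZR0 R); exact: ZR_lt.
rewrite ler_pdivlMr// -(ler_pM2l e0) mulrA (mulrC e (ZR n)) {2}ec -ZRM.
by apply: le_trans (_ : ZR (b * m) <= _); [rewrite ZRM ler_pM2r|exact: ZR_le].
Qed.

Lemma ratio_ge (e W : R) (n m b c : Z) : 0 < e -> e = ZR c -> (0 < m)%Z ->
  ZR b <= e * W -> (n * c <= b * m)%Z -> ZR n / ZR m <= W.
Proof.
move=> e0 ec m0 h hn.
have m0' : 0 < ZR m by rewrite -(@ZR0 R); exact: ZR_lt.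
rewrite ler_pdivrMr// -(ler_pM2l e0) mulrA (mulrC e (ZR n)) {1}ec -ZRM.
by apply: le_trans (_ : _ <= ZR (b * m)) _; [exact: ZR_le|rewrite ZRM ler_pM2r].
Qed.

Lemma bound4E (a d b x n y l : Z) : ZR (a * (d * d * d * d * (b * b * b * b) * x) - a * (n * n * n * n * y) - l)
  = ZR a * (ZR d ^+ 4 * ZR b ^+ 4 * ZR x) - ZR a * (ZR n ^+ 4 * ZR y) - ZR l.
Proof. by rewrite !ZRB !(@ZRM R); ring. Qed.

Lemma bound2E (a d b x n y l : Z) : ZR (a * (d * d * (b * b) * x) - a * (n * n * y) - l)
  = ZR a * (ZR d ^+ 2 * ZR b ^+ 2 * ZR x) - ZR a * (ZR n ^+ 2 * ZR y) - ZR l.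
Proof. by rewrite !ZRB !(@ZRM R); ring. Qed.

Lemma weight4E (d k s : Z) : ZR (d * d * d * d * (k * s)) = ZR d ^+ 4 * (ZR k * ZR s).
Proof. by rewrite !(@ZRM R); ring. Qed.

Lemma weight2E (d k s : Z) : ZR (d * d * (k * s)) = ZR d ^+ 2 * (ZR k * ZR s).
Proof. by rewrite !(@ZRM R); ring. Qed.

Definition shell_start : R := D^-1 * 400%:R.

Lemma shell_start_ge0 : 0 <= shell_start.
Proof. by apply: mulr_ge0; [rewrite invr_ge0; exact: ltW D_gt0|exact: ler0n]. Qed.

Let ZR400 : ZR 400 = 400%:R. Proof. by rewrite ZR_num. Qed.

Lemma quadratureP (r := quadrature) (a := shell_start) (b := ZR 25) :
  [/\ D^-1 ^+ 4 * ZR (low4 r) <= 5 * S * parts 4 a b,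
      D^-1 ^+ 2 * ZR (low2 r) <= 3 * S * parts 2 a b,
      S * parts 4 a b <= D^-1 ^+ 4 * ZR (up4 r),
      S * parts 2 a b <= D^-1 ^+ 2 * ZR (up2 r)
    & encloses (last_error r) b (last_node r)].
Proof.
have d0 : 0 < D^-1 by rewrite invr_gt0.
have start_ok : enclosed 76 D^-1 400 (start_nodes 401 400) by apply: start_enclosed.
have := @shell_sumsP R 12 76 D^-1 200 (start_node 400) (start_nodes 400 401) d0
  (size_start_nodes _ _) start_ok.
by cbv zeta; rewrite two_num.
Qed.

Lemma start_value : encloses 76 shell_start (start_node 400).
Proof. by rewrite /shell_start -ZR400; apply: start_encloses. Qed.

Let five : ZR 5 = 5. Proof. by rewrite ZR_num. Qed.
Let three : ZR 3 = 3. Proof. by rewrite ZR_num. Qed.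

Definition shell_moment p : R := wmoment p (ZR 25) - wmoment p shell_start.

Lemma shell_moment_bounds :
  ZR 4279061 / ZR 10000 <= shell_moment 4 <= ZR 4279186 / ZR 10000 /\
  ZR 2061125 / ZR 100000 <= shell_moment 2 <= ZR 2061139 / ZR 100000.
Proof.
have [l4 l2 u4 u2 [_ /andP[e1 e2]]] := quadratureP.
have [_ /andP[s1 s2]] := start_value.
have := certificateP; rewrite /certificate; cbv zeta.
move: quadrature l4 l2 u4 u2 e1 e2 => r l4 l2 u4 u2 e1 e2.
case/and5P => /Z.leb_le c1 /Z.leb_le c2 /Z.leb_le c3 /Z.leb_le c4 _.
have n0 : 0 <= ZR 400 by apply: ZR_ge0.
have b0 : 0 <= ZR 25 by apply: ZR_ge0.
have k5 : 0 <= ZR 5 by apply: ZR_ge0.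
have k3 : 0 <= ZR 3 by apply: ZR_ge0.
have S0 : 0 < S by exact: scale_gt0.
have D0 := D_gt0.
rewrite /parts /shell_start -ZR400 -five -three in l4 l2 u4 u2 s1 s2.
rewrite /shell_moment /shell_start -ZR400.
rewrite -ZRD in e2; rewrite -ZRD in s2.
have w4 (k : Z) : 0 < ZR k -> 0 < D ^+ 4 * (ZR k * S) by move=> ?; rewrite mulr_gt0 ?mulr_gt0 ?exprn_gt0.
have w2 (k : Z) : 0 < ZR k -> 0 < D ^+ 2 * (ZR k * S) by move=> ?; rewrite mulr_gt0 ?mulr_gt0 ?exprn_gt0.
have z1 : 0 < ZR 1 by rewrite ZR1.
have z3 : 0 < ZR 3 by rewrite three.
have z5 : 0 < ZR 5 by rewrite five.
have p4 : (0 < 10000)%Z by [].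
have p5 : (0 < 100000)%Z by [].
have f4 := lower_scaled D0 n0 b0 u4 e1 s2.
have f2 := lower_scaled D0 n0 b0 u2 e1 s2.
have g4 := upper_scaled k5 D0 n0 b0 l4 e2 s1.
have g2 := upper_scaled k3 D0 n0 b0 l2 e2 s1.
have q1 := ratio_ge (w4 1%Z z1) (esym (weight4E 65536 1 scale)) p4 _ c2.
have q2 := ratio_le (w4 5%Z z5) (esym (weight4E 65536 5 scale)) p4 _ c1.
have q3 := ratio_ge (w2 1%Z z1) (esym (weight2E 65536 1 scale)) p5 _ c4.
have q4 := ratio_le (w2 3%Z z3) (esym (weight2E 65536 3 scale)) p5 _ c3.
split; apply/andP; split.
- by apply: q1; rewrite bound4E ZR1 !mul1r.
- by apply: q2; rewrite bound4E.
- by apply: q3; rewrite bound2E ZR1 !mul1r.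
- by apply: q4; rewrite bound2E.
Qed.

(** Between pi and 4 < 2 pi the sine is not positive. *)
Lemma sin_pos_lt_pi (x : R) : 0 <= x <= 4 -> 0 < sin x -> x < pi.
Proof.
move=> /andP[x0 x4] sx; rewrite ltNge; apply/negP => px.
have y : 0 <= x - pi <= pi by have := @pihalf_ge1 R; rewrite subr_ge0 px/=; lra.
by have := sin_ge0_pi y; rewrite -[x in sin x](subrK pi) sinDpi in sx *; lra.
Qed.

Lemma sin_neg_gt_pi (x : R) : 0 <= x -> sin x < 0 -> pi < x.
Proof.
move=> x0 sx; rewrite ltNge; apply/negP => px.
by have := @sin_ge0_pi R x; rewrite x0 px => /(_ isT); lra.
Qed.

Definition pi_low : Z := (31415 * scale / 10000 + 1)%Z.
Definition pi_high : Z := (31416 * scale / 10000)%Z.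

Lemma pi_certificate :
  [&& (0 <=? pi_low)%Z, (pi_low <=? 4 * scale)%Z, (31415 * scale <=? 10000 * pi_low)%Z,
      (1 <=? sine_fx pi_low)%Z, (0 <=? pi_high)%Z, (pi_high <=? 4 * scale)%Z,
      (10000 * pi_high <=? 31416 * scale)%Z & (sine_fx pi_high <=? -161)%Z].
Proof. by vm_cast_no_check (erefl true). Qed.

Lemma pi_bounds : ZR 31415 <= ZR 10000 * pi <= ZR 31416.
Proof.
have S0 : 0 < S by exact: scale_gt0.
have Z4 : ZR 4 = 4 by rewrite ZR_num.
have Z160 : ZR 160 = 160 by rewrite ZR_num.
have := pi_certificate; move: pi_low pi_high => x y.
case/and5P => /Z.leb_le x0 /Z.leb_le x4 /Z.leb_le xp /Z.leb_le xs.
case/and4P => /Z.leb_le y0 /Z.leb_le y4 /Z.leb_le yp /Z.leb_le ys.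
have range z : (0 <= z)%Z -> (z <= 4 * scale)%Z -> 0 <= ZR z / S <= 4.
  move=> z0 z4; rewrite divr_ge0 ?(ZR_ge0 z0) ?(ltW S0)//=.
  by rewrite ler_pdivrMr// -Z4 -ZRM; exact: ZR_le.
have /andP[bx _] := sine_fx_bounds (range x x0 x4).
have /andP[_ by_] := sine_fx_bounds (range y y0 y4).
have sx : 0 < sin (ZR x / S).
  rewrite -(pmulr_rgt0 _ S0); apply: lt_le_trans bx.
  by apply: lt_le_trans (ZR_le xs); rewrite ZR1.
have sy : sin (ZR y / S) < 0.
  rewrite -(pmulr_rlt0 _ S0); apply: le_lt_trans by_ _.
  rewrite -Z160 -ZRD -(@ZR0 R); apply: ZR_lt.
  apply: Z.le_lt_trans (_ : (-161 + 160 < 0)%Z); last by [].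
  exact: Zplus_le_compat_r.
have lx := sin_pos_lt_pi (range x x0 x4) sx.
have /andP[ry0 _] := range y y0 y4.
have ly := sin_neg_gt_pi ry0 sy.
have k0 : 0 < ZR 10000 by rewrite -(@ZR0 R); exact: ZR_lt.
apply/andP; split.
  apply: (@le_trans _ _ (ZR 10000 * (ZR x / S))); last by rewrite ler_pM2l// ltW.
  by rewrite mulrA ler_pdivlMr// -!(@ZRM R); exact: ZR_le.
apply: (@le_trans _ _ (ZR 10000 * (ZR y / S))); first by rewrite ler_pM2l// ltW.
by rewrite mulrA ler_pdivrMr// -!(@ZRM R); exact: ZR_le.
Qed.

Let Z100 : ZR 100 = 100. Proof. by rewrite ZR_num. Qed.

Let decimal (a b c : Z) : ZR (a * (100 * 100) + b * 100 + c) = ZR a * (100 * 100) + ZR b * 100 + ZR c.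
Proof. by rewrite !ZRD !(@ZRM R) Z100. Qed.

Lemma pi_decimal : 314 * 100 + 15 <= 100 * 100 * (pi : R) <= 314 * 100 + 16.
Proof.
have := pi_bounds; have z (p : positive) : ZR (Z.pos p) = (Pos.to_nat p)%:R by exact: ZR_num.
have -> : ZR 10000 = 100 * 100 by rewrite -Z100 -ZRM.
have -> : ZR 31415 = ZR 314 * 100 + ZR 15 by rewrite -Z100 -ZRM -ZRD.
have -> : ZR 31416 = ZR 314 * 100 + ZR 16 by rewrite -Z100 -ZRM -ZRD.
by rewrite !z.
Qed.

Lemma half_last : 2 ^+ 11 * shell_start = ZR 25 / 2.
Proof.
have := two_num; rewrite -/shell_start exprS -mulrA => <-.
by rewrite [2 * _]mulrC mulfK.
Qed.

(** The node at half the last abscissa is reached after 11 doublings of the first node. *)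
Lemma last_deficit : 100 * 100 * (pi - psi (ZR 25 / 2)) <= 1.
Proof.
have a0 := shell_start_ge0.
have [E' [_ /andP[xU _]]] := encloses_iter 11 a0 start_value; rewrite half_last in xU.
have := certificateP; rewrite /certificate; cbv zeta.
move: quadrature => r /and5P[_ _ _ _ /Z.leb_le].
move: (iter 11 _ _) xU => x xU h.
have S0 : 0 < S by exact: scale_gt0.
have /andP[_ pu] := pi_bounds.
have k0 : 0 < ZR 10000 by rewrite -(@ZR0 R); exact: ZR_lt.
have l0 : 0 < ZR 16384 by rewrite -(@ZR0 R); exact: ZR_lt.
have l1 : ZR 10000 <= ZR 16384 by exact: ZR_le.
have kE : 100 * 100 = ZR 10000 by rewrite -Z100 -ZRM.
have {}h : ZR 31416 * S * ZR 16384 - ZR x * ZR 10000 * ZR 16384 <= ZR 10000 * S.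
  by rewrite -!(@ZRM R) -ZRB; exact: ZR_le.
rewrite kE; move: (ZR 10000) (ZR 16384) (ZR 31416) (psi _) pu k0 l0 l1 h xU => k l P w pu k0 l0 l1 h xU.
have wpi : w <= pi -> k * (pi - w) <= l * (pi - w) by move=> ?; rewrite ler_wpM2r// subr_ge0.
have h1 : k * S * (l * (pi - w)) <= k * S * 1.
  rewrite mulr1; apply: le_trans h.
  have e1 : S * l * (k * pi) <= S * l * P by apply: ler_wpM2l => //; rewrite mulr_ge0// ltW.
  have e2 : k * l * ZR x <= k * l * (S * w) by apply: ler_wpM2l => //; rewrite mulr_ge0// ltW.
  move: (S) (ZR x) e1 e2 => s X e1 e2; lra.
rewrite ler_pM2l ?mulr_gt0// in h1.
case: (leP w pi) => [/wpi h2|h2]; first exact: le_trans h1.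
by apply: (@le_trans _ _ 0) => //; rewrite pmulr_rle0// subr_le0 ltW.
Qed.

Lemma shell_start_small : 0 <= shell_start <= 100^-1.
Proof.
rewrite shell_start_ge0 /shell_start /= mulrC ler_pdivrMr//.
rewrite ler_pdivlMl// -Z100 -ZR400 -ZRM; exact: ZR_le.
Qed.

Lemma shell_moment_decimal :
  427 + 90 / 100 + 61 / (100 * 100) <= shell_moment 4 <= 427 + 91 / 100 + 86 / (100 * 100) /\
  20 + 61 / 100 + 12 / (100 * 100) + 5 / (10 * (100 * 100)) <= shell_moment 2 <=
  20 + 61 / 100 + 13 / (100 * 100) + 9 / (10 * (100 * 100)).
Proof.
have := shell_moment_bounds.
have -> : ZR 10000 = 100 * 100 by rewrite -Z100 -ZRM.
have -> : ZR 100000 = 10 * (100 * 100) by rewrite -Z100 -ZR10 -!(@ZRM R).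
have -> : ZR 4279061 = ZR 427 * (100 * 100) + ZR 90 * 100 + ZR 61 by rewrite -decimal.
have -> : ZR 4279186 = ZR 427 * (100 * 100) + ZR 91 * 100 + ZR 86 by rewrite -decimal.
have -> : ZR 2061125 = ZR 206 * (100 * 100) + ZR 11 * 100 + ZR 25 by rewrite -decimal.
have -> : ZR 2061139 = ZR 206 * (100 * 100) + ZR 11 * 100 + ZR 39 by rewrite -decimal.
have -> : ZR 427 = 427 by rewrite ZR_num.
have -> : ZR 90 = 90 by rewrite ZR_num.
have -> : ZR 61 = 61 by rewrite ZR_num.
have -> : ZR 91 = 91 by rewrite ZR_num.
have -> : ZR 86 = 86 by rewrite ZR_num.
have -> : ZR 206 = 206 by rewrite ZR_num.
have -> : ZR 11 = 11 by rewrite ZR_num.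
have -> : ZR 25 = 25 by rewrite ZR_num.
have -> : ZR 39 = 39 by rewrite ZR_num.
move=> [/andP[h1 h2] /andP[h3 h4]].
by split; apply/andP; split; lra.
Qed.

(** 25 = 2 * (25 / 2), so the tail estimate applies with the deficit at 25 / 2. *)
Lemma wmoment4_far v : ZR 25 <= v -> wmoment 4 v - wmoment 4 (ZR 25) <= (100 * 100)^-1.
Proof.
move=> hv; have h := last_deficit.
have w0 : 0 <= pi - psi (ZR 25 / 2) by rewrite subr_ge0 ltW// psi_lt_pi.
have w1 : pi - psi (ZR 25 / 2) <= 1 by lra.
have U0 : 0 < ZR 25 / 2 by rewrite divr_gt0// -(@ZR0 R); exact: ZR_lt.
have TU : 2 * (ZR 25 / 2) = ZR 25 by rewrite mulrC divfK.
have := @wmoment4_tail R _ v U0 w1; rewrite TU => /(_ hv) t.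
apply: (le_trans t).
have Z25 : ZR 25 = 25 by rewrite ZR_num.
have -> : 4 * (ZR 25 / 2) ^+ 2 = 625 by rewrite Z25; field.
move: (pi - _) h w0 => w h w0.
have h2 : (625 * w) ^+ 2 <= (16^-1) ^+ 2 by apply: lerXn2r; rewrite ?nnegrE; lra.
have h3 : (625 * w) ^+ 2 * w <= (16^-1) ^+ 2 * w by apply: ler_wpM2r.
by rewrite -mulrA; lra.
Qed.

Lemma wmoment2_far v : ZR 25 <= v -> wmoment 2 v - wmoment 2 (ZR 25) <= (100 * (100 * 100))^-1.
Proof.
move=> hv; have T0 : 0 < ZR 25 by rewrite -(@ZR0 R); exact: ZR_lt.
have := wmoment2_tail T0 hv; have := wmoment4_far hv.
have -> : ZR 25 = 25 by rewrite ZR_num.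
move: (wmoment 4 v - _) (wmoment 2 v - _) => a b h1 h2; lra.
Qed.

Lemma wmoment_upper p v B : 0 <= v -> wmoment p (ZR 25) - wmoment p 0 <= B ->
  (ZR 25 <= v -> wmoment p v - wmoment p 0 <= B) -> wmoment p v - wmoment p 0 <= B.
Proof.
move=> v0 h1 h2; case: (leP (ZR 25) v) => [/h2//|vT].
by apply: le_trans h1; rewrite lerD2r wmoment_nondecreasing// ltW.
Qed.

Lemma kmoment_bounds :
  2 * (427 + 90 / 100 + 61 / (100 * 100)) <= (2 * (pi : R)) ^+ 5 * kmoment 4
    <= 2 * (427 + 91 / 100 + 88 / (100 * 100)) /\
  2 * (20 + 61 / 100 + 12 / (100 * 100) + 5 / (10 * (100 * 100))) <= (2 * (pi : R)) ^+ 3 * kmoment 2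
    <= 2 * (20 + 61 / 100 + 14 / (100 * 100)).
Proof.
have [/andP[l4 u4] /andP[l2 u2]] := shell_moment_decimal.
have /andP[a0 a1] := shell_start_small.
have T0 : 0 <= ZR 25 by exact: ZR_ge0.
have aX p : shell_start ^+ p <= (100^-1) ^+ p by apply: lerXn2r; rewrite ?nnegrE.
have s4 := wmoment_small 4 a0; have s2 := wmoment_small 2 a0.
have s4' := @wmoment_nondecreasing R 4 0 _ (lexx 0) a0.
have s2' := @wmoment_nondecreasing R 2 0 _ (lexx 0) a0.
have a5 : shell_start ^+ 5 <= (100 * 100)^-1.
  by apply: le_trans (aX 5) _; lra.
have a3 : shell_start ^+ 3 <= (100 * (100 * 100))^-1.
  by apply: le_trans (aX 3) _; lra.
rewrite /shell_moment in l4 u4 l2 u2.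
have e4 := le_trans s4 a5; have e2 := le_trans s2 a3.
have t4 : 0 <= (100 * 100)^-1 :> R by rewrite invr_ge0 mulr_ge0.
have t2 : 0 <= (100 * (100 * 100))^-1 :> R by rewrite invr_ge0 !mulr_ge0.
have r p : wmoment p (ZR 25) - wmoment p (ZR 25) = 0 by rewrite subrr.
split.
- have [|up low] := @kmoment_wmoment R 4 (427 + 91 / 100 + 88 / (100 * 100)) isT.
    move=> v v0; apply: (wmoment_upper v0) => [|/wmoment4_far t]; last exact: glue_upper t u4 e4 slack4.
    by apply: (glue_upper _ u4 e4 slack4); rewrite r.
  by apply/andP; split; [exact: le_trans (glue_lower l4 s4') (low _ T0)|exact: up].
- have [|up low] := @kmoment_wmoment R 2 (20 + 61 / 100 + 14 / (100 * 100)) isT.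
    move=> v v0; apply: (wmoment_upper v0) => [|/wmoment2_far t]; last exact: glue_upper t u2 e2 slack2.
    by apply: (glue_upper _ u2 e2 slack2); rewrite r.
  by apply/andP; split; [exact: le_trans (glue_lower l2 s2') (low _ T0)|exact: up].
Qed.

Lemma kmoment_values : [/\ 0 < (kmoment 2 : R), `|(kmoment 2 : R) - 166 / 1000| <= 5 / 10000,
  0 < (kmoment 4 / kmoment 2 ^+ 2 - 3 : R) &
  `|(kmoment 4 / kmoment 2 ^+ 2 - 3 : R) - 164 / 1000| <= 5 / 10000].
Proof.
have [h4 h2] := kmoment_bounds.
have e1 : 1000 = 10 * 100 :> R by rewrite -natrM.
have e2 : 10000 = 100 * 100 :> R by rewrite -natrM.
have [m0 v k0 k] := kurtosis_arith pi_decimal h4 h2.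
by rewrite e1 e2; split.
Qed.

End Certificate.

(** * The limit theorem for iterated densities *)

Theorem theorem9 (R : realType) :
  exists (K : R -> R) (mu : probability (measurableTypeR R) R),
  (* K is the linearizer, unique already as a germ at 0 *)
  (koenigs_linearizer_on setT K /\
   (forall (r : R) (L : R -> R), 0 < r ->
      koenigs_linearizer_on [set u | `|u| < r] L ->
      forall u, `|u| < r -> L u = K u)) /\
  (* K is an analytic increasing bijection and the cdf of the symmetric law mu,
     which has an analytic density *)
  [/\ real_analytic K,
      {homo K : u v / u < v},
      set_bij setT `]0, 1[ K
    & (forall u, law_cdf mu u = (K u)%:E)] /\
  (symmetric_law mu /\
   exists2 k : R -> R, real_analytic k & has_density mu k) /\
  (* limit law, moments and variance of the rescaled X n *)
  (forall (f : R -> R) (m : R), Dplus f -> is_median f m ->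
   forall (d : nat -> measure_display) (T : forall n, measurableType (d n))
     (P : forall n, probability (T n) R) (X : forall n, {RV P n >-> R}),
   (forall n, has_density (distribution (P n) (X n)) (iter n rho f)) ->
   let Y n := fun w : T n => 2 ^+ n * f m * (X n w - m) in
   cvg_in_distribution P Y mu /\
   (forall eps : R, 0 < eps ->
      ('E_(P 0%N)[fun w => (`|X 0%N w| `^ eps)%R] < +oo)%E ->
      cvg_moments P Y mu /\
      (fun n => fine ('V_(P n)[X n])%E : R^o) ~_\oo
      (fun n => law_variance mu * f m ^- 2 * 4 ^- n : R^o))) /\
  `|law_variance mu - 166 / 1000| <= 5 / 10000 /\
  (* tails of the limit law *)
  (forall u, 1 - K (2 * u) = A (1 - K u)) /\
  (exists Theta : R -> R,
     [/\ continuous Theta,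
         (forall x, 0 < Theta x),
         (forall x, Theta (x + 1) = Theta x)
       & exists (h : R -> R) (C : R),
           (\forall u \near +oo, `|h u| <= C * u `^ (- log2 3)) /\
           forall u, 0 < u ->
             - ln (1 - K u) = u `^ log2 3 * Theta (log2 u) * (1 + h u)]) /\
  [/\ compressed_exponential_tails mu (log2 3),
      lighter_than_exponential mu
    & heavier_than_gaussian mu] /\
  [/\ endpoint_degree (A : R -> R) 3,
      is_derive (2^-1 : R) (1 : R) A 2
    & log2 3 = ln 3 / ln ('D_1 A (2^-1 : R))] /\
  0 < excess_kurtosis mu /\
  `|excess_kurtosis mu - 164 / 1000| <= 5 / 10000.
Proof.
have [var_gt0 var_value kurt_gt0 kurt_value] := @kmoment_values R.
exists Kfun, koenigs_law; split; [split|split; [split|split; [split|split; [|split;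
  [|split; [|split; [|split; [|split; [split|split]]]]]]]]].
- exact: Kfun_koenigs.
- exact: Kfun_unique.
- exact: Kfun_analytic.
- by move=> u v uv; rewrite /Kfun ltrD2l phi_increasing.
- exact: Kfun_bij.
- move=> u; by rewrite /law_cdf -koenigs_law_cdf set_itvE.
- exact: koenigs_law_symmetric.
- by exists kappa; [exact: kappa_analytic|exact: koenigs_law_density].
- move=> f m fD fm d T P X Xf Y; split; first exact: rescaled_cvg_in_distribution.
  move=> eps eps0 Xeps; split; first exact: (rescaled_cvg_moments fD fm Xf eps0 Xeps).
  exact: (variance_equivalent fD fm Xf eps0 Xeps var_gt0).
- by rewrite law_variance_kmoment.
- by move=> u; rewrite !Kfun_gtail gtail_double A_Aform// ltW// gtail_gt0.
- by exists Theta; exact: tail_exponent_Theta.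
- by split; [exact: koenigs_law_compressed|exact: koenigs_law_lighter|exact: koenigs_law_heavier].
- exact: A_endpoint_degree.
- exact: A_derive_half.
- by rewrite (@derive_val _ _ _ _ _ _ _ (@A_derive_half R)).
- by rewrite excess_kurtosis_kmoment.
- by rewrite excess_kurtosis_kmoment.
Qed.
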